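(* Suppose $\Phi$ is adapted to the natural filtration of $L$ with $\mathbb E[\sup_{s\in[-r,0]}|\Phi_s|^2]<\infty$ and $\mathbb E[L_1^4]<\infty$, let $X$ be the unique strong solution of the CDGARCH variance equation with initial condition $\Phi$, let $m(t):=\mathbb E[X_t]$ for $t\in[-r,\infty)$, and let $\phi(u)=\mathbb E[\Phi_u]$ on $[-r,0]$, assumed positive. Write $c_0:=c_\mu-\kappa_2c_\nu$ and $f:=f_\mu+\kappa_2f_\nu$. Then: (a) $m$ is finite-valued, continuously differentiable on $(0,\infty)$ and satisfies $\frac{d}{dt}m(t)=\eta-c_0m(t)+\int_{-r}^0m(t+u)f(u)\,du$ for $t>0$, with $m(u)=\phi(u)$ for $u\in[-r,0]$; (b) $m$ satisfies the renewal equation $m(t)=\int_0^t\zeta(t-u)m(u)\,du+h(t)$, $t>0$, with $m(0)=\phi(0)$, where $\zeta(t)=-c_0\mathbf 1_{(0,\infty)}(t)+\int_0^{t\wedge r}f(-u)\,du$ for $t\in[0,\infty)$ and $$h(t)=m(0)+\frac{\eta}{\zeta(r)}\int_0^t\zeta(u)\,du+\int_0^r(\zeta(t+u)-\zeta(u))\Big(m(-u)+\frac{\eta}{\zeta(r)}\Big)du.$$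
   Context: Let $p,q\ge0$, $r:=p\vee q>0$, $(\Omega,\mathcal F,\mathbb F=(\mathcal F_t)_{t\ge-r},\mathbb P)$ a filtered probability space with the usual conditions, and $(L_t)_{t\ge-r}$ a càdlàg adapted centered square-integrable Lévy process with $L_{-r}=0$, increments independent of the past and stationary, Lévy measure $\Pi_L$ and no Brownian component; $S=[L,L]$, $S_t=\sum_{-r<s\le t}(\Delta L_s)^2$, $\kappa_2=\int z^2\Pi_L(dz)$. Parameters: $\eta>0$, $c_\mu,c_\nu>0$, $f_\mu,f_\nu$ nonnegative continuous supported on $[-p,0]$, $[-q,0]$; $\mu(E)=\int_{E\cap[-p,0]}f_\mu-c_\mu\delta_0(E)$, $\nu(E)=\int_{E\cap[-q,0]}f_\nu+c_\nu\delta_0(E)$. Extend $\Phi_t=\Phi_0$ for $t>0$, $\theta_t=\Phi_t+\eta t\mathbf 1_{[0,\infty)}(t)$. CDGARCH variance equation: $X_t=\theta_t+\int_{-p}^0\int_u^{t+u}X_s\,ds\,\mu(du)+\int_{-q}^0\int_{u+}^{t+u}X_{s-}\,dS_s\,\nu(du)$, $t\ge0$, $X=\Phi$ on $[-r,0]$; its strong solution is the unique adapted càdlàg $X$ with $\mathbb E[\sup_{s\in[-r,t]}|X_s|^2]<\infty$ for all $t$ satisfying it. In (b), $m(-u)$ for $u\in[0,r]$ equals $\phi(-u)$.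
   Formalization: Part (b) is stated under the additional assumption ζ(r) ≠ 0, since h contains η/ζ(r), which is undefined when c_0 equals the integral of f over [-r,0]; part (a) is stated without this assumption. *)

(* Defs.v *)
From HB Require Import structures.
From mathcomp Require Import all_boot all_order all_algebra.
From mathcomp Require Import all_classical all_reals all_analysis.
Set Implicit Arguments. Unset Strict Implicit. Unset Printing Implicit Defensive.
Import Order.TTheory GRing.Theory Num.Theory.
Import numFieldNormedType.Exports.
Local Open Scope classical_set_scope.
Local Open Scope ring_scope.

Section CDGARCH.
Context {R : realType}.

Definition Lint (a b : R) (g : R -> R) : R :=
  \int[@lebesgue_measure R]_(x in `[a, b]) g x.

Definition left_lim (g : R -> R) (t : R) : R := lim (g x @[x --> t^'-]).
Definition jump (g : R -> R) (t : R) : R := g t - left_lim g t.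

Definition cadlag_on (a : R) (g : R -> R) : Prop :=
  (forall t, a <= t -> g x @[x --> t^'+] --> g t) /\
  (forall t, a < t -> cvg (g x @[x --> t^'-])).

Definition sup_sq (g : R -> R) (a b : R) : \bar R :=
  ereal_sup [set ((g s) ^+ 2)%:E | s in `[a, b]].

(* Pathwise Lebesgue-Stieltjes integral  int_{a+}^{b} Y_{s-} dS_s  where
   S_t = sum_{-r < s <= t} (Delta L_s)^2 is a pure-jump increasing process,
   so that dS = sum_s (Delta L_s)^2 delta_s:  it equals
   sum_{a < s <= b} Y_{s-} (Delta L_s)^2  (positive part minus negative part). *)
Definition jump_integral (Y L : R -> R) (a b : R) : R :=
  fine ((\esum_(s in `]a, b]) ((Num.max (left_lim Y s) 0) * jump L s ^+ 2)%:E)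
      - (\esum_(s in `]a, b]) ((Num.max (- left_lim Y s) 0) * jump L s ^+ 2)%:E))%E.

Context {d : measure_display} {Omega : measurableType d}.

Definition expect (P : probability Omega R) (Y : Omega -> R) : R :=
  fine (\int[P]_w (Y w)%:E).

Definition measurable_wrt (G : set (set Omega)) (Y : Omega -> R) : Prop :=
  forall B : set R, measurable B -> G (Y @^-1` B).

Definition filtration (r : R) (F : R -> set (set Omega)) : Prop :=
  (forall t, -r <= t -> sigma_algebra setT (F t) /\ F t `<=` measurable) /\
  (forall s t, -r <= s -> s <= t -> F s `<=` F t).

Definition usual_conditions (P : probability Omega R) (r : R)
    (F : R -> set (set Omega)) : Prop :=
  (forall N A, measurable N -> P N = 0%E -> A `<=` N -> measurable A) /\
  (forall N, measurable N -> P N = 0%E -> F (-r) N) /\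
  (forall t, -r <= t -> F t = \bigcap_(s in `]t, +oo[) F s).

Definition adapted (r : R) (F : R -> set (set Omega)) (Y : Omega -> R -> R) :=
  forall t, -r <= t -> measurable_wrt (F t) (Y^~ t).

Definition natural_filtration (P : probability Omega R) (r : R)
    (L : Omega -> R -> R) (t : R) : set (set Omega) :=
  <<s [set A | exists s (B : set R), [/\ -r <= s, s <= t, measurable B &
                                         A = (L^~ s) @^-1` B]]
      `|` [set N | measurable N /\ P N = 0%E] >>.

Definition centered_sq_levy (P : probability Omega R) (r : R)
    (F : R -> set (set Omega)) (L : Omega -> R -> R) : Prop :=
  [/\ adapted r F L /\ (forall w, cadlag_on (-r) (L w)), (forall w, L w (-r) = 0),
   (forall s t, -r <= s -> s <= t -> forall A (B : set R), F s A -> measurable B ->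
      P (A `&` ((fun w => L w t - L w s) @^-1` B)) =
      (P A * P ((fun w => (L w t - L w s)%R) @^-1` B))%E),
   (forall s t h, -r <= s -> -r <= t -> 0 <= h -> forall B : set R, measurable B ->
      P ((fun w => L w (s + h) - L w s) @^-1` B) =
      P ((fun w => L w (t + h) - L w t) @^-1` B)) &
   (forall t, -r <= t ->
      [/\ P.-integrable setT (fun w => (L w t)%:E),
          P.-integrable setT (fun w => ((L w t) ^+ 2)%:E) &
          expect P (L^~ t) = 0])].

Definition levy_measure (Pi : {measure set R -> \bar R}) : Prop :=
  Pi [set 0] = 0%E /\ (\int[Pi]_z (Num.min 1 (z ^+ 2))%:E < +oo)%E.

(* Levy-Khintchine formula for the unit-time increment L_{-r+1} - L_{-r}
   with Levy measure Pi, Gaussian coefficient sigma^2 = 0 (no Brownian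
   component) and some drift b, written with real and imaginary parts:
   E[exp(iuL)] = exp(A(u) + i B(u)). *)
Definition levy_khintchine_no_brownian (P : probability Omega R) (r : R)
    (L : Omega -> R -> R) (Pi : {measure set R -> \bar R}) : Prop :=
  exists b : R, forall u : R,
    let A := \int[Pi]_z (cos (u * z) - 1) in
    let B := u * b + \int[Pi]_z (sin (u * z) - (if `|z| < 1 then u * z else 0)) in
    expect P (fun w => cos (u * L w (-r + 1))) = expR A * cos B /\
    expect P (fun w => sin (u * L w (-r + 1))) = expR A * sin B.

Definition theta (Phi : Omega -> R -> R) (eta : R) (w : Omega) (t : R) : R :=
  if t <= 0 then Phi w t else Phi w 0 + eta * t.

(* right-hand side of the CDGARCH variance equation, with
   mu(du) = f_mu(u) 1_[-p,0](u) du - c_mu delta_0(du),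
   nu(du) = f_nu(u) 1_[-q,0](u) du + c_nu delta_0(du) *)
Definition cdgarch_rhs (p q eta c_mu c_nu : R) (f_mu f_nu : R -> R)
    (Phi L X : Omega -> R -> R) (w : Omega) (t : R) : R :=
  theta Phi eta w t
  + (Lint (-p) 0 (fun u => f_mu u * Lint u (t + u) (X w)) - c_mu * Lint 0 t (X w))
  + (Lint (-q) 0 (fun u => f_nu u * jump_integral (X w) (L w) u (t + u))
     + c_nu * jump_integral (X w) (L w) 0 t).

Definition strong_solution (P : probability Omega R) (p q r eta c_mu c_nu : R)
    (f_mu f_nu : R -> R) (F : R -> set (set Omega))
    (Phi L X : Omega -> R -> R) : Prop :=
  [/\ adapted r F X, (forall w, cadlag_on (-r) (X w)),
   (forall t, -r <= t -> (\int[P]_w sup_sq (X w) (-r) t < +oo)%E) &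
   {ae P, forall w, (forall s, -r <= s -> s <= 0 -> X w s = Phi w s) /\
          (forall t, 0 <= t ->
             X w t = cdgarch_rhs p q eta c_mu c_nu f_mu f_nu Phi L X w t)}].

End CDGARCH.

(* Main.v *)
Require Import Defs.
From HB Require Import structures.
From mathcomp Require Import all_boot all_order all_algebra.
From mathcomp Require Import all_classical all_reals all_analysis.
From mathcomp Require Import measurable_realfun ring lra zify.
Import Order.TTheory GRing.Theory Num.Theory.
Import numFieldNormedType.Exports.
Local Open Scope classical_set_scope.
Local Open Scope ring_scope.
Set Implicit Arguments.
Unset Strict Implicit.
Unset Printing Implicit Defensive.

(** Taking expectations in the variance equation turns it into a deterministic
    delay equation for [m]. The stochastic input is the compensation formula
      E sum_(a < s <= b) X_(s-) (Delta L_s)^2 = kappa_2 int_a^b E X_s ds.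
    For a left-constant integrand it is the limit of E[Y sum_i g(L_(t_(i+1)) -
    L_(t_i))] along meshes, for kernels [g] that vanish near 0 (so that only the
    finitely many large jumps of each path survive) and that are, up to small
    multiples of [x^2], combinations of cosines: the mean of the latter is read
    off the Levy-Khintchine formula. Letting [g] increase to [x^2] and
    approximating [X] by left-constant step processes gives the formula.
    Fubini then yields m' = eta - c0 m + k with [k] a continuous window integral;
    integrating [k] against the primitive [G x = int_0^(x /\ r) f(-u) du] gives
    the renewal equation. *)

(** * Riemann sums of right-continuous functions *)

Section real_valued_integral.
Context d (T : measurableType d) (R : realType) (mu : {measure set T -> \bar R}).

(** What is known of the driving process is its paths and the characteristic function of one unit
    increment, while the integral against [S] is an unordered sum over the jumps of each path.
    Meshes link the two. The logarithm of a complex characteristic function is avoided by passing to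
    its squared modulus, which is real, positive and multiplicative in time; the phase contributes
    only at second order because the process is centered. A kernel that vanishes near 0 has no
    closed mean, and a computable one does not vanish near 0, so two kernels are kept, [psi] and
    [rho], whose gap costs a vanishing share of the variance. Pathwise limits pass to means by a
    second-moment bound uniform in the mesh. Joint measurability of processes in time and chance is
    bypassed: time integrals are limits of Riemann sums, the exchange with expectation is made on
    finite sums, and completeness makes almost sure limits measurable. On [[-r, 0]] the mean is only
    right-continuous, so the regularity of its convolution with [f] must come from [f]. *)

Lemma Rdominated_convergence (D : set T) (f_ : nat -> T -> R) (f g : T -> R) :
  measurable D -> (forall n, measurable_fun D (f_ n)) -> measurable_fun D f ->
  {ae mu, forall x, D x -> f_ ^~ x @ \oo --> f x} ->
  mu.-integrable D (EFin \o g) ->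
  {ae mu, forall x, D x -> forall n, `|f_ n x| <= g x} ->
  mu.-integrable D (EFin \o f) /\
  \int[mu]_(x in D) f_ n x @[n --> \oo] --> \int[mu]_(x in D) f x.
Proof.
move=> mD mf_ mf ff ig fg.
have [| | | |i1 _ i2] := @dominated_convergence _ _ _ mu D mD
  (fun n => EFin \o f_ n) (EFin \o f) (EFin \o g) _ _ _ ig.
- by move=> n; exact/measurable_EFinP.
- exact/measurable_EFinP.
- apply: filterS ff => x /[swap] Dx /(_ Dx) h.
  by apply/fine_cvgP; split; [exact: nearW | exact: h].
- by apply: filterS fg => x h Dx n; rewrite /= lee_fin h.
split=> //; rewrite /Rintegral; apply: fine_cvg.
rewrite fineK; first exact: i2.
exact: integrable_fin_num.
Qed.

Lemma integrable_Rscale (D : set T) (k : R) (f : T -> R) :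
  measurable D -> mu.-integrable D (EFin \o f) ->
  mu.-integrable D (EFin \o (fun x => k * f x)).
Proof. by move=> mD fi; exact: (integrableZl mD k fi). Qed.

Lemma integrable_Rsum (I : Type) (s : seq I) (D : set T) (f : I -> T -> R) :
  measurable D -> (forall i, mu.-integrable D (EFin \o f i)) ->
  mu.-integrable D (EFin \o (fun x => \sum_(i <- s) f i x)).
Proof.
move=> mD fi; rewrite (_ : _ \o _ = fun x => \sum_(i <- s) (f i x)%:E)%E.
  by apply: integrable_sum => // i _; exact: fi.
by apply/funext => x /=; rewrite sumEFin.
Qed.

Lemma Rintegral_sum (I : Type) (s : seq I) (D : set T) (f : I -> T -> R) :
  measurable D -> (forall i, mu.-integrable D (EFin \o f i)) ->
  \int[mu]_(x in D) (\sum_(i <- s) f i x) =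
  \sum_(i <- s) \int[mu]_(x in D) f i x.
Proof.
move=> mD fi; elim: s => [|i s IHs].
  under eq_Rintegral do rewrite big_nil.
  by rewrite big_nil Rintegral_cst// mul0r.
under eq_Rintegral do rewrite big_cons.
by rewrite big_cons RintegralD// ?IHs//; exact: integrable_Rsum.
Qed.

End real_valued_integral.

Section riemann_sums.
Context {R : realType}.
Implicit Types (a b u M : R) (n i : nat) (y : R -> R).
Local Notation leb := (@lebesgue_measure R).

Definition mesh a b n i : R := a + i%:R * ((b - a) / n.+1%:R).

Lemma mesh0 a b n : mesh a b n 0 = a.
Proof. by rewrite /mesh mul0r addr0. Qed.

Lemma meshN a b n : mesh a b n n.+1 = b.
Proof. by rewrite /mesh mulrCA divff ?pnatr_eq0// mulr1 addrC subrK. Qed.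

Lemma meshS a b n i : mesh a b n i.+1 = mesh a b n i + (b - a) / n.+1%:R.
Proof. by rewrite /mesh -natr1 mulrDl mul1r addrA. Qed.

Lemma mesh_step_gt0 a b n : a < b -> 0 < (b - a) / n.+1%:R.
Proof. by move=> ab; rewrite divr_gt0 ?subr_gt0. Qed.

Lemma le_mesh a b n : a < b -> {homo mesh a b n : i j / (i <= j)%N >-> i <= j}.
Proof.
move=> ab i j ij; rewrite /mesh lerD2l ler_wpM2r ?ler_nat//.
exact/ltW/mesh_step_gt0.
Qed.

Lemma lt_mesh a b n i j : a < b -> (mesh a b n i < mesh a b n j) = (i < j)%N.
Proof. by move=> ab; rewrite /mesh ltrD2l ltr_pM2r ?ltr_nat// mesh_step_gt0. Qed.

Lemma mesh_ge a b n i : a < b -> a <= mesh a b n i.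
Proof. by move=> ab; rewrite -{1}(mesh0 a b n) le_mesh. Qed.

Lemma mesh_le a b n i : a < b -> (i <= n.+1)%N -> mesh a b n i <= b.
Proof. by move=> ab ni; rewrite -{2}(meshN a b n) le_mesh. Qed.

Lemma mesh_shift a b c n i : mesh (a + c) (b + c) n i = mesh a b n i + c.
Proof. by rewrite /mesh opprD addrACA subrr addr0 addrAC. Qed.

Lemma cvg_step a b : (b - a) / n.+1%:R @[n --> \oo] --> (0 : R).
Proof.
rewrite -(mulr0 (b - a)); apply: cvgM; first exact: cvg_cst.
exact: cvg_harmonic.
Qed.

Lemma mesh_indexr a b n u : a < b -> a <= u < b ->
  exists2 i, (i < n.+1)%N & mesh a b n i <= u < mesh a b n i.+1.
Proof.
move=> ab /andP[au ub]; have d0 := mesh_step_gt0 n ab.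
set d := _ / _ in d0; have := @Num.Theory.truncn_itv R ((u - a) / d).
rewrite divr_ge0 ?subr_ge0 ?(ltW d0)// => /(_ isT).
set i := Num.trunc _; rewrite ler_pdivlMr// ltr_pdivrMr// => /andP[h1 h2].
exists i; last first.
  by rewrite /mesh -/d; apply/andP; split; rewrite -?lerBrDl -?ltrBlDl.
rewrite -(@lt_mesh a b n)// meshN (le_lt_trans _ ub)//.
by rewrite /mesh -/d -lerBrDl.
Qed.

Lemma mesh_indexl a b n u : a < b -> a < u <= b ->
  exists2 i, (i < n.+1)%N & mesh a b n i < u <= mesh a b n i.+1.
Proof.
move=> ab /andP[au ub].
have h : exists i, u <= mesh a b n i by exists n.+1; rewrite meshN.
case: (ex_minnP h) => -[|i]; first by rewrite mesh0 leNgt au.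
move=> ui mi; exists i.
  by apply: mi; rewrite meshN.
by rewrite ui ltNge; rewrite andbT; apply/negP => /mi; rewrite ltnn.
Qed.

(* With [c = 0] the tags are the left endpoints, with [c = 1] the right ones. *)
Definition riemann_sum (c : bool) y a b n : R :=
  \sum_(i < n.+1) y (mesh a b n (i + c)%N) * ((b - a) / n.+1%:R).

(** One-sided continuity in the form used by tags. Cells are closed on the left and open on the
    right, so a right tag lies strictly beyond [u] while a left tag may equal it. Sequences stay in
    [[a, b]], so nothing is asked of [y] outside. *)
Definition tag_continuous (c : bool) y a b : Prop :=
  forall u (s : nat -> R), a < u < b -> (forall n, a <= s n <= b) ->
    (forall n, if c then u < s n else s n <= u) ->
    s @ \oo --> u -> y (s n) @[n --> \oo] --> y u.

Let step (c : bool) y a b n u : R :=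
  \sum_(i < n.+1) y (mesh a b n (i + c)%N) *
                  \1_`[mesh a b n i, mesh a b n i.+1[ u.

Let stepE (c : bool) y a b n u i : a < b -> (i < n.+1)%N ->
  mesh a b n i <= u < mesh a b n i.+1 ->
  step c y a b n u = y (mesh a b n (i + c)%N).
Proof.
move=> ab ni /andP[iu ui]; rewrite /step (bigD1 (Ordinal ni))//= indicE.
rewrite mem_set /= ?in_itv/= ?iu// mulr1 big1 ?addr0// => j ji.
rewrite indicE memNset ?mulr0//= in_itv/= => /andP[ju uj].
have := le_lt_trans iu uj; rewrite lt_mesh// ltnS => ij.
have := le_lt_trans ju ui; rewrite lt_mesh// ltnS => ij'.
by move/eqP: ji; apply; apply/val_inj/eqP; rewrite eqn_leq ij'.
Qed.

Let measurable_step c y a b n D : measurable_fun D (step c y a b n).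
Proof.
apply: measurable_sum => i; apply: measurable_funM => //.
Qed.

Let integral_step c y a b n : a < b ->
  \int[leb]_(x in `]a, b[) step c y a b n x = riemann_sum c y a b n.
Proof.
move=> ab; rewrite Rintegral_sum//=; last first.
  move=> i; apply: (@integrableS _ _ _ leb setT) => //.
  exact/integrable_Rscale/integrable_indic_itv.
apply: eq_bigr => i _; rewrite RintegralZl//; last first.
  by apply: (@integrableS _ _ _ leb setT) => //; exact: integrable_indic_itv.
congr (_ * _); rewrite Rintegral_itv_obnd_cbnd; last first.
  by apply: (@integrableS _ _ _ leb setT) => //; exact: integrable_indic_itv.
rewrite /Rintegral integral_indic//= setIidl; last first.
  apply: subset_itv; rewrite bnd_simp ?mesh_ge//.
  by rewrite mesh_le//.
rewrite lebesgue_measure_itv/= lte_fin lt_mesh// ltnSn/=.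
by rewrite meshS addrAC subrr add0r.
Qed.

Let step_cvg c y a b u : tag_continuous c y a b -> a < u < b ->
  step c y a b n u @[n --> \oo] --> y u.
Proof.
move=> yc /andP[au ub]; have ab := lt_trans au ub.
have /choice[k kP] n : exists i,
    (i < n.+1)%N /\ mesh a b n i <= u < mesh a b n i.+1.
  by have [|i] := mesh_indexr (u := u) n ab; [rewrite (ltW au)|exists i].
have kn n : (k n < n.+1)%N by case: (kP n).
have ku n : mesh a b n (k n) <= u < mesh a b n (k n).+1 by case: (kP n).
under eq_fun do rewrite (stepE c y ab (kn _) (ku _)).
apply: yc; first by rewrite au ub.
- move=> n; rewrite mesh_ge// mesh_le//.
  by case: c; rewrite ?addn1 ?addn0 // ltnW.
- by move=> n; have /andP[? ?] := ku n; case: c; rewrite ?addn1 ?addn0.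
- apply/cvgrPdist_lt => /= e e0.
  have /cvgrPdist_lt/(_ _ e0) := cvg_step a b; apply: filterS => n.
  rewrite sub0r normrN gtr0_norm ?mesh_step_gt0// => dn.
  have := ku n; rewrite meshS => /andP[].
  have d0 := mesh_step_gt0 n ab.
  case: (c); rewrite ?addn1 ?addn0 ltr_norml ?meshS.
    set d := _ / _ in d0 dn *; set x := mesh _ _ _ _ => h1 h2.
    by apply/andP; split; lra.
  set d := _ / _ in d0 dn *; set x := mesh _ _ _ _ => h1 h2.
  by apply/andP; split; lra.
Qed.

(** Inside the interval [y] is the pointwise limit of its step functions on the mesh; two endpoints
    cannot spoil measurability. *)
Lemma measurable_tag_continuous c y a b :
  tag_continuous c y a b -> measurable_fun `[a, b] y.
Proof.
move=> yc; have [ab|ba] := ltP a b; last first.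
  move: ba; rewrite le_eqVlt => /predU1P[->|ba].
    by rewrite set_itv1; exact: measurable_fun_set1.
  by rewrite set_itv_ge ?bnd_simp -?ltNge//; exact: measurable_fun_set0.
apply: (@measurable_fun_itv_cc _ _ _ false true).
apply: (@measurable_fun_cvg _ _ _ _ (step c y a b)) => // u /=.
by rewrite in_itv/= => ?; exact: step_cvg.
Qed.

Lemma integrable_tag_continuous c y a b M :
  (forall u, a <= u <= b -> `|y u| <= M) -> tag_continuous c y a b ->
  leb.-integrable `[a, b] (EFin \o y).
Proof.
move=> yM yc; apply: measurable_bounded_integrable => //.
- by rewrite /= lebesgue_measure_itv/=; case: ifP => // _; exact: ltry.
- exact: measurable_tag_continuous yc.
- exists M; split; first exact: num_real.
  by move=> x Mx u /= /yM; move/le_trans; apply; exact: ltW.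
Qed.

(** The sums are the integrals of the step functions, to which dominated convergence applies with
    the constant [M]. *)
Lemma riemann_sum_cvg c y a b M : a < b ->
  (forall u, a <= u <= b -> `|y u| <= M) -> tag_continuous c y a b ->
  riemann_sum c y a b n @[n --> \oo] --> Lint a b y.
Proof.
move=> ab yM yc; have iy := integrable_tag_continuous yM yc.
have iyo : leb.-integrable `]a, b[ (EFin \o y).
  by apply: integrableS iy => //; exact: subset_itv_oo_cc.
have -> : Lint a b y = \int[leb]_(x in `]a, b[) y x.
  by rewrite /Lint/Rintegral integral_itv_bndoo//; case/integrableP : iyo.
under eq_fun do rewrite -integral_step//.
have [] // := @Rdominated_convergence _ _ _ leb `]a, b[ (step c y a b) y (cst M).
- by move=> n; exact: measurable_step.
- by apply: measurable_funS (measurable_tag_continuous yc) => //; exact: subset_itv_oo_cc.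
- by apply: aeW => u /=; rewrite in_itv/= => uab; exact: step_cvg.
- apply: measurable_bounded_integrable => //=.
    by rewrite lebesgue_measure_itv/=; case: ifP => // _; exact: ltry.
  by exists `|M|; split; [exact: num_real | move=> x Mx u _; exact: ltW].
apply: aeW => u; rewrite /= in_itv/= => /andP[au ub] n.
have [|i ni iu] := mesh_indexr (u := u) n ab; first by rewrite (ltW au).
rewrite (stepE _ _ ab ni iu); apply: yM.
by rewrite mesh_ge// mesh_le//; case: (c); rewrite ?addn1 ?addn0 // ltnW.
Qed.

End riemann_sums.

Section riemann_consequences.
Context {R : realType}.
Implicit Types (a b c u M : R) (n i : nat) (y : R -> R).
Local Notation leb := (@lebesgue_measure R).

Lemma tag_continuous_right y a b :
  (forall u, a < u < b -> y x @[x --> u^'+] --> y u) ->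
  tag_continuous true y a b.
Proof. by move=> yc u s /yc /cvg_at_rightP yu _ us su; exact: yu. Qed.

Lemma tag_continuous_left y a b :
  (forall u, a < u < b -> y x @[x --> u^'-] --> y u) ->
  tag_continuous false y a b.
Proof.
move=> yc u s /yc /cvgrPdist_lt yu _ us su; apply/cvgrPdist_lt => /= e e0.
have {yu} := yu _ e0.
rewrite near_withinE => nu.
have {}nu : \forall x \near u, x <= u -> `|y u - y x| < e.
  near=> x; rewrite le_eqVlt => /predU1P[->|xu].
    by rewrite subrr normr0.
  by move: xu; near: x.
have h : \forall n \near \oo, s n <= u -> `|y u - y (s n)| < e.
  exact: su _ nu.
by apply: filterS h => n; apply.
Unshelve. all: by end_near. Qed.

Lemma tag_continuousS (k : bool) y a b a' b' : a' <= a -> b <= b' ->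
  tag_continuous k y a' b' -> tag_continuous k y a b.
Proof.
move=> aa bb yc u s /andP[au ub] sab; apply: yc.
  by rewrite (le_lt_trans aa)// (lt_le_trans ub).
by move=> n; have /andP[h1 h2] := sab n; rewrite (le_trans aa)// (le_trans h2).
Qed.

Lemma tag_continuousM (k : bool) y z a b : tag_continuous k y a b ->
  tag_continuous k z a b -> tag_continuous k (fun u => y u * z u) a b.
Proof.
move=> yc zc u s uab sab su us.
by apply: cvgM; [exact: yc|exact: zc].
Qed.

Lemma continuous_tag (k : bool) y a b : continuous y -> tag_continuous k y a b.
Proof.
by move=> yc u s _ _ _ su; apply: (cvg_comp _ _ su); exact: yc.
Qed.

Lemma Lint_xx a y : Lint a a y = 0.
Proof. by rewrite /Lint set_itv1 Rintegral_set1. Qed.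

Lemma Lint_eq a b y z : (forall u, a <= u <= b -> y u = z u) ->
  Lint a b y = Lint a b z.
Proof.
by move=> yz; apply: eq_Rintegral => u; rewrite inE/= in_itv/= => /yz.
Qed.

(** A shifted mesh is the mesh of the shifted interval, so both integrals are limits of the same
    Riemann sums. *)
Lemma Lint_shift a b c M y : (forall u, a + c <= u <= b + c -> `|y u| <= M) ->
  tag_continuous true y (a + c) (b + c) ->
  Lint (a + c) (b + c) y = Lint a b (fun x => y (x + c)).
Proof.
move=> yM yc; have [ab|] := ltP a b; last first.
  rewrite le_eqVlt => /predU1P[->|ba]; first by rewrite !Lint_xx.
  rewrite /Lint !set_itv_ge ?Rintegral_set0 ?bnd_simp -?ltNge// ?ltrD2r//.
have abc : a + c < b + c by rewrite ltrD2r.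
have h1 := riemann_sum_cvg abc yM yc.
have h2 : riemann_sum true (fun x => y (x + c)) a b n @[n --> \oo] -->
          Lint a b (fun x => y (x + c)).
  apply: (@riemann_sum_cvg _ _ _ _ _ M) => //.
    by move=> u uab; apply: yM; rewrite !lerD2r.
  move=> u s uab sab us su; apply: (yc (u + c) (fun n => s n + c)).
  - by rewrite !ltrD2r.
  - by move=> n; rewrite !lerD2r.
  - by move=> n; rewrite ltrD2r; exact: us.
  - by apply: cvgD => //; exact: cvg_cst.
apply: (cvg_unique _ h1) => //.
rewrite (_ : riemann_sum true y (a + c) (b + c) =
             riemann_sum true (fun x => y (x + c)) a b)//.
apply/funext => n; apply: eq_bigr => i _.
by rewrite mesh_shift opprD addrACA subrr addr0.
Qed.

(** Reflection reverses the mesh and exchanges right with left tags, so a right-continuous and a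
    left-continuous function share their Riemann sums. *)
Lemma Lint_opp a b M y : (forall u, a <= u <= b -> `|y u| <= M) ->
  (forall u, a < u < b -> y x @[x --> u^'+] --> y u) ->
  Lint a b y = Lint (- b) (- a) (fun x => y (- x)).
Proof.
move=> yM yc; have [ab|] := ltP a b; last first.
  rewrite le_eqVlt => /predU1P[->|ba]; first by rewrite !Lint_xx.
  rewrite /Lint !set_itv_ge ?Rintegral_set0 ?bnd_simp -?ltNge// ?ltrN2//.
have ba : - b < - a by rewrite ltrN2.
have h1 := riemann_sum_cvg ab yM (tag_continuous_right yc).
have h2 : riemann_sum false (fun x => y (- x)) (- b) (- a) n @[n --> \oo] -->
          Lint (- b) (- a) (fun x => y (- x)).
  apply: (@riemann_sum_cvg _ _ _ _ _ M) => //.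
    by move=> u uab; apply: yM; rewrite lerNr lerNl andbC.
  apply: tag_continuous_left => u uab; apply/cvg_at_leftNP => /=.
  rewrite (_ : _ \o _ = y); last by apply/funext => x /=; rewrite opprK.
  by apply: yc; rewrite ltrNr ltrNl andbC.
apply: (cvg_unique _ h1) => //.
rewrite (_ : riemann_sum true y a b =
             riemann_sum false (fun x => y (- x)) (- b) (- a))//.
apply/funext => n; rewrite /riemann_sum (reindex_inj rev_ord_inj)/=.
apply: eq_bigr => i _; congr (y _ * _); last by rewrite opprK addrC.
rewrite addn0 addn1 subSS /mesh -[in LHS]natr1 natrB ?leq_ord//.
have : n.+1%:R != 0 :> R by rewrite pnatr_eq0.
by rewrite -natr1 => n0; field.
Qed.

End riemann_consequences.

(** * Exchange of a mean with a time integral *)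

Section cadlag_fubini.
Context d (T : measurableType d) (R : realType) (mu : {measure set T -> \bar R}).
Context (D : set T) (mD : measurable D) (Y : T -> R -> R) (a b : R) (g : T -> R).
Hypotheses (ig : mu.-integrable D (EFin \o g))
  (mY : forall u, a <= u <= b -> measurable_fun D (Y^~ u))
  (Yc : {ae mu, forall x, D x -> tag_continuous true (Y x) a b})
  (Yg : {ae mu, forall x, D x -> forall u, a <= u <= b -> `|Y x u| <= g x}).

Lemma integrable_section u : a <= u <= b -> mu.-integrable D (EFin \o Y^~ u).
Proof.
move=> uab.
have [] // := @Rdominated_convergence _ _ _ mu D (fun=> Y^~ u) (Y^~ u) g.
- by move=> _; exact: mY.
- exact: mY.
- by apply: aeW => x _; exact: cvg_cst.
- by apply: filterS Yg => x /[swap] Dx /(_ Dx) h n; exact: h.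
Qed.

Lemma norm_integral_section u : a <= u <= b ->
  `|\int[mu]_(x in D) Y x u| <= \int[mu]_(x in D) `|g x|.
Proof.
move=> uab; have iu := integrable_section uab.
apply: (le_trans (le_normr_Rintegral mD iu)).
have ing : mu.-integrable D (fun x => `|g x|%:E)%E := integrable_norm ig.
have inu : mu.-integrable D (fun x => `|Y x u|%:E)%E := integrable_norm iu.
rewrite /Rintegral fine_le ?integrable_fin_num//.
apply: ae_ge0_le_integral => //.
- exact: measurable_int inu.
- exact: measurable_int ing.
- apply: filterS Yg => x /[swap] Dx /(_ Dx) h.
  by rewrite lee_fin (le_trans (h _ uab))// ler_norm.
Qed.

Lemma tag_continuous_integral :
  tag_continuous true (fun u => \int[mu]_(x in D) Y x u) a b.
Proof.
move=> u s uab sab us su /=.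
have [] // := @Rdominated_convergence _ _ _ mu D (fun n => Y^~ (s n)) (Y^~ u) g mD.
- by move=> n; exact: mY.
- by apply: mY; case/andP: uab => ? ?; rewrite !ltW.
- by apply: filterS Yc => x /[swap] Dx /(_ Dx) h; exact: h.
- by apply: filterS Yg => x /[swap] Dx /(_ Dx) h n; exact: h.
Qed.

(** Finite Riemann sums commute with the integral over [D]. They converge to both sides: pathwise
    with dominating function [(b - a) * g], and in the mean because the integrated function inherits
    a bound and right-continuity. *)
Theorem Rintegral_Lint : a < b ->
  measurable_fun D (fun x => Lint a b (Y x)) ->
  mu.-integrable D (EFin \o (fun x => Lint a b (Y x))) /\
  \int[mu]_(x in D) Lint a b (Y x) = Lint a b (fun u => \int[mu]_(x in D) Y x u).
Proof.
move=> ab mL.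
have imesh n (i : 'I_n.+1) : a <= mesh a b n (i + true)%N <= b.
  by rewrite mesh_ge// mesh_le// addn1.
have iterm n (i : 'I_n.+1) : mu.-integrable D
    (EFin \o (fun x => Y x (mesh a b n (i + true)%N) * ((b - a) / n.+1%:R))).
  under [X in EFin \o X]eq_fun do rewrite mulrC.
  by apply: integrable_Rscale => //; exact: integrable_section.
have [| | | |iL h1] := @Rdominated_convergence _ _ _ mu D
  (fun n x => riemann_sum true (Y x) a b n)
  (fun x => Lint a b (Y x)) (fun x => (b - a) * g x) mD _ mL.
- move=> n; apply/measurable_EFinP; apply: measurable_int.
  exact/integrable_Rsum/iterm.
- apply: filterS2 Yc Yg => x h1 h2 Dx.
  by apply: riemann_sum_cvg; [by []|exact: h2|exact: h1].
- exact: integrable_Rscale.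
- apply: filterS Yg => x /[swap] Dx /(_ Dx) h n.
  rewrite /riemann_sum (le_trans (ler_norm_sum _ _ _))//.
  apply: (@le_trans _ _ (\sum_(i < n.+1) g x * ((b - a) / n.+1%:R))).
    apply: ler_sum => i _; rewrite normrM ler_pM//; first exact: h.
    by rewrite gtr0_norm// mesh_step_gt0.
  rewrite sumr_const card_ord -mulrnAr -[_ *+ n.+1]mulr_natr divfK ?pnatr_eq0//.
  by rewrite mulrC.
split=> //; apply: (cvg_unique _ h1) => //.
have h2 := riemann_sum_cvg ab norm_integral_section tag_continuous_integral.
rewrite (_ : (fun n => _) =
  riemann_sum true (fun u => \int[mu]_(x in D) Y x u) a b)//.
apply/funext => n; rewrite Rintegral_sum//; apply: eq_bigr => i _.
by rewrite RintegralZr//; exact: integrable_section.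
Qed.

End cadlag_fubini.

(** * Cadlag paths and sums over their jumps *)

Section cadlag_paths.
Context {R : realType}.
Implicit Types (a b c e s t u : R) (x : R -> R) (G : R -> R).

Lemma left_lim_cvg a x t : cadlag_on a x -> a < t ->
  x s @[s --> t^'-] --> left_lim x t.
Proof. by move=> [_ xl] /xl. Qed.

Lemma at_right_bound t (Q : R -> Prop) : (\forall s \near t^'+, Q s) ->
  exists2 e, 0 < e & forall s, t < s < t + e -> Q s.
Proof.
rewrite near_withinE => /nbhs_ballP[e /= e0 h]; exists e => // s /andP[ts st].
by apply: h => //; rewrite /ball/= distrC gtr0_norm ?subr_gt0// ltrBlDl.
Qed.

Lemma at_left_bound t (Q : R -> Prop) : (\forall s \near t^'-, Q s) ->
  exists2 e, 0 < e & forall s, t - e < s < t -> Q s.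
Proof.
rewrite near_withinE => /nbhs_ballP[e /= e0 h]; exists e => // s /andP[ts st].
by apply: h => //; rewrite /ball/= gtr0_norm ?subr_gt0// ltrBlDl -ltrBlDr.
Qed.

Lemma seq_pos_lbound (S : seq R) :
  exists2 e, 0 < e & forall z, z \in S -> 0 < z -> e <= z.
Proof.
elim: S => [|y S [e e0 h]]; first by exists 1.
have [y0|y0] := ltP 0 y; last first.
  exists e => // z; rewrite inE => /predU1P[->|]; last exact: h.
  by move=> /lt_le_trans /(_ y0); rewrite ltxx.
exists (Num.min e y); first by rewrite lt_min e0.
move=> z; rewrite inE ge_min => /predU1P[->|/h{}h z0]; first by rewrite lexx orbT.
by rewrite h.
Qed.

(* Compactness of [[a, b]]: away from finitely many points [J], increments over
   sufficiently short intervals are small. *)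
Lemma cadlag_small_increments a b x e : cadlag_on a x -> 0 < e ->
  exists (J : seq R) (h : R), 0 < h /\
    forall s t, a <= s -> s < t -> t <= b -> t - s < h ->
      (forall c, c \in J -> ~~ (s < c <= t)) -> `|x t - x s| < e.
Proof.
move=> xc e0; have e20 : 0 < e / 2 by rewrite divr_gt0.
(* Right of [u] the path stays within [e / 2] of [x u], left of [u] within [e / 2] of the left
   limit. For [u = a] the left half is vacuous. *)
have osc u : exists2 d, 0 < d & a <= u ->
    (forall s t, u <= s < u + d -> u <= t < u + d -> `|x t - x s| < e) /\
    (forall s t, a <= s -> u - d < s < u -> u - d < t < u -> `|x t - x s| < e).
  have [au|] := leP a u; last by exists 1.
  have [xr xl] := xc; have /cvgrPdist_lt/(_ _ e20)/at_right_bound := xr _ au.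
  move=> [d1 d10 h1].
  have h1' s : u <= s < u + d1 -> `|x u - x s| < e / 2.
    by rewrite le_eqVlt => /andP[/predU1P[<-|us] su];
      [rewrite subrr normr0|rewrite h1// us].
  have r1 s t : u <= s < u + d1 -> u <= t < u + d1 -> `|x t - x s| < e.
    move=> /h1' hs /h1' ht; rewrite [e]splitr.
    by rewrite (le_lt_trans (ler_distD (x u) _ _))// ltrD// distrC.
  move: au; rewrite le_eqVlt => /predU1P[ua|au].
    exists d1 => // _; split=> // s t as_ /andP[_ su].
    by move: (le_lt_trans as_ su); rewrite ua ltxx.
  have /cvgrPdist_lt/(_ _ e20)/at_left_bound[d2 d20 h2] := left_lim_cvg xc au.
  exists (Num.min d1 d2); first by rewrite lt_min d10.
  move=> _; split.
    move=> s t /andP[us su] /andP[ut tu]; apply: r1.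
      by rewrite us (lt_le_trans su)// lerD2l ge_min lexx.
    by rewrite ut (lt_le_trans tu)// lerD2l ge_min lexx.
  move=> s t _ /andP[us su] /andP[ut tu].
  rewrite (le_lt_trans (ler_distD (left_lim x u) _ _))// [e]splitr ltrD//.
    rewrite distrC h2// tu (le_lt_trans _ ut)//.
    by rewrite lerD2l lerN2 ge_min lexx orbT.
  rewrite h2// su (le_lt_trans _ us)//.
  by rewrite lerD2l lerN2 ge_min lexx orbT.
have {osc} [d dP] := choice (fun u => let: ex_intro2 d h1 h2 := osc u in
  ex_intro (fun d : R => 0 < d /\ _) d (conj h1 h2)).
have : cover_compact (`[a, b] : set R).
  by rewrite -compact_cover; exact: segment_compact.
move=> /(_ R `[a, b]%classic (fun u => ball u (d u / 2))) [].
- by move=> u _; apply: ball_open; rewrite divr_gt0//; case: (dP u).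
- move=> u uab; exists u => //; apply: ballxx.
  by rewrite divr_gt0//; case: (dP u).
move=> J JD Jcover.
have [h h0 hP] := seq_pos_lbound [seq d u / 2 | u <- finmap.enum_fset J].
exists (finmap.enum_fset J), h; split=> //.
move=> s t as_ st tb ts noJ.
have sab : `[a, b]%classic s by rewrite /= in_itv/= as_ ltW// (lt_le_trans st).
have [u /= uJ su] := Jcover s sab.
have hu : h <= d u / 2.
  by apply: hP; [exact: map_f|rewrite divr_gt0//; case: (dP u)].
have [d0 /(_ _)[]] := dP u.
  by have := JD _ uJ; rewrite inE/= in_itv/= => /andP[].
move=> hr hl; move: su; rewrite /ball/= ltr_norml => /andP[su1 su2].
(* The centre [u] of the ball containing [s] is not in []s, t]], so both points lie on the same side
   of it, at distance less than [d u]. *)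
have := noJ u uJ; rewrite negb_and -leNgt -ltNge => /orP[us|tu].
  by apply: hr; apply/andP; split; lra.
by apply: hl => //; apply/andP; split; lra.
Qed.

End cadlag_paths.

(** * Sums over jumps as limits of sums over mesh increments *)

Section jump_sums.
Context {R : realType}.
Implicit Types (a b c e s t u : R) (x : R -> R) (G : R -> R) (n : nat).

Lemma cvg_right_seq x u (s : nat -> R) : x t @[t --> u^'+] --> x u ->
  (forall n, u <= s n) -> s @ \oo --> u -> x (s n) @[n --> \oo] --> x u.
Proof.
move=> /cvgrPdist_lt xu us su; apply/cvgrPdist_lt => /= e e0.
have {xu} := xu _ e0.
rewrite near_withinE => nu.
have {}nu : \forall y \near u, u <= y -> `|x u - x y| < e.
  near=> y; rewrite le_eqVlt => /predU1P[<-|uy].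
    by rewrite subrr normr0.
  by move: uy; near: y.
have h : \forall n \near \oo, u <= s n -> `|x u - x (s n)| < e.
  exact: su _ nu.
by apply: filterS h => n; apply.
Unshelve. all: by end_near. Qed.

Lemma cvg_sum_seq (T : eqType) (J : seq T) (y : nat -> T -> R) (l : T -> R) :
  (forall i, i \in J -> y ^~ i @ \oo --> l i) ->
  \sum_(i <- J) y n i @[n --> \oo] --> \sum_(i <- J) l i.
Proof.
elim: J => [|j J IH] yl.
  by under eq_fun do rewrite big_nil; rewrite big_nil; exact: cvg_cst.
under eq_fun do rewrite big_cons.
rewrite big_cons; apply: cvgD; first by apply: yl; rewrite mem_head.
by apply: IH => i iJ; apply: yl; rewrite inE iJ orbT.
Qed.

Lemma esum_supported (T : choiceType) (A : set T) (J : seq T) (f : T -> \bar R) :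
  uniq J -> (forall i, A i -> 0 <= f i)%E -> (forall i, i \in J -> A i) ->
  (forall i, A i -> i \notin J -> f i = 0%E) ->
  (\esum_(i in A) f i = \sum_(i <- J) f i)%E.
Proof.
move=> uJ f0 JA fJ; rewrite (esumID [set` J])//.
rewrite [X in (_ + X)%E]esum1 ?adde0; last first.
  by move=> s [As /= /negP sJ]; exact: fJ.
have -> : A `&` [set` J] = [set` J].
  by apply/seteqP; split=> [s []//|s /= sJ]; split=> //; exact: JA.
rewrite esum_fset; [by rewrite -fsbig_seq|exact: finite_seq|].
by move=> s; rewrite inE => /JA; exact: f0.
Qed.

Lemma mesh_intervalP a b n c i j : a < b ->
  mesh a b n i < c <= mesh a b n i.+1 -> mesh a b n j < c <= mesh a b n j.+1 ->
  i = j.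
Proof.
move=> ab /andP[i1 i2] /andP[j1 j2].
have := lt_le_trans i1 j2; rewrite lt_mesh// ltnS => ij.
have := lt_le_trans j1 i2; rewrite lt_mesh// ltnS => ji.
by apply/eqP; rewrite eqn_leq ij.
Qed.

(** Cells are open on the left and closed on the right here: exactly one contains [c], its right end
    tends to [c] from [c] on, where the path is right-continuous, and its left end from strictly
    below, where the left limit appears. *)
Lemma cvg_mesh_jump a b x G c : a < b -> cadlag_on a x -> continuous G ->
  a < c <= b ->
  \sum_(i < n.+1) (mesh a b n i < c <= mesh a b n i.+1)%R%:R *
     G (x (mesh a b n i.+1) - x (mesh a b n i)) @[n --> \oo] --> G (jump x c).
Proof.
move=> ab xc Gc acb.
have /choice[k kP] n : exists i,
    (i < n.+1)%N /\ mesh a b n i < c <= mesh a b n i.+1.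
  by have [i] := mesh_indexl n ab acb; exists i.
have kn n : (k n < n.+1)%N by case: (kP n).
have kc n : mesh a b n (k n) < c <= mesh a b n (k n).+1 by case: (kP n).
have E n : \sum_(i < n.+1) (mesh a b n i < c <= mesh a b n i.+1)%R%:R *
     G (x (mesh a b n i.+1) - x (mesh a b n i)) =
     G (x (mesh a b n (k n).+1) - x (mesh a b n (k n))).
  rewrite (bigD1 (Ordinal (kn n)))//= kc mul1r big1 ?addr0// => j jk.
  case: (boolP (mesh a b n j < c <= mesh a b n j.+1)) => [cj|_]; last first.
    by rewrite mul0r.
  by move/eqP : jk; case; apply/val_inj => /=; exact: mesh_intervalP cj (kc n).
rewrite (funext E).
have d0 n := mesh_step_gt0 n ab.
have cv0 : mesh a b n (k n) @[n --> \oo] --> c.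
  apply/cvgrPdist_lt => /= e e0.
  have /cvgrPdist_lt/(_ _ e0) := cvg_step a b; apply: filterS => n.
  rewrite sub0r normrN gtr0_norm ?mesh_step_gt0// => dn.
  have := kc n; rewrite meshS => /andP[].
  have := d0 n; set d := _ / _ in dn *; set z := mesh _ _ _ _ => ? h1 h2.
  by rewrite ltr_norml; apply/andP; split; lra.
have cv1 : mesh a b n (k n).+1 @[n --> \oo] --> c.
  under eq_fun do rewrite meshS.
  by rewrite -(addr0 c); apply: cvgD => //; exact: cvg_step.
have cr : x (mesh a b n (k n).+1) @[n --> \oo] --> x c.
  apply: cvg_right_seq cv1.
    by case: xc => xr _; apply: xr; case/andP: acb => /ltW.
  by move=> n; case/andP: (kc n).
have cl : x (mesh a b n (k n)) @[n --> \oo] --> left_lim x c.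
  have /cvg_at_leftP : x t @[t --> c^'-] --> left_lim x c.
    by apply: (left_lim_cvg xc); case/andP: acb.
  by apply; split=> // n; case/andP: (kc n).
exact: (cvg_comp _ _ (cvgB cr cl) (Gc _)).
Qed.

(** As [G] vanishes on [[-e, e]], only cells meeting the finite exceptional set contribute on a fine
    mesh, and only jumps in that set contribute to the sum. Both sides thus reduce to finite sums
    over the same points. *)
Lemma cvg_mesh_jumps a b x G e : a < b -> cadlag_on a x -> continuous G ->
  0 < e -> (forall z, `|z| <= e -> G z = 0) -> (forall z, 0 <= G z) ->
  exists2 l : R, (\esum_(s in `]a, b]) (G (jump x s))%:E = l%:E)%E &
    \sum_(i < n.+1) G (x (mesh a b n i.+1) - x (mesh a b n i))
      @[n --> \oo] --> l.
Proof.
move=> ab xc Gc e0 Ge G0.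
have [J0 [h [h0 hP]]] := cadlag_small_increments b xc e0.
pose J := undup [seq c <- J0 | a < c <= b].
have JP c : c \in J = (a < c <= b) && (c \in J0) by rewrite mem_undup mem_filter.
have uJ : uniq J by exact: undup_uniq.
exists (\sum_(c <- J) G (jump x c)).
  rewrite (esum_supported uJ)//.
  - by rewrite sumEFin.
  - by move=> s _; rewrite lee_fin.
  - by move=> s; rewrite JP /= in_itv/= => /andP[].
  move=> s /=; rewrite in_itv/= => asb; rewrite JP asb/= => sJ.
  congr EFin; apply: Ge; have /andP[as_ sb] := asb.
  (* The jump at a point [s] outside [J0] is the limit of increments over []t, s]], which avoids
     [J0] once [t] is close to [s]; those increments are below [e]. *)
  have xs := left_lim_cvg xc as_.
  have {xs} : `|x s - x t| @[t --> s^'-] --> `|jump x s|.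
    by apply: cvg_norm; apply: cvgB => //; exact: cvg_cst.
  move=> /cvgr_gt xs; rewrite leNgt; apply/negP => /xs{}xs.
  have [g g0 gP] := seq_pos_lbound [seq s - c | c <- J0].
  near s^'- => t; have ts : t < s by near: t; exact: nbhs_left_lt.
  have : e < `|x s - x t| by near: t.
  rewrite ltNge => /negP; apply; apply/ltW/hP => //.
  - by near: t; exact: nbhs_left_ge.
  - by rewrite ltrBlDr -ltrBlDl; near: t; apply: nbhs_left_gt; rewrite ltrBlDr ltrDl.
  move=> c cJ; apply/negP => /andP[tc]; rewrite le_eqVlt => /predU1P[cs|cs].
    by move: sJ; rewrite -cs cJ.
  have : g <= s - c by apply: gP; [exact: map_f|rewrite subr_gt0].
  have : s - g < t by near: t; apply: nbhs_left_gt; rewrite ltrBlDr ltrDl.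
  lra.
(* Steps below the smallest gap [g] put at most one point of [J] in a cell; steps below [h] make the
   increments over the other cells invisible to [G]. *)
have [g g0 gP] := seq_pos_lbound [seq c1 - c2 | c1 <- J, c2 <- J].
have cS : \sum_(c <- J) \sum_(i < n.+1) (mesh a b n i < c <= mesh a b n i.+1)%R%:R *
     G (x (mesh a b n i.+1) - x (mesh a b n i)) @[n --> \oo] -->
    \sum_(c <- J) G (jump x c).
  by apply: cvg_sum_seq => c; rewrite JP => /andP[acb _]; exact: cvg_mesh_jump.
apply: cvg_trans cS; apply: near_eq_cvg.
have /cvgrPdist_lt/(_ _ h0) dh := cvg_step a b.
have /cvgrPdist_lt/(_ _ g0) dg := cvg_step a b.
near=> n; have : (b - a) / n.+1%:R < h.
  by rewrite -[ltLHS]gtr0_norm ?mesh_step_gt0// -normrN -sub0r; near: n.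
have : (b - a) / n.+1%:R < g.
  by rewrite -[ltLHS]gtr0_norm ?mesh_step_gt0// -normrN -sub0r; near: n.
move=> dng dnh; rewrite exchange_big/=; apply: eq_bigr => i _.
rewrite -big_distrl/=.
have [/hasP[c cJ ci]|/hasPn noc] := boolP (has
    (fun c => mesh a b n i < c <= mesh a b n i.+1) J).
  rewrite (big_rem c)//= ci big_seq_cond big1 ?addr0 ?mul1r// => c'.
  rewrite andbT rem_filter// mem_filter /= => /andP[c'c c'J].
  case: (boolP (_ < c' <= _)) => // c'i.
  move: ci c'i; rewrite meshS => /andP[c1 c2] /andP[c'1 c'2].
  move: c'c; rewrite neq_lt => /orP[cc|cc].
    have : g <= c - c'.
      by apply: gP; [apply/allpairsP; exists (c, c')|rewrite subr_gt0].
    by set z := mesh _ _ _ _ in c1 c2 c'1 c'2; set d := _ / _ in dng c2 c'2; lra.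
  have : g <= c' - c.
    by apply: gP; [apply/allpairsP; exists (c', c)|rewrite subr_gt0].
  by set z := mesh _ _ _ _ in c1 c2 c'1 c'2; set d := _ / _ in dng c2 c'2; lra.
rewrite big_seq big1 ?mul0r => [|c /noc /negbTE->//].
apply/esym/Ge/ltW/hP; rewrite ?mesh_ge ?lt_mesh ?mesh_le//.
  by rewrite meshS addrAC subrr add0r.
move=> c cJ0; apply/negP => ci; have := noc c; rewrite JP cJ0 ci andbT.
move/(_ _)/negP; apply => //; case/andP: ci => c1 c2.
by rewrite (le_lt_trans _ c1) ?mesh_ge// (le_trans c2)// mesh_le.
Unshelve. all: by end_near. Qed.

End jump_sums.

(** * Convergence theorems for unordered sums *)

Section esum_limits.
Context {R : realType} {T : choiceType}.
Implicit Types (A B : set T) (f g : T -> R) (y : nat -> T -> R).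

Local Notation Esum A f := (\esum_(i in A) (f i)%:E)%E.

Lemma Esum_setU A B f : [disjoint A & B] -> (forall i, 0 <= f i) ->
  (Esum (A `|` B) f = Esum A f + Esum B f)%E.
Proof.
move=> /disj_setPS AB f0; rewrite (esumID A); last by move=> *; rewrite lee_fin.
congr (_ + _)%E; congr (esum _ _).
  by apply/seteqP; split=> [i []//|i Ai]; split=> //; left.
apply/seteqP; split=> [i [[]//]|i Bi]; split; first by right.
by move=> Ai; apply: (AB i).
Qed.

Lemma Esum_subset A B f : A `<=` B -> (forall i, 0 <= f i) ->
  (Esum A f <= Esum B f)%E.
Proof.
move=> AB f0; rewrite [leRHS](esumID A); last by move=> *; rewrite lee_fin.
rewrite (_ : B `&` A = A) ?leeDl ?esum_ge0//.
  by move=> *; rewrite lee_fin.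
by apply/seteqP; split=> [i []//|i Ai]; split=> //; exact: AB.
Qed.

Lemma Esum_approx A f (e : R) : (forall i, 0 <= f i) -> 0 < e ->
  (Esum A f < +oo)%E -> exists J : seq T, [/\ uniq J, (forall i, i \in J -> A i) &
    (Esum A f < (\sum_(i <- J) f i + e)%:E)%E].
Proof.
move=> f0 e0 Aoo; have Afin : (Esum A f)%E \is a fin_num.
  by rewrite ge0_fin_numE//; apply: esum_ge0 => i _; rewrite lee_fin.
have : (Esum A f - e%:E < Esum A f)%E by rewrite lteBlDr// lteDl ?lte_fin.
move=> /ereal_sup_gt[_ [F [finF FA] <-]] h.
exists (finmap.enum_fset (fset_set F)); split.
- exact: finmap.fset_uniq.
- by move=> i iF; apply: FA; move: iF; rewrite in_fset_set// inE.
- by move: h; rewrite lteBlDr// fsbig_finite//= sumEFin -EFinD.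
Qed.

Lemma Esum_ge A f (J : seq T) : (forall i, 0 <= f i) -> uniq J ->
  (forall i, i \in J -> A i) -> ((\sum_(i <- J) f i)%:E <= Esum A f)%E.
Proof.
move=> f0 uJ JA; apply: esum_ge; exists [set` J].
  by split; [exact: finite_seq|move=> i /= /JA].
by rewrite -fsbig_seq//= sumEFin.
Qed.

(** Monotone convergence for counting measure on an arbitrary index set: each finite partial sum of
    the limit is a limit of finite partial sums. *)
Lemma cvg_Esum_monotone A (y : nat -> T -> R) f :
  (forall n i, 0 <= y n i) ->
  (forall i, {homo y ^~ i : m n / (m <= n)%N >-> m <= n}) ->
  (forall i, A i -> y ^~ i @ \oo --> f i) ->
  (Esum A (y n) @[n --> \oo] --> Esum A f)%E.
Proof.
move=> y0 yh yf.
have yle n i : A i -> y n i <= f i.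
  move=> Ai; rewrite -(cvg_lim (@Rhausdorff R) (yf i Ai)).
  apply: limr_ge; first by apply/cvg_ex; exists (f i); exact: yf.
  by near=> m; apply: yh; near: m; exact: nbhs_infty_ge.
have nd : nondecreasing_seq (fun n => Esum A (y n)).
  by move=> m n mn; apply: le_esum => i _; rewrite lee_fin; exact: yh.
have := ereal_nondecreasing_cvgn nd.
suff -> : ereal_sup (range (fun n => Esum A (y n))) = Esum A f by [].
apply/eqP; rewrite eq_le; apply/andP; split.
  apply: ub_ereal_sup => _ [n _ <-]; apply: le_esum => i Ai.
  by rewrite lee_fin; exact: yle.
apply: ub_ereal_sup => _ [F [finF FA] <-]; rewrite fsbig_finite//= sumEFin.
set J := finmap.enum_fset _.
have JA i : i \in J -> A i.
  by move=> iF; apply: FA; move: iF; rewrite in_fset_set// inE.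
have cJ : \sum_(i <- J) y n i @[n --> \oo] --> \sum_(i <- J) f i.
  by apply: cvg_sum_seq => i /JA; exact: yf.
have cJE : ((\sum_(i <- J) y n i)%:E @[n --> \oo] --> (\sum_(i <- J) f i)%:E)%E.
  by apply/fine_cvgP; split; [exact: nearW|exact: cJ].
rewrite -(cvg_lim (@ereal_hausdorff R) cJE).
apply: lime_le; first by apply/cvg_ex; eexists; exact: cJE.
apply: nearW => n; apply: (@le_trans _ _ (Esum A (y n))).
  by apply: Esum_ge => //; exact: finmap.fset_uniq.
by apply: ereal_sup_ubound; exists n.
Unshelve. all: by end_near. Qed.

(** The Fatou half: finitely many indices carry [l] up to [e / 2], and a finite sum of convergent
    terms converges. *)
Lemma Esum_lsc A (y : nat -> T -> R) f (e l : R) : 0 < e ->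
  (forall n i, 0 <= y n i) -> (forall i, 0 <= f i) ->
  (forall i, A i -> y ^~ i @ \oo --> f i) -> (Esum A f = l%:E)%E ->
  \forall n \near \oo, ((l - e)%:E < Esum A (y n))%E.
Proof.
move=> e0 y0 f0 yf fl; have e20 : 0 < e / 2 by rewrite divr_gt0.
have [|J [uJ JA]] := Esum_approx f0 e20 (A := A); first by rewrite fl ltry.
rewrite fl lte_fin => lJ.
have cJ : \sum_(i <- J) y n i @[n --> \oo] --> \sum_(i <- J) f i.
  by apply: cvg_sum_seq => i /JA; exact: yf.
have /cvgrPdist_lt/(_ _ e20) := cJ; apply: filterS => n.
rewrite ltr_norml => /andP[_ h]; apply: lt_le_trans (Esum_ge _ uJ JA) => //.
by rewrite lte_fin; lra.
Qed.

Lemma EsumZ A f (k : R) : 0 <= k -> (forall i, 0 <= f i) ->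
  (Esum A f < +oo)%E ->
  (Esum A (fun i => k * f i)%R = k%:E * Esum A f)%E.
Proof.
move=> k0 f0 Aoo; apply/eqP; rewrite eq_le; apply/andP; split.
  apply: ub_ereal_sup => _ [F [finF FA] <-]; rewrite fsbig_finite//= sumEFin.
  rewrite -big_distrr/= EFinM; apply: lee_pmul => //.
    by rewrite lee_fin sumr_ge0.
  by apply: Esum_ge => // i iF; apply: FA; move: iF; rewrite in_fset_set// inE.
have kf0 i : 0 <= k * f i by rewrite mulr_ge0.
apply/lee_addgt0Pr => e e0.
(* Dividing by [k + 1] rather than [k] also covers [k = 0]. *)
have d0 : 0 < e / (k + 1) by rewrite divr_gt0// ltr_wpDl.
have [J [uJ JA /ltW h]] := Esum_approx f0 d0 Aoo.
have k0E : (0 <= k%:E)%E by rewrite lee_fin.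
apply: (le_trans (lee_wpmul2l k0E h)).
rewrite -EFinM mulrDr EFinD; apply: leeD.
  by rewrite big_distrr/=; exact: Esum_ge.
rewrite lee_fin mulrCA ger_pMr// ler_pdivrMr ?mul1r ?lerDl//.
by rewrite ltr_wpDl.
Qed.

(** Lower semicontinuity is applied twice, to [y * f] and to [(K - y) * f]. Their sums add up to the
    constant [K * S], so the second lower bound is an upper bound for the first. *)
Lemma cvg_Esum_dominated A (y : nat -> T -> R) (z f : T -> R) (K S : R) :
  (forall n i, 0 <= y n i <= K) -> (forall i, 0 <= z i <= K) ->
  (forall i, 0 <= f i) -> (Esum A f = S%:E)%E ->
  (forall i, A i -> y ^~ i @ \oo --> z i) ->
  exists2 l : R, (Esum A (fun i => z i * f i)%R = l%:E)%E &
  fine (Esum A (fun i => y n i * f i)%R) @[n --> \oo] --> l.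
Proof.
move=> yK zK f0 fS yz.
have split_sum (v : T -> R) : (forall i, 0 <= v i <= K) ->
    exists2 l : R, (Esum A (fun i => v i * f i) = l%:E)%E &
    (Esum A (fun i => (K - v i) * f i) = (K * S - l)%:E)%E.
  move=> vK; have v0 i : 0 <= v i * f i.
    by rewrite mulr_ge0//; case/andP: (vK i).
  have Kv0 i : 0 <= (K - v i) * f i.
    by rewrite mulr_ge0// subr_ge0; case/andP: (vK i).
  have E : (Esum A (fun i => v i * f i) + Esum A (fun i => (K - v i) * f i) =
            (K * S)%:E)%E.
    rewrite -esumD//; last 2 first.
    - by move=> *; rewrite lee_fin.
    - by move=> *; rewrite lee_fin.
    rewrite (eq_esum (b := fun i => (K * f i)%:E)); last first.
      by move=> i _; rewrite -EFinD; congr EFin; ring.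
    (* An index is what witnesses [0 <= K]; over the empty set all sums are 0. *)
    have [[i Ai]|nA] := pselect (exists i, A i).
      rewrite EsumZ//; first by rewrite fS.
        by have /andP[h1 h2] := vK i; exact: le_trans h2.
      by rewrite fS ltry.
    move: fS; have -> : A = set0 by apply/seteqP; split=> i // Ai; case: nA; exists i.
    by rewrite !esum_set0 => -[<-]; rewrite mulr0.
  have ge1 : (0 <= Esum A (fun i => v i * f i))%E.
    by apply: esum_ge0 => i _; rewrite lee_fin.
  have ge2 : (0 <= Esum A (fun i => (K - v i) * f i))%E.
    by apply: esum_ge0 => i _; rewrite lee_fin.
  move: E ge1 ge2; case: esum => [l| |]; case: esum => [l'| |]//= [<-] _ _.
  by exists l => //; congr EFin; ring.
have [l zl Kzl] := split_sum z zK.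
exists l => //; apply/cvgrPdist_lt => /= e e0.
have h1 := Esum_lsc e0 _ _ _ zl.
have {}h1 : \forall n \near \oo, ((l - e)%:E < Esum A (fun i => y n i * f i)%R)%E.
  apply: h1 => [n i|i|i Ai].
  - by rewrite mulr_ge0//; case/andP: (yK n i).
  - by rewrite mulr_ge0//; case/andP: (zK i).
  - by apply: cvgM; [exact: yz|exact: cvg_cst].
have h2 := Esum_lsc e0 _ _ _ Kzl.
have {}h2 : \forall n \near \oo,
    ((K * S - l - e)%:E < Esum A (fun i => (K - y n i) * f i)%R)%E.
  apply: h2 => [n i|i|i Ai].
  - by rewrite mulr_ge0// subr_ge0; case/andP: (yK n i).
  - by rewrite mulr_ge0// subr_ge0; case/andP: (zK i).
  - by apply: cvgM; [apply: cvgB; [exact: cvg_cst|exact: yz]|exact: cvg_cst].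
apply: filterS2 h1 h2 => n; have [l' -> ->] := split_sum (y n) (yK n).
by rewrite !lte_fin/= ltr_norml => ? ?; apply/andP; split; lra.
Qed.

End esum_limits.

Section running_esum.
Context {R : realType}.
Implicit Types (a b c u v : R) (f : R -> R).
Local Notation Esum A f := (\esum_(i in A) (f i)%:E)%E.

Lemma Esum_itvU a c b f : a <= c -> c <= b -> (forall i, 0 <= f i) ->
  (Esum `]a, b] f = Esum `]a, c] f + Esum `]c, b] f)%E.
Proof.
move=> ac cb f0; rewrite -Esum_setU//.
  by rewrite -itv_bndbnd_setU// bnd_simp.
apply/disj_setPS => x [/=]; rewrite !in_itv/= => /andP[_ xc] /andP[cx _].
by move: (lt_le_trans cx xc); rewrite ltxx.
Qed.

Lemma Esum_itv_fine a b u f : (forall i, 0 <= f i) -> (Esum `]a, b] f < +oo)%E ->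
  u <= b -> (Esum `]a, u] f)%E \is a fin_num.
Proof.
move=> f0 foo ub; rewrite ge0_fin_numE; last first.
  by apply: esum_ge0 => *; rewrite lee_fin.
by apply: le_lt_trans foo; apply: Esum_subset => //; apply: subset_itvl; rewrite bnd_simp.
Qed.

(** Finitely many points of []u, b]] carry all of its mass up to [e]. They stay at a positive
    distance [g] from [u], so []u, v]] has mass at most [e] as soon as [v < u + g]. *)
Lemma running_Esum_rcont a b u f : (forall i, 0 <= f i) ->
  (Esum `]a, b] f < +oo)%E -> a <= u < b ->
  fine (Esum `]a, v] f)%E @[v --> u^'+] --> fine (Esum `]a, u] f)%E.
Proof.
move=> f0 foo /andP[au ub]; apply/cvgrPdist_le => /= e e0.
have uoo : (Esum `]u, b] f < +oo)%E.
  by apply: le_lt_trans foo; apply: Esum_subset => //; apply: subset_itvr; rewrite bnd_simp.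
have [J [uJ JA Je]] := Esum_approx f0 e0 uoo.
have [g g0 gP] := seq_pos_lbound [seq c - u | c <- J].
near=> v; have uv : u < v by near: v; exact: nbhs_right_gt.
have vb : v <= b by near: v; apply: nbhs_right_le.
have vg : v < u + g by near: v; apply: nbhs_right_lt; rewrite ltrDl.
have fin1 := Esum_itv_fine f0 foo (ltW ub).
rewrite (Esum_itvU au (ltW uv) f0).
have fin2 : (Esum `]u, v] f)%E \is a fin_num by exact: Esum_itv_fine uoo vb.
rewrite fineD// opprD addrA subrr sub0r normrN ger0_norm ?fine_ge0 ?esum_ge0//; last first.
  by move=> *; rewrite lee_fin.
rewrite -lee_fin fineK//; have fin3 : (Esum `]v, b] f)%E \is a fin_num.
  rewrite ge0_fin_numE; last by apply: esum_ge0 => *; rewrite lee_fin.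
  by apply: le_lt_trans uoo; apply: Esum_subset => //; apply: subset_itvr; rewrite bnd_simp ltW.
have Jv : ((\sum_(i <- J) f i)%:E <= Esum `]v, b] f)%E.
  apply: Esum_ge => // c cJ; have /= := JA c cJ; rewrite !in_itv/= => /andP[uc ->].
  have : g <= c - u by apply: gP; [exact: map_f|rewrite subr_gt0].
  by rewrite andbT; lra.
move: Je; rewrite (Esum_itvU (ltW uv) vb f0) EFinD -(fineK fin2) -(fineK fin3).
by move: Jv; rewrite -(fineK fin3) -!EFinD !lte_fin !lee_fin; lra.
Unshelve. all: by end_near. Qed.

End running_esum.

(** * Independence and measurability *)

Section measurable_wrt_theory.
Context {R : realType} {d : measure_display} {Omega : measurableType d}.
Context (G : set (set Omega)) (sG : sigma_algebra setT G) (mG : G `<=` measurable).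
Implicit Types (Y Z : Omega -> R).

(** On the type generated by [G] the measurable sets are exactly [G], so closure of [measurable_wrt]
    under algebra and composition follows from that of [measurable_fun]. *)
Lemma measurable_wrtP Y : measurable_wrt G Y <->
  measurable_fun (setT : set (g_sigma_algebraType G)) Y.
Proof.
split=> [mY _ B mB|mY B mB].
  by rewrite setTI; apply: sub_sigma_algebra; exact: mY.
have := mY measurableT B mB; rewrite setTI /measurable/=.
by rewrite sigma_algebra_id.
Qed.

Lemma measurable_wrt_measurable Y : measurable_wrt G Y -> measurable_fun setT Y.
Proof. by move=> mY _ B mB; rewrite setTI; apply: mG; exact: mY. Qed.

Lemma measurable_wrt_comp (g : R -> R) Y : measurable_fun setT g ->
  measurable_wrt G Y -> measurable_wrt G (g \o Y).
Proof. by move=> mg /measurable_wrtP mY; apply/measurable_wrtP/measurableT_comp. Qed.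

Lemma measurable_wrtB Y Z : measurable_wrt G Y -> measurable_wrt G Z ->
  measurable_wrt G (fun w => Y w - Z w).
Proof.
by move=> /measurable_wrtP mY /measurable_wrtP mZ; apply/measurable_wrtP/measurable_funB.
Qed.

Lemma measurable_wrt_sum (I : Type) (s : seq I) (Y : I -> Omega -> R) :
  (forall i, measurable_wrt G (Y i)) ->
  measurable_wrt G (fun w => \sum_(i <- s) Y i w).
Proof.
move=> mY; apply/measurable_wrtP; apply: measurable_sum => i.
exact/measurable_wrtP.
Qed.

End measurable_wrt_theory.

Section independence.
Context {R : realType} {d : measure_display} {T : measurableType d}.
Context (P : probability T R).
Implicit Types (Y Z : T -> R).
Local Open Scope ereal_scope.

Definition independent Y Z := forall A B : set R, measurable A -> measurable B ->
  P (Y @^-1` A `&` Z @^-1` B) = P (Y @^-1` A) * P (Z @^-1` B).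

Lemma independent_comp (g h : R -> R) Y Z : measurable_fun setT g ->
  measurable_fun setT h -> independent Y Z -> independent (g \o Y) (h \o Z).
Proof.
move=> mg mh YZ A B mA mB; apply: (YZ (g @^-1` A) (h @^-1` B)).
  by rewrite -[X in measurable X]setTI; exact: mg.
by rewrite -[X in measurable X]setTI; exact: mh.
Qed.

(** The law of the pair agrees with the product of the two laws on rectangles, hence everywhere, and
    Fubini applies to the function [z.1 * z.2]. *)
Lemma integral_independent Y Z : independent Y Z ->
  P.-integrable setT (EFin \o Y) -> P.-integrable setT (EFin \o Z) ->
  P.-integrable setT (EFin \o (fun w => Y w * Z w)%R) /\
  (\int[P]_w (Y w * Z w) = \int[P]_w Y w * \int[P]_w Z w)%R.
Proof.
move=> YZ iY iZ.
have mY : measurable_fun setT Y by apply/measurable_EFinP; exact: measurable_int iY.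
have mZ : measurable_fun setT Z by apply/measurable_EFinP; exact: measurable_int iZ.
have mYZ : measurable_fun setT (fun w => (Y w, Z w)) by exact: measurable_fun_pair.
pose Y' : {RV P >-> R} := HB.pack Y (isMeasurableFun.Build _ _ _ _ Y mY).
pose Z' : {RV P >-> R} := HB.pack Z (isMeasurableFun.Build _ _ _ _ Z mZ).
pose V : {RV P >-> _} := HB.pack (fun w => (Y w, Z w))
  (isMeasurableFun.Build _ _ _ _ _ mYZ).
pose m1 := distribution P Y'; pose m2 := distribution P Z'.
pose m := distribution P V.
have mE (X : set (R * R)) : measurable X -> (m1 \x m2) X = m X.
  apply: product_measure_unique => A B mA mB.
  by rewrite -[RHS]YZ.
pose f (z : R * R) : \bar R := (z.1 * z.2)%:E.
have mf : measurable_fun setT f.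
  apply/measurable_EFinP; apply: measurable_funM.
    exact: measurable_fst.
  exact: measurable_snd.
have m_int (g : R * R -> \bar R) : \int[m]_z g z = \int[m1 \x m2]_z g z.
  by apply: eq_measure_integral => X mX _; exact/esym/mE.
have iZm : m2.-integrable setT EFin.
  apply/integrableP; split => //; rewrite ge0_integral_distribution//.
    by move/integrableP : iZ => [].
  exact: measurableT_comp.
have iYm : m1.-integrable setT EFin.
  apply/integrableP; split => //; rewrite ge0_integral_distribution//.
    by move/integrableP : iY => [].
  exact: measurableT_comp.
have m1E : \int[m1]_y y%:E = \int[P]_w (Y w)%:E.
  by rewrite integral_distribution.
have m2E : \int[m2]_z z%:E = \int[P]_w (Z w)%:E.
  by rewrite integral_distribution.
have finZ : \int[m2]_z z%:E \is a fin_num by exact: integrable_fin_num.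
have finY : \int[m1]_z z%:E \is a fin_num by exact: integrable_fin_num.
have inner y : \int[m2]_z f (y, z) = y%:E * \int[m2]_z z%:E.
  by rewrite /f; under eq_integral do rewrite EFinM; rewrite integralZl.
have inner_abs y : \int[m2]_z `|f (y, z)| = `|y|%:E * \int[m2]_z `|z|%:E.
  rewrite -(integralZl measurableT (integrable_norm iZm) `|y|%R).
  by apply: eq_integral => z _; rewrite /f/= normrM EFinM.
have finaZ : \int[m2]_z `|z|%:E \is a fin_num.
  by apply: integrable_fin_num => //; exact: (integrable_norm iZm).
have i12 : (m1 \x m2).-integrable setT f.
  apply/integrable12ltyP => //.
  under eq_integral do rewrite inner_abs.
  rewrite -(fineK finaZ) integralZr//; last exact: (integrable_norm iYm).
  have finaY : \int[m1]_y `|y|%:E \is a fin_num.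
    by apply: integrable_fin_num => //; exact: (integrable_norm iYm).
  by rewrite -(fineK finaY) -EFinM ltry.
have iYZ : P.-integrable setT (EFin \o (fun w => Y w * Z w)%R).
  apply/integrableP; split.
    by apply/measurable_EFinP/measurable_funM.
  rewrite -[ltLHS](ge0_integral_distribution V (f := fun z => `|f z|))//.
    by rewrite -/m m_int; move/integrableP : i12 => [].
  exact: measurableT_comp.
split=> //.
have -> : (\int[P]_w (Y w * Z w) = fine (\int[m1 \x m2]_z f z))%R.
  by rewrite -m_int integral_distribution.
rewrite -(integral12_prod_meas1 i12).
under eq_integral do rewrite /fubini_F inner.
by rewrite -(fineK finZ) integralZr// fineM// m1E m2E.
Qed.

End independence.

(** * The cosine kernels *)

Section trigonometric_kernel.
Context {R : realType}.
Implicit Types (x y : R) (K n : nat).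

(** The mean value theorem gives [sin x = cos c * x] with [0 < c < x], and [1 - cos c] is twice the
    square of [sin (c / 2)], hence at most [c]. Quadratic order suffices, since it is compared with
    the variance. *)
Lemma sin_pos_bounds x : 0 < x -> `|sin x| <= x /\ `|sin x - x| <= x ^+ 2.
Proof.
have lip (z : R) : 0 < z -> exists2 c : R, 0 < c < z & sin z = cos c * z.
  move=> z0; have [] := @MVT R sin cos 0 z z0.
    exact/continuous_subspaceT/continuous_sin.
  by move=> c; rewrite in_itv/= sin0 !subr0 => cz cE; exists c.
have sinle (z : R) : 0 < z -> `|sin z| <= z.
  move=> z0; have [c _ ->] := lip z z0.
  by rewrite normrM (gtr0_norm z0) ler_piMl ?(ltW z0)// cos_max.
move=> x0; split; first exact: sinle.
have [c /andP[c0 cx] ->] := lip x x0.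
rewrite -{2}(mul1r x) -mulrBl normrM (gtr0_norm x0) expr2 ler_pM2r//.
have -> : c = (c / 2) *+ 2 by rewrite -mulr_natr divfK.
rewrite cos_mulr2n cos2sin2.
have h : `|sin (c / 2)| <= c / 2 by apply: sinle; rewrite divr_gt0.
have : (sin (c / 2)) ^+ 2 <= c / 2.
  apply: le_trans h; rewrite -real_normK ?num_real// expr2 ler_piMr//.
  exact: sin_max.
have := sqr_ge0 (sin (c / 2)).
move: (sin (c / 2) ^+ 2) => t t0 t1.
rewrite (_ : _ - 1 = - (2 * t)); last by rewrite -mulr_natr; ring.
rewrite normrN ger0_norm; lra.
Qed.

Lemma norm_sin_le x : `|sin x| <= `|x|.
Proof.
have [x0|x0|->] := ltgtP x 0; last by rewrite sin0 normr0.
  have [|+ _] := @sin_pos_bounds (- x); first by rewrite oppr_gt0.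
  by rewrite sinN normrN (ltr0_norm x0).
by rewrite (gtr0_norm x0) (sin_pos_bounds x0).1.
Qed.

Lemma norm_sinB_le x : `|sin x - x| <= x ^+ 2.
Proof.
have [x0|x0|->] := ltgtP x 0; last by rewrite sin0 subrr normr0 sqr_ge0.
  have [|_] := @sin_pos_bounds (- x); first by rewrite oppr_gt0.
  by rewrite sinN sqrrN -opprD normrN.
exact: (sin_pos_bounds x0).2.
Qed.

Lemma oneBcosE x : 1 - cos x = 2 * sin (x / 2) ^+ 2.
Proof.
have {1}-> : x = (x / 2) *+ 2 by rewrite -mulr_natr divfK.
rewrite cos_mulr2n cos2sin2; ring.
Qed.

Lemma oneBcos_ge0 x : 0 <= 1 - cos x.
Proof. by rewrite subr_ge0 cos_le1. Qed.

Lemma oneBcos_le2 x : 1 - cos x <= 2.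
Proof. by have := cos_geN1 x; lra. Qed.

Lemma oneBcos_le x : 1 - cos x <= x ^+ 2 / 2.
Proof.
rewrite oneBcosE; have := norm_sin_le (x / 2); rewrite -ler_sqr ?nnegrE//.
rewrite !real_normK ?num_real//.
by rewrite expr_div_n; move: (sin _ ^+ 2) (x ^+ 2) => u v; lra.
Qed.

(** Half-angles turn the left side into twice a difference of squares of [sin (x / 2)] and [x / 2].
    One factor is quadratic and the other linear in [x]. *)
Lemma norm_oneBcosB x : `|(1 - cos x) - x ^+ 2 / 2| <= `|x| ^+ 3 / 2.
Proof.
rewrite oneBcosE.
rewrite (_ : _ - _ = 2 * ((sin (x / 2) - x / 2) * (sin (x / 2) + x / 2))); last by field.
rewrite normrM [`|2|]ger0_norm// normrM.
have h1 := norm_sinB_le (x / 2).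
have h2 : `|sin (x / 2) + x / 2| <= `|x|.
  rewrite (le_trans (ler_normD _ _))//.
  have := norm_sin_le (x / 2); rewrite normrM [`|2^-1|]ger0_norm//; lra.
have : `|sin (x / 2) - x / 2| * `|sin (x / 2) + x / 2| <= (x / 2) ^+ 2 * `|x|.
  exact: ler_pM.
rewrite expr_div_n -[x ^+ 2]real_normK ?num_real//.
move: `|x| => u; move: (_ * _) => v h.
rewrite (_ : u ^+ 3 / 2 = 2 * (u ^+ 2 / 2 ^+ 2 * u)); first by rewrite ler_pM2l.
by field.
Qed.

(* [2(1 - cos y) - (1 - cos 2y)/2 = (1 - cos y)^2], so that these functions
   increase in [K]; they tend to [x ^+ 2] but are [O(x^3)] at 0. *)
Definition rho K x : R :=
  2 * 4 ^+ K * (1 - cos (x / 2 ^+ K)) - 2 / 4 ^+ K * (1 - cos (2 ^+ K * x)).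

Lemma oneBcos_double y : 1 - cos (2 * y) <= 4 * (1 - cos y).
Proof.
have -> : 2 * y = y *+ 2 by rewrite mulr_natl.
rewrite cos_mulr2n; have := cos_geN1 y; have := cos_le1 y; nra.
Qed.

Lemma rho0 x : rho 0 x = 0.
Proof. by rewrite /rho !expr0 divr1 mul1r mulr1 divr1 subrr. Qed.

(** Passing from [K] to [K.+1] halves one frequency and doubles the other; the doubling inequality
    makes the first term grow and the subtracted one shrink. *)
Lemma rhoS K x : rho K x <= rho K.+1 x.
Proof.
have p4 : (0 : R) < 4 ^+ K by rewrite exprn_gt0.
rewrite /rho; apply: lerB.
  have xE : x / 2 ^+ K = 2 * (x / 2 ^+ K.+1).
    by rewrite exprS; field; rewrite expf_neq0.
  have := ler_wpM2l (ltW p4) (oneBcos_double (x / 2 ^+ K.+1)).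
  by rewrite -xE [4 ^+ K.+1]exprS; lra.
rewrite (_ : 2 ^+ K.+1 * x = 2 * (2 ^+ K * x)); last by rewrite exprS mulrA.
have p4V : 0 <= (4 ^+ K)^-1 :> R by rewrite invr_ge0 ltW.
have := ler_wpM2l p4V (oneBcos_double (2 ^+ K * x)).
by rewrite [4 ^+ K.+1]exprS invfM; lra.
Qed.

Lemma rho_homo x : {homo rho ^~ x : m n / (m <= n)%N >-> m <= n}.
Proof. by apply: homo_leq => [//|y z t|n]; [exact: le_trans|exact: rhoS]. Qed.

Lemma rho_ge0 K x : 0 <= rho K x.
Proof. by rewrite -(rho0 x); exact: rho_homo. Qed.

Let pow4 K : 4 ^+ K = 2 ^+ K * 2 ^+ K :> R.
Proof. by rewrite -exprMn -natrM. Qed.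

Lemma rho_le_bound K x : rho K x <= 4 * 4 ^+ K.
Proof.
have p4 : (0 : R) < 4 ^+ K by rewrite exprn_gt0.
have : 0 <= 2 / 4 ^+ K * (1 - cos (2 ^+ K * x)).
  by rewrite mulr_ge0 ?oneBcos_ge0// divr_ge0// ltW.
have := oneBcos_le2 (x / 2 ^+ K); rewrite /rho; nra.
Qed.

Lemma rho_le_sqr K x : rho K x <= x ^+ 2.
Proof.
have p4 : (0 : R) < 4 ^+ K by rewrite exprn_gt0.
have : 0 <= 2 / 4 ^+ K * (1 - cos (2 ^+ K * x)).
  by rewrite mulr_ge0 ?oneBcos_ge0// divr_ge0// ltW.
have h := oneBcos_le (x / 2 ^+ K).
have : 2 * 4 ^+ K * (1 - cos (x / 2 ^+ K)) <= x ^+ 2.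
  rewrite (_ : x ^+ 2 = 2 * 4 ^+ K * ((x / 2 ^+ K) ^+ 2 / 2)).
    by rewrite ler_pM2l// mulr_gt0.
  by rewrite pow4; field; rewrite expf_neq0.
rewrite /rho; lra.
Qed.

(** Both cosine terms equal [x ^+ 2] to second order and cancel; what is left is the cubic error of
    the one with frequency [2 ^+ K]. *)
Lemma rho_le_cube K x : rho K x <= 2 ^+ K * `|x| ^+ 3.
Proof.
have p4 : (0 : R) < 4 ^+ K by rewrite exprn_gt0.
have p2 : (0 : R) < 2 ^+ K by rewrite exprn_gt0.
have h1 : 2 * 4 ^+ K * (1 - cos (x / 2 ^+ K)) <= x ^+ 2.
  rewrite (_ : x ^+ 2 = 2 * 4 ^+ K * ((x / 2 ^+ K) ^+ 2 / 2)).
    by rewrite ler_pM2l ?oneBcos_le// mulr_gt0.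
  by rewrite pow4; field; rewrite expf_neq0.
have h2 : x ^+ 2 - 2 ^+ K * `|x| ^+ 3 <= 2 / 4 ^+ K * (1 - cos (2 ^+ K * x)).
  rewrite (_ : x ^+ 2 - _ = 2 / 4 ^+ K *
    ((2 ^+ K * x) ^+ 2 / 2 - `|2 ^+ K * x| ^+ 3 / 2)).
    rewrite ler_pM2l ?divr_gt0//.
    by have := norm_oneBcosB (2 ^+ K * x); rewrite ler_norml => /andP[+ _]; lra.
  rewrite normrM (gtr0_norm p2) !exprMn pow4.
  by field; rewrite expf_neq0.
rewrite /rho; lra.
Qed.

(** The cube is the Taylor error at frequency [1 / 2 ^+ K]; the 4 bounds the subtracted term, since
    [1 - cos] is at most 2 and [4 ^+ K] dominates [2 ^+ K]. *)
Lemma rho_ge K x : x ^+ 2 - (`|x| ^+ 3 + 4) / 2 ^+ K <= rho K x.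
Proof.
have p4 : (0 : R) < 4 ^+ K by rewrite exprn_gt0.
have p2 : (0 : R) < 2 ^+ K by rewrite exprn_gt0.
have p21 : (1 : R) <= 2 ^+ K by rewrite exprn_ege1// ler1n.
have h1 : x ^+ 2 - `|x| ^+ 3 / 2 ^+ K <= 2 * 4 ^+ K * (1 - cos (x / 2 ^+ K)).
  rewrite (_ : x ^+ 2 - _ = 2 * 4 ^+ K *
    ((x / 2 ^+ K) ^+ 2 / 2 - `|x / 2 ^+ K| ^+ 3 / 2)).
    rewrite ler_pM2l ?mulr_gt0//.
    by have := norm_oneBcosB (x / 2 ^+ K); rewrite ler_norml => /andP[+ _]; lra.
  rewrite normrM normfV (gtr0_norm p2) !exprMn !exprVn pow4.
  by field; rewrite expf_neq0.
have h2 : 2 / 4 ^+ K * (1 - cos (2 ^+ K * x)) <= 4 / 2 ^+ K.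
  apply: (@le_trans _ _ (2 / 4 ^+ K * 2)).
    by rewrite ler_pM2l ?divr_gt0// oneBcos_le2.
  rewrite mulrAC -natrM ler_pM2l// lef_pV2 ?posrE//.
  by rewrite pow4 ler_peMl// ltW.
rewrite mulrDl /rho; lra.
Qed.

Lemma cvg_exp2V : (2 ^+ K)^-1 @[K --> \oo] --> (0 : R).
Proof.
under eq_fun do rewrite -exprVn; apply: cvg_expr.
by rewrite ger0_norm// invf_lt1// ltr1n.
Qed.

Lemma cvg_rho x : rho K x @[K --> \oo] --> x ^+ 2.
Proof.
apply: (@squeeze_cvgr _ _ _ _ (fun K => x ^+ 2 - (`|x| ^+ 3 + 4) / 2 ^+ K) (cst (x ^+ 2))).
- by apply: nearW => K; rewrite rho_ge rho_le_sqr.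
- rewrite -{2}(subr0 (x ^+ 2)); apply: cvgB; first exact: cvg_cst.
  rewrite -[X in _ --> X](mulr0 (`|x| ^+ 3 + 4)); apply: cvgM; first exact: cvg_cst.
  exact: cvg_exp2V.
- exact: cvg_cst.
Qed.

Lemma continuous_oneBcos (c : R) : continuous (fun x : R => 1 - cos (c * x)).
Proof.
move=> x; apply: cvgB; first exact: cvg_cst.
apply: (@continuous_comp _ _ _ (fun z => c * z)); last exact: continuous_cos.
by apply: cvgM; [exact: cvg_cst|exact: cvg_id].
Qed.

Lemma continuous_rho K : continuous (rho K).
Proof.
move=> x; apply: cvgB; apply: cvgM; try exact: cvg_cst.
  under eq_fun do rewrite mulrC; rewrite mulrC; exact: continuous_oneBcos.
exact: continuous_oneBcos.
Qed.

(* [rho] is [O(x^3)] at 0, so the correction makes [psi] vanish near 0; its cost is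
   at most [1 / (K + 1)] times the quadratic variation. *)
Definition psi K x : R := Num.max 0 (rho K x - x ^+ 2 / K.+1%:R).

Lemma psi_ge0 K x : 0 <= psi K x.
Proof. by rewrite /psi le_max lexx. Qed.

Lemma psi_le_rho K x : psi K x <= rho K x.
Proof.
rewrite /psi ge_max rho_ge0/= lerBlDr lerDl divr_ge0 ?sqr_ge0//.
Qed.

Lemma psi_ge K x : rho K x - x ^+ 2 / K.+1%:R <= psi K x.
Proof. by rewrite /psi le_max lexx orbT. Qed.

Lemma psi_homo x : {homo psi ^~ x : m n / (m <= n)%N >-> m <= n}.
Proof.
move=> m n mn; rewrite /psi ge_max psi_ge0/= le_max; apply/orP; right.
apply: lerB; first exact: rho_homo.
by rewrite ler_wpM2l ?sqr_ge0// lef_pV2 ?posrE// ler_nat.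
Qed.

(** The radius is where the cubic bound [2 ^+ K * |x| ^+ 3] on [rho] meets the correction
    [x ^+ 2 / K.+1]. *)
Lemma psi_near0 K x : `|x| <= (2 ^+ K)^-1 / K.+1%:R -> psi K x = 0.
Proof.
move=> xK; apply/eqP; rewrite /psi; apply/eqP/max_idPl.
rewrite subr_le0 (le_trans (rho_le_cube K x))//.
rewrite exprS -[x ^+ 2]real_normK ?num_real// mulrA mulrC ler_wpM2l//.
have p2 : (0 : R) < 2 ^+ K by rewrite exprn_gt0.
have := ler_wpM2l (ltW p2) xK; by rewrite mulrA divff ?mul1r.
Qed.

Lemma cvg_psi x : psi K x @[K --> \oo] --> x ^+ 2.
Proof.
apply: (@squeeze_cvgr _ _ _ _ (fun K => rho K x - x ^+ 2 / K.+1%:R) (cst (x ^+ 2))).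
- apply: nearW => K; rewrite psi_ge (le_trans (psi_le_rho _ _))//.
  exact: rho_le_sqr.
- rewrite -{2}(subr0 (x ^+ 2)); apply: cvgB; first exact: cvg_rho.
  rewrite -[X in _ --> X](mulr0 (x ^+ 2)); apply: cvgM; first exact: cvg_cst.
  exact: cvg_harmonic.
- exact: cvg_cst.
Qed.

Lemma continuous_psi K : continuous (psi K).
Proof.
move=> x; apply: (@continuous_max _ _ (cst 0) (fun x => rho K x - x ^+ 2 / K.+1%:R)).
  exact: cvg_cst.
apply: cvgB; first exact: continuous_rho.
by apply: cvgM; [exact: exprn_continuous|exact: cvg_cst].
Qed.

End trigonometric_kernel.

(** The Cauchy equation on the half-line. Nonnegativity makes [f] monotone, which replaces
    continuity: [f x] is squeezed between values at rational points. *)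
Lemma additive_ge0_linear (R : realType) (f : R -> R) :
  (forall x : R, 0 <= x -> 0 <= f x) ->
  (forall x y : R, 0 <= x -> 0 <= y -> f (x + y) = f x + f y) ->
  forall x : R, 0 <= x -> f x = x * f 1.
Proof.
move=> f0 fD x x0.
have fnat n (y : R) : 0 <= y -> f (n%:R * y) = n%:R * f y.
  move=> y0; elim: n => [|n IH].
    by have := fD 0 0 (lexx _) (lexx _); rewrite !mul0r addr0; lra.
  rewrite -natr1 mulrDl mul1r fD ?IH ?mulr_ge0//; ring.
have homo (y z : R) : 0 <= y -> y <= z -> f y <= f z.
  move=> y0 yz; rewrite -(subrK y z) fD ?subr_ge0// lerDr f0// subr_ge0//.
have f1 := f0 _ ler01.
apply/eqP; rewrite -subr_eq0 -normr_le0; apply/ler_addgt0Pr => /= e e0.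
(* With denominator [n] the squeeze has width [f 1 / n], which this choice puts below [e]. *)
rewrite add0r; pose n := (Num.trunc (f 1 / e)).+1.
have n0 : (0 : R) < n%:R by rewrite ltr0n.
have nP : f 1 < n%:R * e.
  have /andP[_] := @Num.Theory.truncn_itv R (f 1 / e) (divr_ge0 f1 (ltW e0)).
  by rewrite ltr_pdivrMr.
have /andP[k1 k2] := @Num.Theory.truncn_itv R (n%:R * x) (mulr_ge0 (ltW n0) x0).
move: k1 k2; set k := Num.trunc _ => k1 /ltW k2.
have h1 := homo _ _ (ler0n R k) k1.
have h2 := homo _ _ (mulr_ge0 (ltW n0) x0) k2.
move: h1 h2; rewrite fnat// -[k%:R]mulr1 fnat// -[k.+1%:R]mulr1 fnat// -natr1 => h1 h2.
have k1' := ler_wpM2r f1 k1; have k2' := ler_wpM2r f1 k2.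
rewrite -(ler_pM2l n0) -[X in X * `|_|](gtr0_norm n0) -normrM mulrBr mulrA ler_norml.
move: k1' k2'; rewrite -natr1; move: (k%:R : R) (n%:R : R) nP h1 h2 => kk nn nP h1 h2.
by move=> ? ?; apply/andP; split; lra.
Qed.

(** * The Levy process and its characteristic exponent *)

Section integrable_real.
Context {R : realType} {d : measure_display} {T : measurableType d}.
Context (P : probability T R).
Implicit Types (Y Z : T -> R).

Lemma integrable_measurable (Y : T -> R) :
  P.-integrable setT (EFin \o Y) -> measurable_fun setT Y.
Proof. by move=> iY; apply/measurable_EFinP; exact: measurable_int iY. Qed.

Lemma integrable_bounded Y (M : R) : measurable_fun setT Y ->
  (forall w, `|Y w| <= M) -> P.-integrable setT (EFin \o Y).
Proof.
move=> mY YM; apply: measurable_bounded_integrable => //.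
  by rewrite (le_lt_trans (probability_le1 _ _))// ltry.
by exists M; split; [exact: num_real|move=> x Mx w _; exact: le_trans (YM w) (ltW Mx)].
Qed.

Lemma integrable_dominated Y Z : measurable_fun setT Y ->
  P.-integrable setT (EFin \o Z) -> (forall w, `|Y w| <= Z w) ->
  P.-integrable setT (EFin \o Y).
Proof.
move=> mY iZ YZ; apply: le_integrable iZ => //; first exact/measurable_EFinP.
by move=> w _ /=; rewrite lee_fin (le_trans (YZ w))// ler_norm.
Qed.

Lemma Rintegral_prob_cst (k : R) : \int[P]_w k = k.
Proof.
have PT : P setT = 1%E by exact: probability_setT.
by rewrite Rintegral_cst//= PT mulr1.
Qed.

Lemma sqr_Rintegral_le Y : P.-integrable setT (EFin \o Y) ->
  P.-integrable setT (EFin \o (fun w => Y w ^+ 2)) ->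
  (\int[P]_w Y w) ^+ 2 <= \int[P]_w (Y w ^+ 2).
Proof.
move=> iY iY2; set m := \int[P]_w Y w.
have : 0 <= \int[P]_w (Y w ^+ 2 - (2 * m) * Y w + m ^+ 2).
  apply: Rintegral_ge0 => w _.
  by rewrite (_ : _ + _ = (Y w - m) ^+ 2) ?sqr_ge0//; ring.
have iZ : P.-integrable setT (EFin \o (fun w => (2 * m) * Y w)).
  exact: integrable_Rscale.
have iB : P.-integrable setT (EFin \o (fun w => Y w ^+ 2 - (2 * m) * Y w)).
  exact: (integrableB measurableT iY2 iZ).
rewrite RintegralD//; last exact: (@integrable_bounded _ `|m ^+ 2|).
by rewrite RintegralB// RintegralZl// Rintegral_prob_cst -/m; lra.
Qed.

Lemma equidistributed_Rintegral Y Z (g : R -> R) : measurable_fun setT Y ->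
  measurable_fun setT Z -> measurable_fun setT g ->
  (forall B, measurable B -> P (Y @^-1` B) = P (Z @^-1` B)) ->
  P.-integrable setT (EFin \o (g \o Z)) ->
  P.-integrable setT (EFin \o (g \o Y)) /\
  \int[P]_w g (Y w) = \int[P]_w g (Z w).
Proof.
move=> mY mZ mg YZ iZ.
pose Y' : {RV P >-> R} := HB.pack Y (isMeasurableFun.Build _ _ _ _ Y mY).
pose Z' : {RV P >-> R} := HB.pack Z (isMeasurableFun.Build _ _ _ _ Z mZ).
have E (f : R -> \bar R) :
    (\int[distribution P Y']_y f y = \int[distribution P Z']_y f y)%E.
  by apply: eq_measure_integral => B mB _; exact: YZ.
have mgE : measurable_fun setT (EFin \o g) by exact/measurable_EFinP.
have iY : P.-integrable setT (EFin \o (g \o Y)).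
  apply/integrableP; split; first by apply/measurable_EFinP/measurableT_comp.
  have -> : (\int[P]_x `|(EFin \o (g \o Y)) x| =
    \int[distribution P Y']_y `|(g y)%:E|)%E.
    by rewrite ge0_integral_distribution//; exact: measurableT_comp.
  rewrite E ge0_integral_distribution//; last exact: measurableT_comp.
  by move/integrableP : iZ => [].
split=> //; rewrite /Rintegral.
have -> : (\int[P]_w (g (Y w))%:E = \int[distribution P Y']_y (g y)%:E)%E.
  by rewrite integral_distribution.
by rewrite E integral_distribution.
Qed.

End integrable_real.

Section levy_increments.
Context {R : realType} {d : measure_display} {Omega : measurableType d}.
Context (P : probability Omega R) (r : R) (F : R -> set (set Omega)).
Context (L : Omega -> R -> R).
Hypotheses (hF : filtration r F) (hL : centered_sq_levy P r F L).
Implicit Types (s t h k u : R) (g : R -> R).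

Lemma filtration_sigma t : -r <= t -> sigma_algebra setT (F t).
Proof. by case: hF => h _ /h[]. Qed.

Lemma filtration_measurable t : -r <= t -> F t `<=` measurable.
Proof. by case: hF => h _ /h[]. Qed.

Lemma measurable_wrt_filtration s t (Y : Omega -> R) : -r <= s -> s <= t ->
  measurable_wrt (F s) Y -> measurable_wrt (F t) Y.
Proof. by case: hF => _ h rs st mY B mB; apply: (h s t) => //; exact: mY. Qed.

Lemma levy_adapted t : -r <= t -> measurable_wrt (F t) (L^~ t).
Proof. by case: hL => -[+ _] _ _ _ _; exact. Qed.

Lemma levy_increment_adapted s t : -r <= s -> s <= t ->
  measurable_wrt (F t) (fun w => L w t - L w s).
Proof.
move=> rs st; have rt := le_trans rs st.
apply: measurable_wrtB; first exact: filtration_sigma.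
  exact: levy_adapted.
by apply: (measurable_wrt_filtration rs st); exact: levy_adapted.
Qed.

Lemma measurable_levy_increment s t : -r <= s -> s <= t ->
  measurable_fun setT (fun w => L w t - L w s).
Proof.
move=> rs st; have rt := le_trans rs st.
apply: (@measurable_wrt_measurable _ _ _ (F t)).
  exact: filtration_measurable.
exact: levy_increment_adapted.
Qed.

Lemma levy_independent s t (Y : Omega -> R) : -r <= s -> s <= t -> measurable_wrt (F s) Y ->
  independent P Y (fun w => L w t - L w s).
Proof.
move=> rs st mY A B mA mB; case: hL => _ _ /(_ s t rs st) + _ _; apply => //.
exact: mY.
Qed.

Lemma levy_start w : L w (-r) = 0.
Proof. by case: hL. Qed.

Lemma levy_integrable t : -r <= t -> P.-integrable setT (EFin \o L^~ t).
Proof. by case: hL => _ _ _ _ /[apply] -[]. Qed.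

Lemma levy_integrable2 t : -r <= t ->
  P.-integrable setT (EFin \o (fun w => L w t ^+ 2)).
Proof. by case: hL => _ _ _ _ /[apply] -[]. Qed.

Lemma levy_centered t : -r <= t -> \int[P]_w L w t = 0.
Proof. by case: hL => _ _ _ _ /[apply] -[]. Qed.

Lemma levy_stationary s h g : -r <= s -> 0 <= h -> measurable_fun setT g ->
  P.-integrable setT (EFin \o (fun w => g (L w (-r + h)))) ->
  P.-integrable setT (EFin \o (fun w => g (L w (s + h) - L w s))) /\
  \int[P]_w g (L w (s + h) - L w s) = \int[P]_w g (L w (-r + h)).
Proof.
move=> rs h0 mg ig.
have rh : -r <= -r + h by rewrite lerDl.
apply: equidistributed_Rintegral => //.
- by apply: measurable_levy_increment; rewrite // lerDl.
- exact: (measurable_wrt_measurable (filtration_measurable rh) (levy_adapted rh)).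
move=> B mB; case: hL => _ _ _ /(_ s (-r) h rs (lexx _) h0 B mB) -> _.
by congr (P _); apply/seteqP; split=> w /=; rewrite levy_start subr0.
Qed.

Definition levy_var h : R := \int[P]_w (L w (-r + h) ^+ 2).
Definition levy_cos u h : R := \int[P]_w cos (u * L w (-r + h)).
Definition levy_sin u h : R := \int[P]_w sin (u * L w (-r + h)).

Lemma measurable_cosZ u : measurable_fun setT (fun x : R => cos (u * x)).
Proof.
apply: (measurableT_comp (f := cos)); last exact: mulrl_measurable.
by apply: continuous_measurable_fun; exact: continuous_cos.
Qed.

Lemma measurable_sinZ u : measurable_fun setT (fun x : R => sin (u * x)).
Proof.
apply: (measurableT_comp (f := sin)); last exact: mulrl_measurable.
by apply: continuous_measurable_fun; exact: continuous_sin.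
Qed.

Lemma integrable_bounded_comp g (M : R) (Y : Omega -> R) :
  measurable_fun setT g -> (forall x, `|g x| <= M) -> measurable_fun setT Y ->
  P.-integrable setT (EFin \o (g \o Y)).
Proof.
move=> mg gM mY; apply: (@integrable_bounded _ _ _ _ _ M) => [|w]; last exact: gM.
exact: measurableT_comp.
Qed.

Lemma measurable_levy t : -r <= t -> measurable_fun setT (L^~ t).
Proof.
by move=> rt; exact: (measurable_wrt_measurable (filtration_measurable rt) (levy_adapted rt)).
Qed.

(* The law of [L_(-r + h + k)] is that of the sum of independent copies of
   [L_(-r + h)] and [L_(-r + k)]. *)
Lemma levy_indep_prod h k (f g : R -> R) : 0 <= h -> 0 <= k ->
  measurable_fun setT f -> measurable_fun setT g ->
  P.-integrable setT (EFin \o (fun w => f (L w (-r + h)))) ->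
  P.-integrable setT (EFin \o (fun w => g (L w (-r + k)))) ->
  P.-integrable setT (EFin \o (fun w =>
    f (L w (-r + h)) * g (L w (-r + h + k) - L w (-r + h)))) /\
  \int[P]_w (f (L w (-r + h)) * g (L w (-r + h + k) - L w (-r + h))) =
  \int[P]_w f (L w (-r + h)) * \int[P]_w g (L w (-r + k)).
Proof.
move=> h0 k0 mf mg iff ig; have rh : -r <= -r + h by rewrite lerDl.
have [ig' <-] := levy_stationary rh k0 mg ig.
apply: (integral_independent (Y := fun w => f (L w (-r + h)))) => //.
apply: independent_comp => //.
apply: levy_independent => //; first by rewrite lerDl.
exact: levy_adapted.
Qed.

(** The cross term factors by independence and vanishes by centering. *)
Lemma levy_varD h k : 0 <= h -> 0 <= k ->
  levy_var (h + k) = levy_var h + levy_var k.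
Proof.
move=> h0 k0; have rh : -r <= -r + h by rewrite lerDl.
have rk : -r <= -r + k by rewrite lerDl.
have m2 : measurable_fun setT (fun x : R => x ^+ 2).
  by apply: continuous_measurable_fun; exact: exprn_continuous.
have mid : measurable_fun setT (fun x : R => x) by exact: measurable_id.
have [/= i1 e1] := levy_indep_prod h0 k0 mid mid
  (levy_integrable rh) (levy_integrable rk).
have [i2 e2] := levy_stationary rh k0 m2 (levy_integrable2 rk).
rewrite /levy_var addrA -e2.
under eq_Rintegral => w _.
  rewrite (_ : L w (- r + h + k) ^+ 2 = L w (-r + h) ^+ 2 +
    2 * (L w (-r + h) * (L w (-r + h + k) - L w (-r + h))) +
    (L w (-r + h + k) - L w (-r + h)) ^+ 2); last by ring.
  over.
have i1' := integrable_Rscale 2 measurableT i1.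
have i0 := levy_integrable2 rh.
rewrite RintegralD//; last exact: (integrableD measurableT i0 i1').
rewrite RintegralD// RintegralZl//.
by rewrite e1 levy_centered// mul0r mulr0 addr0.
Qed.

Lemma levy_var_ge0 h : 0 <= levy_var h.
Proof. by apply: Rintegral_ge0 => w _; rewrite sqr_ge0. Qed.

Lemma levy_var_div t n : 0 <= t -> levy_var (t / n.+1%:R) = levy_var t / n.+1%:R.
Proof.
move=> t0; have d0 : 0 <= t / n.+1%:R by rewrite divr_ge0.
have lin := additive_ge0_linear (fun h _ => levy_var_ge0 h) levy_varD.
by rewrite (lin _ d0) (lin _ t0) mulrAC.
Qed.

Lemma integrable_levy_cos u h : 0 <= h ->
  P.-integrable setT (EFin \o (fun w => cos (u * L w (-r + h)))).
Proof.
move=> h0; apply: (@integrable_bounded_comp _ 1 _ (measurable_cosZ u)).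
  by move=> x; exact: cos_max.
by apply: measurable_levy; rewrite lerDl.
Qed.

Lemma integrable_levy_sin u h : 0 <= h ->
  P.-integrable setT (EFin \o (fun w => sin (u * L w (-r + h)))).
Proof.
move=> h0; apply: (@integrable_bounded_comp _ 1 _ (measurable_sinZ u)).
  by move=> x; exact: sin_max.
by apply: measurable_levy; rewrite lerDl.
Qed.

Lemma levy_cosD u h k : 0 <= h -> 0 <= k ->
  levy_cos u (h + k) = levy_cos u h * levy_cos u k - levy_sin u h * levy_sin u k.
Proof.
move=> h0 k0.
have [i1 e1] := levy_indep_prod h0 k0 (measurable_cosZ u) (measurable_cosZ u)
  (integrable_levy_cos u h0) (integrable_levy_cos u k0).
have [i2 e2] := levy_indep_prod h0 k0 (measurable_sinZ u) (measurable_sinZ u)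
  (integrable_levy_sin u h0) (integrable_levy_sin u k0).
rewrite /levy_cos /levy_sin addrA -e1 -e2 -RintegralB//.
apply: eq_Rintegral => w _; rewrite -cosD; congr cos; ring.
Qed.

Lemma levy_sinD u h k : 0 <= h -> 0 <= k ->
  levy_sin u (h + k) = levy_sin u h * levy_cos u k + levy_cos u h * levy_sin u k.
Proof.
move=> h0 k0.
have [i1 e1] := levy_indep_prod h0 k0 (measurable_sinZ u) (measurable_cosZ u)
  (integrable_levy_sin u h0) (integrable_levy_cos u k0).
have [i2 e2] := levy_indep_prod h0 k0 (measurable_cosZ u) (measurable_sinZ u)
  (integrable_levy_cos u h0) (integrable_levy_sin u k0).
rewrite /levy_cos /levy_sin addrA -e1 -e2 -RintegralD//.
apply: eq_Rintegral => w _; rewrite -sinD; congr sin; ring.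
Qed.

(** Squared modulus of the characteristic function at time [h]. Unlike the function itself it has a
    real logarithm, with no branch to choose. *)
Definition levy_sqmod u h : R := levy_cos u h ^+ 2 + levy_sin u h ^+ 2.

Lemma levy_sqmodD u h k : 0 <= h -> 0 <= k ->
  levy_sqmod u (h + k) = levy_sqmod u h * levy_sqmod u k.
Proof. by move=> h0 k0; rewrite /levy_sqmod levy_cosD// levy_sinD//; ring. Qed.

(** The square of a mean is at most the mean of the square, applied to cosine and sine
    separately. *)
Lemma levy_sqmod_le1 u h : 0 <= h -> levy_sqmod u h <= 1.
Proof.
move=> h0; have mL : measurable_fun setT (L^~ (-r + h)).
  by apply: measurable_levy; rewrite lerDl.
have m2 : measurable_fun setT (fun x : R => x ^+ 2).
  by apply: continuous_measurable_fun; exact: exprn_continuous.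
have ic : P.-integrable setT (EFin \o (fun w => cos (u * L w (-r + h)) ^+ 2)).
  apply: (@integrable_bounded_comp _ 1 _ (measurableT_comp m2 (measurable_cosZ u))) => // x.
  by rewrite /= normrX exprn_ile1// cos_max.
have is_ : P.-integrable setT (EFin \o (fun w => sin (u * L w (-r + h)) ^+ 2)).
  apply: (@integrable_bounded_comp _ 1 _ (measurableT_comp m2 (measurable_sinZ u))) => // x.
  by rewrite /= normrX exprn_ile1// sin_max.
have := sqr_Rintegral_le (integrable_levy_cos u h0) ic.
have := sqr_Rintegral_le (integrable_levy_sin u h0) is_.
have : \int[P]_w (cos (u * L w (-r + h)) ^+ 2) +
       \int[P]_w (sin (u * L w (-r + h)) ^+ 2) = 1.
  rewrite -RintegralD//; under eq_Rintegral do rewrite cos2Dsin2.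
  exact: Rintegral_prob_cst.
rewrite /levy_sqmod /levy_cos /levy_sin; lra.
Qed.

End levy_increments.

(** * The modulus of the characteristic function and its short-time behaviour *)

Section levy_exponent.
Context {R : realType} {d : measure_display} {Omega : measurableType d}.
Context (P : probability Omega R) (r : R) (F : R -> set (set Omega)).
Context (L : Omega -> R -> R) (Pi : {measure set R -> \bar R}).
Hypotheses (hF : filtration r F) (hL : centered_sq_levy P r F L).
Hypotheses (hPi : levy_measure Pi) (hLK : levy_khintchine_no_brownian P r L Pi).
Implicit Types (s t h u x z : R) (n K : nat).
Local Notation var := (levy_var P r L).
Local Notation Cos := (levy_cos P r L).
Local Notation Sin := (levy_sin P r L).
Local Notation sqmod := (levy_sqmod P r L).

(** Minus the real part of the characteristic exponent. *)
Definition levy_exponent u : R := \int[Pi]_z (1 - cos (u * z)).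

Lemma measurable_oneBcos u : measurable_fun setT (fun z : R => 1 - cos (u * z)).
Proof. by apply: measurable_funB => //; exact: measurable_cosZ. Qed.

Lemma integrable_oneBcos u : Pi.-integrable setT (EFin \o (fun z => 1 - cos (u * z))).
Proof.
have m2 : measurable_fun setT (fun x : R => x ^+ 2).
  by apply: continuous_measurable_fun; exact: exprn_continuous.
have mmin : measurable_fun setT (fun z : R => Num.min 1 (z ^+ 2)).
  exact: measurable_minr.
have imin : Pi.-integrable setT (EFin \o (fun z => Num.min 1 (z ^+ 2))).
  apply/integrableP; split; first exact/measurable_EFinP.
  case: hPi => _; apply: le_lt_trans.
  by rewrite le_eqVlt; apply/orP; left; apply/eqP; apply: eq_integral => z _ /=;
    rewrite ger0_norm// le_min ler01 sqr_ge0.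
(* The constant serves both regimes: [1 - cos] is at most 2 where the minimum is 1, and at most
   [(u * z) ^+ 2 / 2] where it is [z ^+ 2]. *)
apply: le_integrable (integrable_Rscale (2 + u ^+ 2) measurableT imin) => //.
  by apply/measurable_EFinP; exact: measurable_oneBcos.
move=> z _; rewrite /= lee_fin ger0_norm ?oneBcos_ge0// ger0_norm; last first.
  by rewrite mulr_ge0 ?addr_ge0 ?sqr_ge0// le_min ler01 sqr_ge0.
have u2 := sqr_ge0 u; have z2 := sqr_ge0 z.
rewrite minEle; case: ifPn => _.
  by have := oneBcos_le2 (u * z); lra.
have := oneBcos_le (u * z); rewrite exprMn.
have := mulr_ge0 u2 z2; nra.
Qed.

Lemma levy_exponent_ge0 u : 0 <= levy_exponent u.
Proof. by apply: Rintegral_ge0 => z _; exact: oneBcos_ge0. Qed.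

(** The drift and the compensated sine integral enter only the phase, which the modulus removes. *)
Lemma levy_sqmod1 u : sqmod u 1 = expR (- (2 * levy_exponent u)).
Proof.
have [b /(_ u)/= [hc hs]] := hLK; move: hc hs.
rewrite -[expect P _]/(Cos u 1) -[expect P (fun w => sin _)]/(Sin u 1).
rewrite (_ : \int[Pi]_z (cos (u * z) - 1) = - levy_exponent u); last first.
  rewrite /levy_exponent -[RHS]mulN1r -RintegralZl//; last exact: integrable_oneBcos.
  by apply: eq_Rintegral => z _; rewrite mulN1r opprB.
rewrite /levy_sqmod => -> ->; rewrite !exprMn -mulrDr cos2Dsin2 mulr1.
by rewrite expr2 -expRD; congr expR; ring.
Qed.

(** By multiplicativity a zero at [h] would propagate to every later time, in particular to a
    positive integer, where the value is a power of an exponential. *)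
Lemma levy_sqmod_gt0 u h : 0 <= h -> 0 < sqmod u h.
Proof.
move=> h0; rewrite lt_neqAle addr_ge0 ?sqr_ge0// andbT eq_sym.
have nat_gt0 n : 0 < sqmod u n.+1%:R.
  elim: n => [|n IH]; first by rewrite levy_sqmod1 expR_gt0.
  by rewrite -natr1 (levy_sqmodD hF hL)// mulr_gt0// levy_sqmod1 expR_gt0.
have /andP[_ hM] := @Num.Theory.truncn_itv R h h0.
have := nat_gt0 (Num.trunc h); apply: contraTneq => h00.
by rewrite -[X in sqmod u X](subrK h) (levy_sqmodD hF hL) ?subr_ge0 ?(ltW hM)// h00 mulr0 ltxx.
Qed.

(** Minus its logarithm is additive in [h] and nonnegative, hence linear, with slope known from
    [h = 1]. *)
Lemma levy_sqmodE u h : 0 <= h -> sqmod u h = expR (- (2 * levy_exponent u * h)).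
Proof.
move=> h0; have lin := @additive_ge0_linear R (fun h => - ln (sqmod u h)).
have : - ln (sqmod u h) = h * - ln (sqmod u 1).
  apply: lin => // [x x0|x y x0 y0].
    by rewrite oppr_ge0 ln_le0// (levy_sqmod_le1 hF hL).
  by rewrite (levy_sqmodD hF hL)// lnM ?posrE ?levy_sqmod_gt0// opprD.
rewrite levy_sqmod1 expRK opprK => e.
by rewrite -[LHS]lnK ?posrE ?levy_sqmod_gt0// -[ln _]opprK e; congr expR; ring.
Qed.

(** Centering allows the linear term to be subtracted for free, which raises the order from 1 to
    2. *)
Lemma levy_sin_le u h : 0 <= h -> `|Sin u h| <= u ^+ 2 * var h.
Proof.
move=> h0; have rh : -r <= -r + h by rewrite lerDl.
have iL := integrable_Rscale u measurableT (levy_integrable hL rh).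
have isn := integrable_levy_sin hF hL u h0.
have -> : Sin u h = \int[P]_w (sin (u * L w (-r + h)) - u * L w (-r + h)).
  by rewrite RintegralB// RintegralZl ?(levy_integrable hL)// (levy_centered hL)// mulr0 subr0.
have iB := integrableB measurableT isn iL.
rewrite (le_trans (le_normr_Rintegral _ iB))// /levy_var -RintegralZl//; last first.
  exact: (levy_integrable2 hL rh).
apply: le_Rintegral => //; first exact: (integrable_norm iB).
  exact: (integrable_Rscale _ _ (levy_integrable2 hL rh)).
by move=> w _; rewrite -exprMn norm_sinB_le.
Qed.

Lemma levy_cos_bounds u h : 0 <= h -> 0 <= 1 - Cos u h <= u ^+ 2 * var h.
Proof.
move=> h0; have rh : -r <= -r + h by rewrite lerDl.
have ic := integrable_levy_cos hF hL u h0.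
have i1 : P.-integrable setT (EFin \o (fun=> 1 : R)).
  by apply: (@integrable_bounded _ _ _ P _ 1) => // w; rewrite normr1.
have -> : 1 - Cos u h = \int[P]_w (1 - cos (u * L w (-r + h))).
  by rewrite RintegralB// Rintegral_prob_cst.
rewrite Rintegral_ge0 => [/=|w _]; last exact: oneBcos_ge0.
rewrite /levy_var -RintegralZl//; last exact: (levy_integrable2 hL rh).
apply: le_Rintegral => //; first exact: (integrableB measurableT i1 ic).
  exact: (integrable_Rscale _ _ (levy_integrable2 hL rh)).
move=> w _; rewrite -exprMn (le_trans (oneBcos_le _))//.
by have := sqr_ge0 (u * L w (-r + h)); lra.
Qed.

(** Squeeze from [y / (1 + y) <= 1 - expR (- y) <= y] at [y = a / n.+1]. *)
Lemma cvg_expR_rate (a : R) : 0 <= a ->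
  n.+1%:R * (1 - expR (- (a / n.+1%:R))) @[n --> \oo] --> a.
Proof.
move=> a0; apply: (@squeeze_cvgr _ _ _ _ (fun n => a / (1 + a / n.+1%:R)) (cst a)).
- apply: nearW => n; have n0 : (0 : R) < n.+1%:R by [].
  have y0 : 0 <= a / n.+1%:R by rewrite divr_ge0.
  have ay : a = n.+1%:R * (a / n.+1%:R) by rewrite mulrCA divff ?mulr1 ?pnatr_eq0.
  apply/andP; split.
    rewrite {1}ay -mulrA ler_pM2l//; move: (a / _) y0 => y y0.
    have y1 : 0 < 1 + y by rewrite ltr_wpDr.
    rewrite ler_pdivrMr// mulrBl mul1r.
    have h : 1 + y <= expR y by exact: expR_ge1Dx.
    have h2 : expR (- y) * (1 + y) <= 1.
      by rewrite expRN ler_pdivrMl ?expR_gt0// mulr1.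
    lra.
  rewrite /cst [leRHS]ay ler_pM2l//; have := expR_ge1Dx (- (a / n.+1%:R)).
  by move: (a / _) => y; lra.
- rewrite -[X in _ --> X]divr1; apply: cvgM; first exact: cvg_cst.
  apply: cvgV; first exact: oner_neq0.
  rewrite -[X in _ --> X]addr0; apply: cvgD; first exact: cvg_cst.
  rewrite -(mulr0 a); apply: cvgM; first exact: cvg_cst.
  exact: cvg_harmonic.
- exact: cvg_cst.
Qed.

Lemma cvg_levy_cos u t : 0 <= t ->
  n.+1%:R * (1 - Cos u (t / n.+1%:R)) @[n --> \oo] --> t * levy_exponent u.
Proof.
move=> t0; have d0 n : 0 <= t / n.+1%:R by rewrite divr_ge0.
set v := u ^+ 2 * var t.
have v0 : 0 <= v by rewrite mulr_ge0 ?sqr_ge0 ?levy_var_ge0.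
have varE n : u ^+ 2 * var (t / n.+1%:R) = v / n.+1%:R.
  by rewrite (levy_var_div hF hL)// mulrA.
have cv : v / n.+1%:R @[n --> \oo] --> (0 : R).
  by rewrite -(mulr0 v); apply: cvgM; [exact: cvg_cst|exact: cvg_harmonic].
have cc : Cos u (t / n.+1%:R) @[n --> \oo] --> (1 : R).
  apply: (@squeeze_cvgr _ _ _ _ (fun n => 1 - v / n.+1%:R) (cst 1)).
  - apply: nearW => n; have := levy_cos_bounds u (d0 n); rewrite varE /cst/=.
    by move: (v / _) (Cos _ _) => x y /andP[? ?]; apply/andP; split; lra.
  - by rewrite -[X in _ --> X](subr0 1); apply: cvgB => //; exact: cvg_cst.
  - exact: cvg_cst.
have cs : n.+1%:R * Sin u (t / n.+1%:R) ^+ 2 @[n --> \oo] --> (0 : R).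
  apply: (@squeeze_cvgr _ _ _ _ (cst 0) (fun n => v * (v / n.+1%:R))).
  - apply: nearW => n; rewrite /= mulr_ge0 ?sqr_ge0//=.
    have := levy_sin_le u (d0 n); rewrite varE => h.
    have : Sin u (t / n.+1%:R) ^+ 2 <= (v / n.+1%:R) ^+ 2.
      by rewrite -[leLHS]real_normK ?num_real// ler_sqr ?nnegrE// divr_ge0.
    move=> /(ler_wpM2l (ler0n R n.+1)) /le_trans; apply.
    by rewrite le_eqVlt; apply/orP; left; apply/eqP; field; rewrite addrC natr1 pnatr_eq0.
  - exact: cvg_cst.
  - by rewrite -(mulr0 v); apply: cvgM => //; exact: cvg_cst.
have -> : t * levy_exponent u = (2 * levy_exponent u * t + 0) / (1 + 1) by field.
have cd : 1 + Cos u (t / n.+1%:R) @[n --> \oo] --> (1 + 1 : R).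
  by apply: cvgD => //; exact: cvg_cst.
have a0 : 0 <= 2 * levy_exponent u * t.
  by rewrite !mulr_ge0// levy_exponent_ge0.
have cn : n.+1%:R * (1 - expR (- (2 * levy_exponent u * t / n.+1%:R))) +
   n.+1%:R * Sin u (t / n.+1%:R) ^+ 2 @[n --> \oo] --> 2 * levy_exponent u * t + 0.
  by apply: cvgD => //; exact: cvg_expR_rate.
have cq : (n.+1%:R * (1 - expR (- (2 * levy_exponent u * t / n.+1%:R))) +
   n.+1%:R * Sin u (t / n.+1%:R) ^+ 2) / (1 + Cos u (t / n.+1%:R)) @[n --> \oo] -->
   (2 * levy_exponent u * t + 0) / (1 + 1).
  by apply: cvgM => //; apply: cvgV => //; rewrite gt_eqF.
apply: cvg_trans cq; apply: near_eq_cvg.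
have /cvgr_gt/(_ 0 (@ltr01 R)) := cc; apply: filterS => n c0.
have := levy_sqmodE u (d0 n); rewrite /levy_sqmod mulrA => <-.
have : 1 + Cos u (t / n.+1%:R) != 0 by rewrite gt_eqF// ltr_wpDl.
move: (Cos _ _) (Sin _ _) => c s cN0.
by field.
Qed.

Definition levy_rho K : R := \int[Pi]_z rho K z.

Lemma levy_rhoE K : levy_rho K = 2 * 4 ^+ K * levy_exponent ((2 ^+ K)^-1) -
  2 / 4 ^+ K * levy_exponent (2 ^+ K).
Proof.
rewrite /levy_rho /levy_exponent.
rewrite -RintegralZl//; last exact: integrable_oneBcos.
rewrite -RintegralZl//; last exact: integrable_oneBcos.
rewrite -RintegralB//; first by apply: eq_Rintegral => z _; rewrite /rho [z / _]mulrC.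
  exact/integrable_Rscale/integrable_oneBcos.
exact/integrable_Rscale/integrable_oneBcos.
Qed.

End levy_exponent.

(** * The compensation formula *)

Lemma continuous_minr {R : realType} (k : R) : continuous (fun x : R => Num.min x k).
Proof. by move=> x; apply: (@continuous_min _ _ id (cst k)); [exact: cvg_id|exact: cvg_cst]. Qed.

Lemma continuous_maxr {R : realType} (k : R) : continuous (fun x : R => Num.max x k).
Proof. by move=> x; apply: (@continuous_max _ _ id (cst k)); [exact: cvg_id|exact: cvg_cst]. Qed.

Lemma EFin_Rintegral {d} {T : measurableType d} {R : realType}
  (mu : {measure set T -> \bar R}) (D : set T) (f : T -> R) :
  measurable D -> mu.-integrable D (EFin \o f) ->
  (\int[mu]_(x in D) (f x)%:E = (\int[mu]_(x in D) f x)%R%:E)%E.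
Proof. by move=> mD fi; rewrite /Rintegral fineK//; exact: integrable_fin_num. Qed.

(** * Convergence of means under bounded second moments *)

Section uniform_integrability.
Context {R : realType} {d : measure_display} {T : measurableType d}.
Context (P : probability T R).

Lemma fatou_bound (f_ : nat -> T -> \bar R) (f : T -> \bar R) (c : \bar R) :
  (forall n, measurable_fun setT (f_ n)) -> (forall n w, 0 <= f_ n w)%E ->
  (forall w, f_ ^~ w @ \oo --> f w) ->
  (forall n, \int[P]_w f_ n w <= c)%E -> (\int[P]_w f w <= c)%E.
Proof.
move=> mf f0 ff fc.
under eq_integral => w _ do rewrite -((cvg_limn_einf_sup (ff w)).1).
apply: (le_trans (fatou P measurableT mf (fun n w _ => f0 n w))).
rewrite limn_einf_lim; apply: lime_le; first exact: is_cvg_einfs.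
apply: nearW => n; apply: le_trans (fc n).
by apply: ereal_inf_lbound; exists n => /=.
Qed.

(* Truncate [Z] at level [k]: the second moment bounds the remainder by [M * C / k]. *)
Lemma cvg_integral_bounded_second_moment (Z : nat -> T -> R) (D Y : T -> R) (M C : R) :
  measurable_fun setT Y -> (forall w, 0 <= Y w <= M) ->
  (forall n, measurable_fun setT (Z n)) -> (forall n w, 0 <= Z n w) ->
  (forall w, Z ^~ w @ \oo --> D w) ->
  (forall n, P.-integrable setT (EFin \o (fun w => Z n w ^+ 2))) ->
  (forall n, \int[P]_w (Z n w ^+ 2) <= C) ->
  P.-integrable setT (EFin \o (fun w => Y w * D w)) /\
  \int[P]_w (Y w * Z n w) @[n --> \oo] --> \int[P]_w (Y w * D w).
Proof.
move=> mY YM mZ Z0 ZD iZ2 Z2C.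
have mD : measurable_fun setT D by apply: (measurable_fun_cvg mZ) => w _; exact: ZD.
have D0 w : 0 <= D w.
  rewrite -(cvg_lim (@Rhausdorff R) (ZD w)); apply: limr_ge.
    by apply/cvg_ex; exists (D w); exact: ZD.
  by apply: nearW => n; exact: Z0.
have iZ n : P.-integrable setT (EFin \o Z n).
  have i1 : P.-integrable setT (EFin \o (fun=> 1 : R)).
    by apply: (@integrable_bounded _ _ _ P _ 1) => // w; rewrite normr1.
  apply: (@integrable_dominated _ _ _ P _ (fun w => 1 + Z n w ^+ 2)) => //.
    exact: (integrableD measurableT i1 (iZ2 n)).
  by move=> w; rewrite ger0_norm//; nra.
have C0 : 0 <= C by apply: le_trans (Z2C 0%N); apply: Rintegral_ge0 => w _; exact: sqr_ge0.
have M0 : 0 <= M by have /andP[h1 h2] := YM point; exact: le_trans h2.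
have Y0 w : 0 <= Y w by case/andP: (YM w).
have YleM w : Y w <= M by case/andP: (YM w).
(* First moments are at most [1 + C], since [Z] is at most [1 + Z ^+ 2], and Fatou hands this bound
   to the limit. *)
have iD : P.-integrable setT (EFin \o D).
  apply/integrableP; split; first exact/measurable_EFinP.
  apply: (@le_lt_trans _ _ (1 + C)%:E); last exact: ltry.
  under eq_integral => w _ do rewrite /= ger0_norm//.
  apply: (@fatou_bound (fun n w => (Z n w)%:E)) => [n|n w|w|n].
  - exact/measurable_EFinP.
  - by rewrite lee_fin.
  - by apply/fine_cvgP; split; [exact: nearW|exact: ZD].
  have i1 : P.-integrable setT (EFin \o (fun=> 1 : R)).
    by apply: (@integrable_bounded _ _ _ P _ 1) => // w; rewrite normr1.
  rewrite EFin_Rintegral// lee_fin.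
  apply: (@le_trans _ _ (\int[P]_w (1 + Z n w ^+ 2))).
    apply: le_Rintegral => //; first exact: (integrableD measurableT i1 (iZ2 n)).
    by move=> w _; have := Z0 n w; nra.
  by rewrite RintegralD// Rintegral_prob_cst lerD2l.
have iYbd (V : T -> R) : measurable_fun setT V -> P.-integrable setT (EFin \o V) ->
    (forall w, 0 <= V w) -> P.-integrable setT (EFin \o (fun w => Y w * V w)).
  move=> mV iV V0; apply: (@integrable_dominated _ _ _ P _ (fun w => M * V w)).
  - exact: measurable_funM.
  - exact: integrable_Rscale.
  by move=> w; rewrite ger0_norm ?mulr_ge0// ler_wpM2r.
have iYD := iYbd D mD iD D0; have iYZ n := iYbd _ (mZ n) (iZ n) (Z0 n).
split=> //.
have mtr (k : R) (V : T -> R) : measurable_fun setT V ->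
    measurable_fun setT (fun w => Y w * Num.min (V w) k).
  by move=> mV; apply: measurable_funM => //; exact: measurable_minr.
have tr_bd (k : R) (V : T -> R) w : 0 <= k -> 0 <= V w ->
    `|Y w * Num.min (V w) k| <= M * k.
  move=> k0 V0; have m0 : 0 <= Num.min (V w) k by rewrite le_min V0.
  by rewrite ger0_norm ?mulr_ge0// ler_pM// ge_min lexx orbT.
have itr (k : R) (V : T -> R) : 0 <= k -> measurable_fun setT V -> (forall w, 0 <= V w) ->
    P.-integrable setT (EFin \o (fun w => Y w * Num.min (V w) k)).
  by move=> k0 mV V0; apply: (@integrable_bounded _ _ _ P _ (M * k)); [exact: mtr|move=> w; exact: tr_bd].
have cvg_n (k : R) : 0 <= k -> \int[P]_w (Y w * Num.min (Z n w) k) @[n --> \oo] -->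
    \int[P]_w (Y w * Num.min (D w) k).
  move=> k0; have [] // := @Rdominated_convergence _ _ _ P setT
    (fun n w => Y w * Num.min (Z n w) k) (fun w => Y w * Num.min (D w) k) (cst (M * k)).
  - by move=> n; exact: mtr.
  - exact: mtr.
  - apply: aeW => w _; apply: cvgM; first exact: cvg_cst.
    exact: (cvg_comp _ _ (ZD w) (@continuous_minr _ k _)).
  - by apply: (@integrable_bounded _ _ _ P _ (M * k)) => // w; rewrite ger0_norm// mulr_ge0.
  - by apply: aeW => w _ n; exact: tr_bd.
have cvg_k : \int[P]_w (Y w * Num.min (D w) k%:R) @[k --> \oo] -->
    \int[P]_w (Y w * D w).
  have [] // := @Rdominated_convergence _ _ _ P setT
    (fun k w => Y w * Num.min (D w) k%:R) (fun w => Y w * D w) (fun w => Y w * D w).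
  - by move=> k; exact: mtr.
  - exact: measurable_funM.
  - apply: aeW => w _; apply: cvgM; first exact: cvg_cst.
    apply: cvg_near_cst; near=> k; apply/min_idPl.
    near: k; exact: nbhs_infty_ger.
  - apply: aeW => w _ n; have m0 : 0 <= Num.min (D w) n%:R by rewrite le_min D0/=.
    by rewrite ger0_norm ?mulr_ge0// ler_wpM2l// ge_min lexx.
apply/cvgrPdist_le => /= e e0; have e3 : 0 < e / 3 by rewrite divr_gt0.
have [k k0 [kMC kD]] : exists2 k : nat, (0 < k)%N & M * C / k%:R <= e / 3 /\
    `|\int[P]_w (Y w * D w) - \int[P]_w (Y w * Num.min (D w) k%:R)| <= e / 3.
  near \oo => k; exists k; first by near: k; exact: nbhs_infty_gt.
  split; last by near: k; move/cvgrPdist_le : cvg_k; apply.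
  have k0 : (0 < k)%N by near: k; exact: nbhs_infty_gt.
  rewrite ler_pdivrMr ?ltr0n// -ler_pdivrMl//.
  by near: k; exact: nbhs_infty_ger.
have kR : (0 : R) < k%:R by rewrite ltr0n.
have /cvgrPdist_le/(_ _ e3) := cvg_n k%:R (ltW kR); apply: filterS => n kn.
have kZ : `|\int[P]_w (Y w * Z n w) - \int[P]_w (Y w * Num.min (Z n w) k%:R)| <= e / 3.
  have iB := integrableB measurableT (iYZ n) (itr _ _ (ltW kR) (mZ n) (Z0 n)).
  rewrite -RintegralB//; last exact: itr.
  rewrite (le_trans (le_normr_Rintegral _ iB))//.
  apply: le_trans kMC; apply: (@le_trans _ _ (\int[P]_w (M / k%:R * Z n w ^+ 2))).
    apply: le_Rintegral => //; first exact: (integrable_norm iB).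
      exact: integrable_Rscale.
    move=> w _; rewrite -mulrBr normrM (ger0_norm (Y0 w)) -mulrA ler_pM//.
    rewrite mulrC ler_pdivlMr// minEle; case: ifPn => [_|].
      by rewrite subrr normr0 mul0r sqr_ge0.
    rewrite -ltNge => kZ; rewrite ger0_norm ?subr_ge0 ?ltW//.
    by have := Z0 n w; nra.
  by rewrite RintegralZl// mulrAC ler_wpM2r ?invr_ge0 ?(ltW kR)// ler_wpM2l.
move: kn kD kZ; rewrite !ler_norml => /andP[? ?] /andP[? ?] /andP[? ?].
by apply/andP; split; lra.
Unshelve. all: by end_near. Qed.

End uniform_integrability.

(** * Mean of the squared jumps weighted by a variable known at the left end *)

Section jump_compensator.
Context {R : realType} {d : measure_display} {Omega : measurableType d}.
Context (P : probability Omega R) (r : R) (F : R -> set (set Omega)).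
Context (L : Omega -> R -> R) (Pi : {measure set R -> \bar R}).
Hypotheses (hF : filtration r F) (hL : centered_sq_levy P r F L).
Hypotheses (hPi : levy_measure Pi) (hLK : levy_khintchine_no_brownian P r L Pi).
Implicit Types (a b s t h u x z : R) (n K : nat).
Local Notation var := (levy_var P r L).
Local Notation Cos := (levy_cos P r L).
Local Notation lrho := (levy_rho Pi).

Let measurable_rho K : measurable_fun setT (@rho R K).
Proof. by apply: continuous_measurable_fun; exact: continuous_rho. Qed.

Let measurable_psi K : measurable_fun setT (@psi R K).
Proof. by apply: continuous_measurable_fun; exact: continuous_psi. Qed.

Let measurable_sqr : measurable_fun setT (fun x : R => x ^+ 2).
Proof. by apply: continuous_measurable_fun; exact: exprn_continuous. Qed.

Let psi_le_bound K x : psi K x <= 4 * 4 ^+ K.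
Proof. exact: le_trans (psi_le_rho K x) (rho_le_bound K x). Qed.

Let integrable_rho_comp K (Y : Omega -> R) : measurable_fun setT Y ->
  P.-integrable setT (EFin \o (fun w => rho K (Y w))).
Proof.
move=> mY; apply: (@integrable_bounded _ _ _ P _ (4 * 4 ^+ K)).
  exact: measurableT_comp.
by move=> w; rewrite ger0_norm ?rho_ge0// rho_le_bound.
Qed.

Let integrable_psi_comp K (Y : Omega -> R) : measurable_fun setT Y ->
  P.-integrable setT (EFin \o (fun w => psi K (Y w))).
Proof.
move=> mY; apply: (@integrable_bounded _ _ _ P _ (4 * 4 ^+ K)).
  exact: measurableT_comp.
by move=> w; rewrite ger0_norm ?psi_ge0.
Qed.

Let meanrho K h := \int[P]_w rho K (L w (-r + h)).
Let meanpsi K h := \int[P]_w psi K (L w (-r + h)).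

Let mL h : 0 <= h -> measurable_fun setT (L^~ (-r + h)).
Proof. by move=> h0; apply: (measurable_levy hF hL); rewrite lerDl. Qed.

Let iL2 h : 0 <= h -> P.-integrable setT (EFin \o (fun w => L w (-r + h) ^+ 2)).
Proof. by move=> h0; apply: (levy_integrable2 hL); rewrite lerDl. Qed.

Let meanrhoE K h : 0 <= h -> meanrho K h =
  2 * 4 ^+ K * (1 - Cos (2 ^+ K)^-1 h) - 2 / 4 ^+ K * (1 - Cos (2 ^+ K) h).
Proof.
move=> h0.
have i1 : P.-integrable setT (EFin \o (fun=> 1 : R)).
  by apply: (@integrable_bounded _ _ _ P _ 1) => // w; rewrite normr1.
have ic u : P.-integrable setT (EFin \o (fun w => 1 - cos (u * L w (-r + h)))).
  exact: (integrableB measurableT i1 (integrable_levy_cos hF hL u h0)).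
have e u : 1 - Cos u h = \int[P]_w (1 - cos (u * L w (-r + h))).
  by rewrite RintegralB// ?Rintegral_prob_cst//; exact: (integrable_levy_cos hF hL).
rewrite !e -RintegralZl// -RintegralZl// -RintegralB//.
- by apply: eq_Rintegral => w _; rewrite /rho [_ / 2 ^+ K]mulrC.
- exact: integrable_Rscale.
- exact: integrable_Rscale.
Qed.

Let meanrho_le_var K h : 0 <= h -> meanrho K h <= var h.
Proof.
move=> h0; apply: le_Rintegral => //; first exact: integrable_rho_comp (mL h0).
  exact: iL2.
by move=> w _; exact: rho_le_sqr.
Qed.

Let meanpsi_le K h : 0 <= h -> meanpsi K h <= meanrho K h.
Proof.
move=> h0; apply: le_Rintegral => //; first exact: integrable_psi_comp (mL h0).
  exact: integrable_rho_comp (mL h0).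
by move=> w _; exact: psi_le_rho.
Qed.

Let meanpsi_ge K h : 0 <= h -> meanrho K h - var h / K.+1%:R <= meanpsi K h.
Proof.
move=> h0; have i2 := integrable_Rscale (K.+1%:R^-1) measurableT (iL2 h0).
have ir := integrable_rho_comp K (mL h0).
rewrite /var mulrC -RintegralZl ?iL2// -RintegralB//.
apply: le_Rintegral => //; first exact: (integrableB measurableT ir i2).
  exact: integrable_psi_comp (mL h0).
by move=> w _; rewrite mulrC psi_ge.
Qed.

Let cvg_meanrho K t : 0 <= t ->
  n.+1%:R * meanrho K (t / n.+1%:R) @[n --> \oo] --> t * lrho K.
Proof.
move=> t0; have d0 n : 0 <= t / n.+1%:R by rewrite divr_ge0.
rewrite (levy_rhoE hPi).
under eq_fun => n do rewrite meanrhoE// mulrBr mulrCA [X in _ - X]mulrCA.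
rewrite mulrBr mulrCA [X in _ - X]mulrCA.
by apply: cvgB; apply: cvgM; try exact: cvg_cst; exact: (cvg_levy_cos hF hL hPi hLK).
Qed.

(** [rho] lies below the square and the variance is linear in time, so the approximating means never
    exceed [var 1]. The bound is uniform in [K]. *)
Let lrho_le K : lrho K <= var 1.
Proof.
have c := @cvg_meanrho K 1 (@ler01 R); rewrite mul1r in c.
rewrite -(cvg_lim (@Rhausdorff R) c); apply: limr_le; first by apply/cvg_ex; eexists; exact: c.
apply: nearW => n; rewrite -[leRHS](mulKf (x := n.+1%:R)) ?pnatr_eq0//.
rewrite mulrCA ler_wpM2l// [leRHS]mulrC -(levy_var_div hF hL)//.
by apply: meanrho_le_var; rewrite divr_ge0.
Qed.

Let integrable_Pi_rho K : Pi.-integrable setT (EFin \o @rho R K).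
Proof.
have i1 := integrable_Rscale (2 * 4 ^+ K) measurableT (integrable_oneBcos hPi (2 ^+ K)^-1).
have i2 := integrable_Rscale (2 / 4 ^+ K) measurableT (integrable_oneBcos hPi (2 ^+ K)).
have := integrableB measurableT i1 i2; rewrite (_ : (_ \- _)%E = EFin \o rho K)//.
by apply/funext => z /=; rewrite /rho [z / _]mulrC EFinB.
Qed.

Definition kappa2 : R := fine (\int[Pi]_z (z ^+ 2)%:E).

(** Monotone convergence. The uniform bound [var 1] makes the integral of [z ^+ 2] finite, so [fine]
    returns its true value and not a default. *)
Lemma cvg_levy_rho : lrho K @[K --> \oo] --> kappa2.
Proof.
have mono := @cvg_monotone_convergence _ _ R Pi setT measurableT
  (fun K z => (rho K z)%:E).
have {mono} cE : (\int[Pi]_z (rho K z)%:E @[K --> \oo] --> \int[Pi]_z (z ^+ 2)%:E)%E.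
  have E : (\int[Pi]_z (z ^+ 2)%:E = \int[Pi]_z (limn (fun K => (rho K z)%:E)))%E.
    apply: eq_integral => z _; apply/esym/cvg_lim => //.
    by apply/fine_cvgP; split; [exact: nearW|exact: cvg_rho].
  rewrite E; apply: mono => [K|K z _|z _ m n mn].
  - exact/measurable_EFinP.
  - by rewrite lee_fin rho_ge0.
  - by rewrite lee_fin; exact: rho_homo.
have bd : (\int[Pi]_z (z ^+ 2)%:E <= (var 1)%:E)%E.
  rewrite -(cvg_lim (@ereal_hausdorff R) cE); apply: lime_le.
    by apply/cvg_ex; eexists; exact: cE.
  by apply: nearW => K; rewrite EFin_Rintegral// lee_fin; exact: lrho_le.
apply: fine_cvg; rewrite fineK//.
rewrite ge0_fin_numE; first exact: le_lt_trans bd (ltry _).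
by apply: integral_ge0 => z _; rewrite lee_fin sqr_ge0.
Qed.

Definition jump_sqsum (y : R -> R) a b : \bar R :=
  (\esum_(s in `]a, b]) (jump y s ^+ 2)%:E)%E.

Lemma jump_sqsum_ge0 (y : R -> R) a b : (0 <= jump_sqsum y a b)%E.
Proof. by apply: esum_ge0 => s _; rewrite lee_fin sqr_ge0. Qed.

Section interval.
Variables (a b : R) (Y : Omega -> R) (M : R).
Hypotheses (ra : -r <= a) (ab : a < b).
Hypotheses (mY : measurable_wrt (F a) Y) (YM : forall w, 0 <= Y w <= M).

Let W n i w := L w (mesh a b n i.+1) - L w (mesh a b n i).
Let delta n := (b - a) / n.+1%:R.
Let Z K n k w := \sum_(i < k) psi K (W n i w).

Let rmesh n i : -r <= mesh a b n i.
Proof. by rewrite (le_trans ra)// mesh_ge. Qed.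

Let delta0 n : 0 <= delta n.
Proof. exact/ltW/mesh_step_gt0. Qed.

Let mW n i : measurable_fun setT (W n i).
Proof. by apply: (measurable_levy_increment hF hL) => //; exact: le_mesh. Qed.

Let W_adapted n i : measurable_wrt (F (mesh a b n i.+1)) (W n i).
Proof. by apply: (levy_increment_adapted hF hL) => //; exact: le_mesh. Qed.

Let mean_psiW K n i : \int[P]_w psi K (W n i w) = meanpsi K (delta n).
Proof.
have [] // := levy_stationary hF hL (rmesh n i) (delta0 n) (measurable_psi K).
  exact: integrable_psi_comp (mL (delta0 n)).
by rewrite /W meshS.
Qed.

Let Z_adapted K n k : measurable_wrt (F (mesh a b n k)) (Z K n k).
Proof.
have -> : Z K n k = fun w => \sum_(i <- enum 'I_k) psi K (W n i w).
  by apply/funext => w; rewrite /Z big_enum.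
apply: measurable_wrt_sum; first exact: (filtration_sigma hF (rmesh n k)).
move=> i; apply: (measurable_wrt_comp (filtration_sigma hF (rmesh n k)) (measurable_psi K)).
apply: (measurable_wrt_filtration hF _ _ (@W_adapted n i)) => //.
exact: le_mesh.
Qed.

Let mZ K n k : measurable_fun setT (Z K n k).
Proof. exact: (measurable_wrt_measurable (filtration_measurable hF (rmesh n k)) (@Z_adapted K n k)). Qed.

Let Z_ge0 K n k w : 0 <= Z K n k w.
Proof. by apply: sumr_ge0 => i _; exact: psi_ge0. Qed.

Let Z_le K n k w : Z K n k w <= k%:R * (4 * 4 ^+ K).
Proof.
apply: (@le_trans _ _ (\sum_(i < k) (4 * 4 ^+ K))).
  by apply: ler_sum => i _; exact: psi_le_bound.
by rewrite sumr_const card_ord -[leLHS]mulr_natl.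
Qed.

Let iZ K n k : P.-integrable setT (EFin \o Z K n k).
Proof.
apply: (@integrable_bounded _ _ _ P _ (k%:R * (4 * 4 ^+ K))) => //.
by move=> w; rewrite ger0_norm.
Qed.

Let iZ2 K n k : P.-integrable setT (EFin \o (fun w => Z K n k w ^+ 2)).
Proof.
apply: (@integrable_bounded _ _ _ P _ ((k%:R * (4 * 4 ^+ K)) ^+ 2)).
  exact: (measurableT_comp measurable_sqr (@mZ K n k)).
move=> w; rewrite ger0_norm ?sqr_ge0// ler_sqr ?nnegrE//.
Qed.

Let EZ K n k : \int[P]_w Z K n k w = k%:R * meanpsi K (delta n).
Proof.
have -> : \int[P]_w Z K n k w = \int[P]_w (\sum_(i <- enum 'I_k) psi K (W n i w)).
  by apply: eq_Rintegral => w _; rewrite /Z big_enum.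
rewrite Rintegral_sum//; last by move=> i; exact: integrable_psi_comp.
under eq_bigr do rewrite mean_psiW.
by rewrite big_enum sumr_const card_ord -[LHS]mulr_natl.
Qed.

(** Induction on [k]: the cross term factors by independence, and the diagonal is linearised by
    [psi ^+ 2 <= 4 * 4 ^+ K * psi]. At [k = n.+1] the product [k * var (delta n)] is [var (b - a)],
    so the bound no longer depends on the mesh. *)
Let Z_second_moment K n k : \int[P]_w (Z K n k w ^+ 2) <=
  (k%:R * var (delta n)) ^+ 2 + k%:R * (4 * 4 ^+ K * var (delta n)).
Proof.
set v := var (delta n); have v0 : 0 <= v by exact: levy_var_ge0.
have pv : meanpsi K (delta n) <= v.
  exact: le_trans (meanpsi_le _ (delta0 n)) (meanrho_le_var _ (delta0 n)).
have p0 : 0 <= meanpsi K (delta n) by apply: Rintegral_ge0 => w _; exact: psi_ge0.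
clearbody v.
elim: k => [|k IH].
  rewrite mul0r expr0n/= mul0r addr0 le_eqVlt; apply/orP; left; apply/eqP.
  rewrite -[RHS](@Rintegral_prob_cst _ _ _ P); apply: eq_Rintegral => w _.
  by rewrite /Z big_ord0 expr0n.
have ip := @integrable_psi_comp K _ (mW n k).
have [i1 e1] : P.-integrable setT (EFin \o (fun w => Z K n k w * psi K (W n k w))) /\
  \int[P]_w (Z K n k w * psi K (W n k w)) =
  \int[P]_w Z K n k w * \int[P]_w psi K (W n k w).
  apply: integral_independent => //.
  apply: (@independent_comp _ _ _ P id (psi K)) => //.
  apply: (levy_independent hL) => //; first exact: le_mesh.
  exact: Z_adapted.
have ip2 : P.-integrable setT (EFin \o (fun w => psi K (W n k w) ^+ 2)).
  apply: (@integrable_bounded _ _ _ P _ ((4 * 4 ^+ K) ^+ 2)).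
    apply: (measurableT_comp measurable_sqr).
    exact: (measurableT_comp (measurable_psi K)).
  move=> w; rewrite ger0_norm ?sqr_ge0// ler_sqr ?nnegrE ?psi_ge0//.
have -> : \int[P]_w (Z K n k.+1 w ^+ 2) = \int[P]_w (Z K n k w ^+ 2) +
    2 * (k%:R * meanpsi K (delta n) * meanpsi K (delta n)) +
    \int[P]_w (psi K (W n k w) ^+ 2).
  under eq_Rintegral => w _.
    rewrite (_ : Z K n k.+1 w ^+ 2 = Z K n k w ^+ 2 +
      2 * (Z K n k w * psi K (W n k w)) + psi K (W n k w) ^+ 2); last first.
      by rewrite /Z big_ord_recr/=; ring.
    over.
  have i1' := integrable_Rscale 2 measurableT i1.
  rewrite RintegralD//; last exact: (integrableD measurableT (iZ2 K n k) i1').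
  by rewrite RintegralD// RintegralZl// e1 EZ mean_psiW.
have h2 : \int[P]_w (psi K (W n k w) ^+ 2) <= 4 * 4 ^+ K * v.
  apply: (@le_trans _ _ (\int[P]_w (4 * 4 ^+ K * psi K (W n k w)))).
    apply: le_Rintegral => //; first exact: integrable_Rscale.
    by move=> w _; rewrite expr2 ler_wpM2r ?psi_ge0.
  by rewrite RintegralZl// mean_psiW ler_wpM2l// mulr_ge0// exprn_ge0.
have h1 : meanpsi K (delta n) * meanpsi K (delta n) <= v * v by exact: ler_pM.
have := ler_wpM2l (ler0n R k) h1.
rewrite -[k.+1%:R]natr1; move: IH h2.
have := sqr_ge0 v.
move: (\int[P]_w _) (\int[P]_w _) (4 * 4 ^+ K) (meanpsi _ _) (k%:R) => A B C m N.
rewrite !expr2; nra.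
Qed.

Let L_cadlag w : cadlag_on a (L w).
Proof.
case: hL => -[_ /(_ w)[cr cl]] _ _ _ _; split=> t ta.
  by apply: cr; exact: le_trans ra ta.
by apply: cl; exact: le_lt_trans ra ta.
Qed.

Let D K w : R := fine (\esum_(s in `]a, b]) (psi K (jump (L w) s))%:E).

Let D_fin_cvg K w :
  (\esum_(s in `]a, b]) (psi K (jump (L w) s))%:E = (D K w)%:E)%E /\
  Z K n n.+1 w @[n --> \oo] --> D K w.
Proof.
have e0 : 0 < (2 ^+ K)^-1 / K.+1%:R :> R by rewrite divr_gt0// invr_gt0 exprn_gt0.
have [l El cl] := cvg_mesh_jumps ab (L_cadlag w) (@continuous_psi R K) e0
  (@psi_near0 R K) (@psi_ge0 R K).
by rewrite /D El.
Qed.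

Let D_ge0 K w : 0 <= D K w.
Proof.
by rewrite -lee_fin -(D_fin_cvg K w).1; apply: esum_ge0 => s _; rewrite lee_fin psi_ge0.
Qed.

Let mD K : measurable_fun setT (D K).
Proof.
apply: (measurable_fun_cvg (fun n => @mZ K n n.+1)) => w _.
exact: (D_fin_cvg K w).2.
Qed.

Let cvg_D w : ((D K w)%:E @[K --> \oo] --> jump_sqsum (L w) a b)%E.
Proof.
under eq_fun => K do rewrite -(D_fin_cvg K w).1.
apply: (cvg_Esum_monotone (y := fun K s => psi K (jump (L w) s))
                          (f := fun s => jump (L w) s ^+ 2)).
- by move=> n s; exact: psi_ge0.
- by move=> s; exact: psi_homo.
- by move=> s _; exact: cvg_psi.
Qed.

Lemma measurable_jump_sqsum : measurable_fun setT (fun w => jump_sqsum (L w) a b).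
Proof.
apply: (emeasurable_fun_cvg (fun K w => (D K w)%:E)) => [K|w _]; last exact: cvg_D.
exact/measurable_EFinP.
Qed.

Let Y0 w : 0 <= Y w. Proof. by case/andP: (YM w). Qed.

Let mY' : measurable_fun setT Y.
Proof. exact: (measurable_wrt_measurable (filtration_measurable hF ra) mY). Qed.

Let iY : P.-integrable setT (EFin \o Y).
Proof.
apply: (@integrable_bounded _ _ _ P _ M) => // w.
by rewrite ger0_norm//; case/andP: (YM w).
Qed.

Let EY0 : 0 <= \int[P]_w Y w. Proof. exact: Rintegral_ge0. Qed.

Let EYZ K n k : \int[P]_w (Y w * Z K n k w) =
  \int[P]_w Y w * (k%:R * meanpsi K (delta n)).
Proof.
have Ypsi i : P.-integrable setT (EFin \o (fun w => Y w * psi K (W n i w))) /\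
    \int[P]_w (Y w * psi K (W n i w)) = \int[P]_w Y w * \int[P]_w psi K (W n i w).
  apply: integral_independent => //; last exact: integrable_psi_comp.
  apply: (@independent_comp _ _ _ P id (psi K)) => //.
  apply: (levy_independent hL) => //; first exact: le_mesh.
  by apply: (measurable_wrt_filtration hF ra _ mY); exact: mesh_ge.
have -> : \int[P]_w (Y w * Z K n k w) =
    \int[P]_w (\sum_(i <- enum 'I_k) Y w * psi K (W n i w)).
  by apply: eq_Rintegral => w _; rewrite /Z big_enum/= big_distrr.
rewrite Rintegral_sum//; last by move=> i; case: (Ypsi i).
under eq_bigr => i _ do rewrite (Ypsi i).2 mean_psiW.
by rewrite big_enum sumr_const card_ord -[LHS]mulr_natl mulrCA.
Qed.

(** The mean of [psi] has no closed form but lies between that of [rho] and the same minus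
    [var / K.+1]. Both bounds survive the passage to fine meshes. *)
Let YD K : P.-integrable setT (EFin \o (fun w => Y w * D K w)) /\
  \int[P]_w Y w * ((b - a) * lrho K - var (b - a) / K.+1%:R) <=
  \int[P]_w (Y w * D K w) <= \int[P]_w Y w * ((b - a) * lrho K).
Proof.
have ba0 : 0 <= b - a by rewrite subr_ge0 ltW.
have [|i c] := @cvg_integral_bounded_second_moment _ _ _ P (fun n => Z K n n.+1)
  (D K) Y M (var (b - a) ^+ 2 + 4 * 4 ^+ K * var (b - a)) mY' YM
  (fun n => @mZ K n n.+1) (fun n w => Z_ge0 K n n.+1 w) (fun w => (D_fin_cvg K w).2)
  (fun n => @iZ2 K n n.+1).
  move=> n; apply: (le_trans (Z_second_moment K n n.+1)).
  have nv : n.+1%:R * var (delta n) = var (b - a).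
    by rewrite (levy_var_div hF hL)// mulrCA divff ?mulr1 ?pnatr_eq0.
  by rewrite nv mulrCA nv.
split=> //; have cr := @cvg_meanrho K _ ba0.
rewrite -(cvg_lim (@Rhausdorff R) c); apply/andP; split.
  have c1 : \int[P]_w Y w * (n.+1%:R * meanrho K (delta n) - var (b - a) / K.+1%:R)
      @[n --> \oo] -->
      \int[P]_w Y w * ((b - a) * lrho K - var (b - a) / K.+1%:R).
    by apply: cvgM; [exact: cvg_cst|apply: cvgB => //; exact: cvg_cst].
  rewrite -(cvg_lim (@Rhausdorff R) c1); apply: ler_lim.
  - by apply/cvg_ex; eexists; exact: c1.
  - by apply/cvg_ex; eexists; exact: c.
  apply: nearW => n; rewrite EYZ ler_wpM2l//.
  have := ler_wpM2l (ler0n R n.+1) (meanpsi_ge K (delta0 n)).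
  rewrite mulrBr mulrA (levy_var_div hF hL)// [_ * (var _ / _)]mulrCA divff ?pnatr_eq0//.
  by rewrite mulr1.
have c1 : \int[P]_w Y w * (n.+1%:R * meanrho K (delta n))
    @[n --> \oo] --> \int[P]_w Y w * ((b - a) * lrho K).
  by apply: cvgM => //; exact: cvg_cst.
rewrite -(cvg_lim (@Rhausdorff R) c1); apply: ler_lim.
- by apply/cvg_ex; eexists; exact: c.
- by apply/cvg_ex; eexists; exact: c1.
apply: nearW => n; rewrite EYZ ler_wpM2l// ler_wpM2l//; exact: meanpsi_le.
Qed.

(** As [K] grows the sandwich closes on [kappa2], while [D K] increases to the sum of squared
    jumps. *)
Lemma integral_jump_sqsum :
  (\int[P]_w ((Y w)%:E * jump_sqsum (L w) a b) =
   (\int[P]_w Y w * ((b - a) * kappa2))%R%:E)%E.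
Proof.
have c1 : \int[P]_w (Y w * D K w) @[K --> \oo] -->
    \int[P]_w Y w * ((b - a) * kappa2).
  apply: (@squeeze_cvgr _ _ _ _
    (fun K => \int[P]_w Y w * ((b - a) * lrho K - var (b - a) / K.+1%:R))
    (fun K => \int[P]_w Y w * ((b - a) * lrho K))).
  - by apply: nearW => K; case: (YD K).
  - apply: cvgM; first exact: cvg_cst.
    rewrite -[X in _ --> X]subr0; apply: cvgB.
      by apply: cvgM; [exact: cvg_cst|exact: cvg_levy_rho].
    rewrite -(mulr0 (var (b - a))); apply: cvgM; first exact: cvg_cst.
    exact: cvg_harmonic.
  - apply: cvgM; first exact: cvg_cst.
    by apply: cvgM; [exact: cvg_cst|exact: cvg_levy_rho].
have c2 : ((\int[P]_w (Y w * D K w))%R%:E @[K --> \oo] -->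
    (\int[P]_w Y w * ((b - a) * kappa2))%R%:E)%E.
  by apply/fine_cvgP; split; [exact: nearW|exact: c1].
have c3 : (\int[P]_w (Y w * D K w)%:E @[K --> \oo] -->
    \int[P]_w ((Y w)%:E * jump_sqsum (L w) a b))%E.
  have lE w : (limn (fun K => (Y w * D K w)%:E) = (Y w)%:E * jump_sqsum (L w) a b)%E.
    apply/cvg_lim => //; under eq_fun do rewrite EFinM.
    by apply: cvgeZl => //; exact: cvg_D.
  under eq_integral => w _ do rewrite -lE.
  apply: cvg_monotone_convergence => //.
  - by move=> K; apply/measurable_EFinP/measurable_funM.
  - by move=> K w _; rewrite lee_fin mulr_ge0.
  - move=> w _ m n mn; rewrite lee_fin ler_wpM2l//.
    rewrite -lee_fin -(D_fin_cvg m w).1 -(D_fin_cvg n w).1.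
    by apply: le_esum => s _; rewrite lee_fin psi_homo.
apply: (cvg_unique _ c3) => //.
rewrite (_ : (fun K => _) = (fun K => (\int[P]_w (Y w * D K w))%R%:E))//.
by apply/funext => K; rewrite EFin_Rintegral//; case: (YD K).
Qed.

End interval.

End jump_compensator.

(** * Measurability from completeness *)

Section complete_measure.
Context {R : realType} {d : measure_display} {T : measurableType d}.
Context (P : probability T R).
Hypothesis cP : forall N A, measurable N -> P N = 0%E -> A `<=` N -> measurable A.

Lemma complete_ae_measurable d' (U : measurableType d') (f g : T -> U) :
  measurable_fun setT f -> {ae P, forall w, f w = g w} -> measurable_fun setT g.
Proof.
move=> mf [N [mN PN fgN]] _ B mB; rewrite setTI.
have fg w : ~ N w -> f w = g w by move=> nN; apply: contrapT => fgw; exact/nN/fgN.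
have -> : g @^-1` B = (f @^-1` B `&` ~` N) `|` (g @^-1` B `&` N).
  apply/seteqP; split=> [w gw|w [[fw /fg fgw]|[]//]].
    by have [Nw|Nw] := pselect (N w); [right|left; split=> //=; rewrite fg].
  by rewrite /= -fgw.
apply: measurableU.
  apply: measurableI; last exact: measurableC.
  by rewrite -[X in measurable X]setTI; exact: mf.
by apply: cP mN PN _ => w [].
Qed.

(** The upper limit is measurable everywhere and agrees with [f] off a null set. *)
Lemma complete_ae_measurable_cvg (f_ : nat -> T -> \bar R) (f : T -> \bar R) :
  (forall n, measurable_fun setT (f_ n)) ->
  {ae P, forall w, f_ ^~ w @ \oo --> f w} -> measurable_fun setT f.
Proof.
move=> mf ff; apply: (@complete_ae_measurable _ _ (fun w => limn_esup (f_ ^~ w))).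
  exact: measurable_fun_limn_esup.
by apply: filterS ff => w fw; rewrite (cvg_limn_einf_sup fw).2.
Qed.

Lemma ge0_integral_fin_ae (f : T -> \bar R) : measurable_fun setT f ->
  (forall w, 0 <= f w)%E -> (\int[P]_w f w < +oo)%E ->
  {ae P, forall w, (f w < +oo)%E}.
Proof.
move=> mf f0 foo; have fi : P.-integrable setT f.
  apply/integrableP; split=> //.
  by under eq_integral => w _ do rewrite gee0_abs//.
have := integrable_ae measurableT fi; apply: filterS => w /(_ Logic.I).
by rewrite ge0_fin_numE.
Qed.

End complete_measure.

Section cadlag_composition.
Context {R : realType}.
Implicit Types (a t : R) (x g : R -> R).

Lemma cadlag_comp a x g : continuous g -> cadlag_on a x -> cadlag_on a (g \o x).
Proof.
move=> gc [xr xl]; split=> t ta; first exact: (cvg_comp _ _ (xr t ta) (gc _)).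
by apply/cvg_ex; exists (g (left_lim x t)); exact: (cvg_comp _ _ (xl t ta) (gc _)).
Qed.

Lemma left_lim_comp a x g t : continuous g -> cadlag_on a x -> a < t ->
  left_lim (g \o x) t = g (left_lim x t).
Proof.
move=> gc xc ta; apply/cvg_lim => //.
exact: (cvg_comp _ _ (left_lim_cvg xc ta) (gc _)).
Qed.

Lemma cadlagS a b x : a <= b -> cadlag_on a x -> cadlag_on b x.
Proof.
move=> ab [xr xl]; split=> t bt; first by apply: xr; exact: le_trans bt.
by apply: xl; exact: le_lt_trans bt.
Qed.

Lemma cadlag_tag_continuous a b x : cadlag_on a x -> tag_continuous true x a b.
Proof. by move=> [xr _]; apply: tag_continuous_right => u /andP[/ltW/xr]. Qed.

Lemma left_lim_ge0 a x t : cadlag_on a x -> (forall s, 0 <= x s) -> a < t ->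
  0 <= left_lim x t.
Proof.
move=> xc x0 ta; apply: limr_ge; first by case: xc => _; exact.
exact: nearW.
Qed.

Lemma left_lim_le a x t (K : R) : cadlag_on a x -> (forall s, x s <= K) -> a < t ->
  left_lim x t <= K.
Proof.
move=> xc x0 ta; apply: limr_le; first by case: xc => _; exact.
exact: nearW.
Qed.

(** Left and right sums differ by a boundary term of the order of the step. Left tags, forced by
    adaptedness, can therefore be used for a function that is only right-continuous. *)
Lemma riemann_sum_left (y : R -> R) a b n :
  riemann_sum false y a b n =
  riemann_sum true y a b n + (y a - y b) * ((b - a) / n.+1%:R).
Proof.
rewrite /riemann_sum big_ord_recl [in RHS]big_ord_recr/= addn1 meshN addn0 mesh0.
rewrite (eq_bigr (fun i : 'I_n => y (mesh a b n (i + true)%N) * ((b - a) / n.+1%:R))).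
  by ring.
by move=> i _; rewrite addn0 addn1.
Qed.

End cadlag_composition.

Section mesh_esum.
Context {R : realType}.
Implicit Types (a b s K S : R) (x f : R -> R) (n : nat).
Local Notation Esum A f := (\esum_(i in A) (f i)%:E)%E.

(** On each cell the value is taken at the excluded left end, strictly before [s]; this keeps the
    weight independent of the jumps in the cell and leads to left limits. *)
Definition left_step x a b n s : R :=
  \sum_(i < n.+1) x (mesh a b n i) * (mesh a b n i < s <= mesh a b n i.+1)%R%:R.

Lemma left_stepE x a b n s i : a < b -> (i < n.+1)%N ->
  mesh a b n i < s <= mesh a b n i.+1 -> left_step x a b n s = x (mesh a b n i).
Proof.
move=> ab ni si; rewrite /left_step (bigD1 (Ordinal ni))//= si mulr1.
rewrite big1 ?addr0// => j ji.
case: (boolP (mesh a b n j < s <= mesh a b n j.+1)) => [sj|_]; last by rewrite mulr0.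
by move/eqP : ji; case; apply/val_inj => /=; exact: mesh_intervalP sj si.
Qed.

Lemma left_step_bounds x a b n s K : a < b -> (forall t, 0 <= x t <= K) ->
  0 <= left_step x a b n s <= K.
Proof.
move=> ab xK; have [/existsP[i si]|/existsPn nsi] := boolP
    [exists i : 'I_n.+1, mesh a b n i < s <= mesh a b n i.+1].
  by rewrite (left_stepE _ ab (ltn_ord i) si).
rewrite /left_step big1 ?lexx => [|i _]; last by rewrite (negbTE (nsi i)) mulr0.
by have /andP[h1 h2] := xK 0; exact: le_trans h2.
Qed.

Lemma left_step_cvg x a b s : a < b -> cadlag_on a x -> a < s <= b ->
  left_step x a b n s @[n --> \oo] --> left_lim x s.
Proof.
move=> ab xc sab; have /andP[as_ sb] := sab.
have /choice[k kP] n : exists i,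
    (i < n.+1)%N /\ mesh a b n i < s <= mesh a b n i.+1.
  by have [i] := mesh_indexl n ab sab; exists i.
have E n : left_step x a b n s = x (mesh a b n (k n)).
  by case: (kP n) => h1 h2; exact: left_stepE.
rewrite (funext E); have /cvg_at_leftP := left_lim_cvg xc as_; apply; split.
  by move=> n; case: (kP n) => _ /andP[].
apply/cvgrPdist_lt => /= e e0.
have /cvgrPdist_lt/(_ _ e0) := cvg_step a b; apply: filterS => n.
rewrite sub0r normrN gtr0_norm ?mesh_step_gt0// => dn.
case: (kP n) => _; rewrite meshS => /andP[].
have := mesh_step_gt0 n ab; set dd := _ / _ in dn *; set z := mesh _ _ _ _ => ? h1 h2.
by rewrite ltr_norml; apply/andP; split; lra.
Qed.

Lemma Esum_left_step x a b n f : a < b -> (forall t, 0 <= x t) ->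
  (forall t, 0 <= f t) -> (Esum `]a, b] f < +oo)%E ->
  (Esum `]a, b] (fun s => left_step x a b n s * f s)%R =
   \sum_(i < n.+1) (x (mesh a b n i))%:E *
     Esum `]mesh a b n i, mesh a b n i.+1] f)%E.
Proof.
move=> ab x0 f0 foo.
have st0 s : 0 <= left_step x a b n s * f s.
  by rewrite mulr_ge0//; apply: sumr_ge0 => i _; rewrite mulr_ge0.
suff h k : (k <= n.+1)%N ->
  (Esum `]a, mesh a b n k] (fun s => left_step x a b n s * f s)%R =
   \sum_(i < k) (x (mesh a b n i))%:E *
     Esum `]mesh a b n i, mesh a b n i.+1] f)%E.
  by rewrite -h// meshN.
elim: k => [_|k IH kn].
  by rewrite mesh0 set_itvoc0 esum_set0 big_ord0.
rewrite (Esum_itvU (mesh_ge n k ab) (le_mesh n ab (leqnSn k)) st0) (IH (ltnW kn)).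
rewrite big_ord_recr/=; congr (_ + _)%E.
rewrite -EsumZ//.
  apply: eq_esum => s /=; rewrite in_itv/= => sk.
  by rewrite (left_stepE _ ab kn sk).
apply: le_lt_trans foo; apply: Esum_subset => //.
by apply: subset_itv; rewrite bnd_simp ?mesh_ge ?mesh_le.
Qed.

End mesh_esum.

(** * Compensation of left-limit integrands, bounded and then dominated *)

Section compensation_formula.
Context {R : realType} {d : measure_display} {Omega : measurableType d}.
Context (P : probability Omega R) (r : R) (F : R -> set (set Omega)).
Context (L : Omega -> R -> R) (Pi : {measure set R -> \bar R}).
Hypotheses (hF : filtration r F) (hL : centered_sq_levy P r F L).
Hypotheses (hPi : levy_measure Pi) (hLK : levy_khintchine_no_brownian P r L Pi).
Hypothesis cP : forall N A, measurable N -> P N = 0%E -> A `<=` N -> measurable A.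
Implicit Types (a b s t : R) (n : nat) (V : Omega -> R -> R).
Local Notation kappa := (kappa2 Pi).

Definition weighted_jumps (x y : R -> R) a b : \bar R :=
  (\esum_(s in `]a, b]) (left_lim x s * jump y s ^+ 2)%:E)%E.

Let int_sqsum a b : -r <= a -> a < b ->
  (\int[P]_w jump_sqsum (L w) a b = ((b - a) * kappa)%:E)%E.
Proof.
move=> ra ab; have m1 : measurable_wrt (F a) (fun=> 1 : R).
  by apply/(measurable_wrtP (filtration_sigma hF ra)); exact: measurable_cst.
have b1 (w : Omega) : 0 <= (1 : R) <= 1 by rewrite ler01 lexx.
have := integral_jump_sqsum hF hL hPi hLK ra ab m1 b1.
rewrite Rintegral_prob_cst mul1r => <-.
by apply: eq_integral => w _; rewrite mul1e.
Qed.

Let msqsum a b : -r <= a -> a < b ->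
  measurable_fun setT (fun w => jump_sqsum (L w) a b).
Proof. by move=> ra ab; exact: (measurable_jump_sqsum hF hL ra ab). Qed.

Let sqsum_fin a b : -r <= a -> a < b ->
  {ae P, forall w, (jump_sqsum (L w) a b < +oo)%E}.
Proof.
move=> ra ab; apply: ge0_integral_fin_ae.
- exact: msqsum.
- by move=> w; exact: jump_sqsum_ge0.
- by rewrite int_sqsum// ltry.
Qed.

Section bounded_integrand.
Variables (V : Omega -> R -> R) (K a b : R).
Hypotheses (VK : forall w t, 0 <= V w t <= K).
Hypothesis Vad : forall t, -r <= t -> measurable_wrt (F t) (V^~ t).
Hypothesis Vc : forall w, cadlag_on (-r) (V w).
Hypotheses (ra : -r <= a) (ab : a < b).

Let e t := \int[P]_w V w t.
Let f_ n w := (\sum_(i < n.+1) (V w (mesh a b n i))%:E *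
  jump_sqsum (L w) (mesh a b n i) (mesh a b n i.+1))%E.

Let V0 w t : 0 <= V w t. Proof. by case/andP: (VK w t). Qed.
Let K0 : 0 <= K. Proof. by have /andP[h1 h2] := VK point 0; exact: le_trans h2. Qed.

Let rmesh n i : -r <= mesh a b n i.
Proof. by rewrite (le_trans ra)// mesh_ge. Qed.

Let mV t : -r <= t -> measurable_fun setT (V^~ t).
Proof. by move=> rt; exact: (measurable_wrt_measurable (filtration_measurable hF rt) (Vad rt)). Qed.

Let mterm n i : measurable_fun setT (fun w => (V w (mesh a b n i))%:E *
  jump_sqsum (L w) (mesh a b n i) (mesh a b n i.+1))%E.
Proof.
apply: emeasurable_funM.
  by apply/measurable_EFinP; exact: mV.
by apply: msqsum => //; rewrite lt_mesh.
Qed.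

(** Dominated convergence for unordered sums along one path, available on the event that its squared
    jumps have finite sum. *)
Let f_ae : {ae P, forall w, [/\ f_ ^~ w @ \oo --> weighted_jumps (V w) (L w) a b &
  forall n, (`|f_ n w| <= K%:E * jump_sqsum (L w) a b)%E]}.
Proof.
apply: filterS (sqsum_fin ra ab) => w Sfin.
have [S SE] : exists S, jump_sqsum (L w) a b = S%:E.
  exists (fine (jump_sqsum (L w) a b)); rewrite fineK// ge0_fin_numE//.
  exact: jump_sqsum_ge0.
have fE n : f_ n w = (\esum_(s in `]a, b])
    (left_step (V w) a b n s * jump (L w) s ^+ 2)%:E)%E.
  by rewrite (Esum_left_step n ab (V0 w) (fun t => sqr_ge0 (jump (L w) t)) Sfin).
have lb n s : 0 <= left_step (V w) a b n s <= K.
  by apply: left_step_bounds.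
have vac : cadlag_on a (V w) by exact: cadlagS ra (Vc w).
split.
  (* The bounds are demanded for every real [s], whereas left limits are controlled only to the
     right of [a]; elsewhere [lim] may return a default value. *)
  pose z s := if (a < s) then left_lim (V w) s else 0.
  have zK s : 0 <= z s <= K.
    rewrite /z; case: ifPn => [as_|_]; last by rewrite lexx.
    rewrite (left_lim_ge0 vac)//= (left_lim_le vac)// => t.
    by case/andP: (VK w t).
  have [|l El cl] := cvg_Esum_dominated lb zK (fun s => sqr_ge0 (jump (L w) s)) SE.
    move=> s /=; rewrite in_itv/= /z => /andP[as_ sb]; rewrite as_.
    by apply: left_step_cvg => //; rewrite as_.
  have -> : weighted_jumps (V w) (L w) a b = l%:E.
    rewrite -El; apply: eq_esum => s /=; rewrite in_itv/= /z => /andP[as_ _].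
    by rewrite as_.
  apply/fine_cvgP; split; last first.
    by apply: cvg_trans cl; apply: near_eq_cvg; apply: nearW => n /=; rewrite fE.
  apply: nearW => n; rewrite fE ge0_fin_numE; last first.
    apply: esum_ge0 => s _; rewrite lee_fin mulr_ge0 ?sqr_ge0//.
    by case/andP: (lb n s).
  apply: (@le_lt_trans _ _ (K%:E * S%:E)%E); last by rewrite -EFinM ltry.
  rewrite -SE /jump_sqsum -EsumZ//.
  - apply: le_esum => s _; rewrite lee_fin ler_wpM2r ?sqr_ge0//.
    by case/andP: (lb n s).
  - by move=> s; exact: sqr_ge0.
move=> n; rewrite gee0_abs; last first.
  rewrite fE; apply: esum_ge0 => s _; rewrite lee_fin mulr_ge0 ?sqr_ge0//.
  by case/andP: (lb n s).
rewrite fE /jump_sqsum -EsumZ//.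
- apply: le_esum => s _; rewrite lee_fin ler_wpM2r ?sqr_ge0//.
  by case/andP: (lb n s).
- by move=> s; exact: sqr_ge0.
Qed.

Let mf n : measurable_fun setT (f_ n).
Proof. by apply: emeasurable_sum => i; exact: mterm. Qed.

Lemma measurable_weighted_jumps_bounded :
  measurable_fun setT (fun w => weighted_jumps (V w) (L w) a b).
Proof.
by apply: (complete_ae_measurable_cvg cP mf); apply: filterS f_ae => w [].
Qed.

Let iV t : -r <= t -> P.-integrable setT (EFin \o V^~ t).
Proof.
move=> rt; apply: (@integrable_bounded _ _ _ P _ K); first exact: mV.
by move=> w; rewrite ger0_norm//; case/andP: (VK w t).
Qed.

Let int_f n : (\int[P]_w f_ n w = (kappa * riemann_sum false e a b n)%:E)%E.
Proof.
rewrite ge0_integral_sum//; last first.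
  by move=> i w _; rewrite mule_ge0 ?lee_fin//; exact: jump_sqsum_ge0.
rewrite /riemann_sum big_distrr/= -sumEFin; apply: eq_bigr => i _.
have := integral_jump_sqsum hF hL hPi hLK (rmesh n i) _ (Vad (rmesh n i))
  (fun w => VK w (mesh a b n i)) (b := mesh a b n i.+1).
rewrite lt_mesh// => /(_ (ltnSn _)) ->; rewrite addn0 -/(e _) meshS.
by rewrite addrAC subrr add0r; congr EFin; ring.
Qed.

Let e_bound t : `|e t| <= K \/ t < -r.
Proof.
have [rt|] := leP (-r) t; [left|by right].
rewrite ger0_norm; last by apply: Rintegral_ge0 => w _; exact: V0.
rewrite -(@Rintegral_prob_cst _ _ _ P K); apply: le_Rintegral => //.
- exact: iV.
- by apply: (@integrable_bounded _ _ _ P _ K) => // w; rewrite ger0_norm.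
- by move=> w _; case/andP: (VK w t).
Qed.

Lemma tag_continuous_mean : tag_continuous true e a b.
Proof.
apply: (@tag_continuous_integral _ _ _ P setT measurableT V a b (cst K)).
- by apply: (@integrable_bounded _ _ _ P _ K) => // w; rewrite ger0_norm.
- by move=> u /andP[au _]; apply: mV; exact: le_trans au.
- by apply: aeW => w _; exact: cadlag_tag_continuous (cadlagS ra (Vc w)).
- apply: aeW => w _ u _; rewrite ger0_norm//; by case/andP: (VK w u).
Qed.

(** For a step integrand each cell gives a product of means, and the sum is [kappa] times a left
    Riemann sum of the mean. The squared jumps times [K] dominate the passage to the limit. *)
Lemma integral_weighted_jumps_bounded :
  (\int[P]_w weighted_jumps (V w) (L w) a b = (kappa * Lint a b e)%:E)%E.
Proof.
have eK u : a <= u <= b -> `|e u| <= K.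
  move=> /andP[au _]; case: (e_bound u) => // ur.
  by move: (lt_le_trans ur (le_trans ra au)); rewrite ltxx.
have ig : P.-integrable setT (fun w => K%:E * jump_sqsum (L w) a b)%E.
  apply/integrableP; split.
    by apply: emeasurable_funM; [exact: measurable_cst|exact: msqsum].
  under eq_integral => w _.
    rewrite gee0_abs; last by rewrite mule_ge0 ?lee_fin//; exact: jump_sqsum_ge0.
    over.
  rewrite ge0_integralZl//.
  - by rewrite int_sqsum// -EFinM ltry.
  - exact: msqsum.
  - by move=> w _; exact: jump_sqsum_ge0.
have [] := @dominated_convergence _ _ _ P setT measurableT f_ _ _ mf
  measurable_weighted_jumps_bounded _ ig.
- by apply: filterS f_ae => w [].
- by apply: filterS f_ae => w [].
move=> _ _ c1.
have c2 : riemann_sum false e a b n @[n --> \oo] --> Lint a b e.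
  rewrite (funext (riemann_sum_left e a b)) -[X in _ --> X]addr0; apply: cvgD.
    exact: riemann_sum_cvg ab eK tag_continuous_mean.
  rewrite -(mulr0 (e a - e b)); apply: cvgM; first exact: cvg_cst.
  exact: cvg_step.
apply: (cvg_unique _ c1) => //; rewrite (funext int_f).
apply/fine_cvgP; split; first exact: nearW.
by apply: cvgM => //; exact: cvg_cst.
Qed.

End bounded_integrand.

Section dominated_integrand.
Variables (V : Omega -> R -> R) (D : Omega -> R) (a b : R).
Hypotheses (V0 : forall w t, 0 <= V w t)
  (Vad : forall t, -r <= t -> measurable_wrt (F t) (V^~ t))
  (Vc : forall w, cadlag_on (-r) (V w)) (ra : -r <= a) (ab : a < b)
  (iD : P.-integrable setT (EFin \o D))
  (VD : {ae P, forall w t, a <= t <= b -> V w t <= D w}).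

Let trunc (K : nat) w t := Num.min (V w t) K%:R.

Let truncK K w t : 0 <= trunc K w t <= K%:R.
Proof. by rewrite /trunc le_min V0 ler0n/= ge_min lexx orbT. Qed.

Let trunc_ad K t : -r <= t -> measurable_wrt (F t) (trunc K ^~ t).
Proof.
move=> rt; apply: (measurable_wrt_comp (filtration_sigma hF rt)
  (g := fun x => Num.min x K%:R)); last exact: Vad.
by apply: continuous_measurable_fun; exact: continuous_minr.
Qed.

Let trunc_cadlag K w : cadlag_on (-r) (trunc K w).
Proof. exact: (cadlag_comp (@continuous_minr R K%:R) (Vc w)). Qed.

Let J K w := weighted_jumps (trunc K w) (L w) a b.

Let mJ K : measurable_fun setT (J K).
Proof. exact: (measurable_weighted_jumps_bounded (truncK K) (trunc_ad K) (trunc_cadlag K) ra ab). Qed.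

Let left_lim_trunc K w s : a < s ->
  left_lim (trunc K w) s = Num.min (left_lim (V w) s) K%:R.
Proof.
move=> as_; apply: (left_lim_comp (@continuous_minr R K%:R) (Vc w)).
exact: le_lt_trans as_.
Qed.

Let left_lim_V0 w s : a < s -> 0 <= left_lim (V w) s.
Proof. by move=> as_; apply: (left_lim_ge0 (Vc w)) => //; exact: le_lt_trans as_. Qed.

Let z (K : nat) w s := if a < s then Num.min (left_lim (V w) s) K%:R else 0.

Let JE K w : J K w = (\esum_(s in `]a, b]) (z K w s * jump (L w) s ^+ 2)%:E)%E.
Proof.
apply: eq_esum => s /=; rewrite in_itv/= /z => /andP[as_ _].
by rewrite as_ left_lim_trunc.
Qed.

Let z0 K w s : 0 <= z K w s * jump (L w) s ^+ 2.
Proof.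
rewrite mulr_ge0 ?sqr_ge0// /z; case: ifPn => // as_.
by rewrite le_min ler0n left_lim_V0.
Qed.

Let z_homo w s : {homo (fun K => z K w s * jump (L w) s ^+ 2) : m n / (m <= n)%N >-> m <= n}.
Proof.
move=> m n mn; rewrite ler_wpM2r ?sqr_ge0// /z; case: ifPn => // _.
by rewrite le_min !ge_min lexx/= ler_nat mn orbT.
Qed.

Let cvg_J w : (J K w @[K --> \oo] --> weighted_jumps (V w) (L w) a b)%E.
Proof.
rewrite (funext (JE ^~ w)).
apply: (cvg_Esum_monotone (y := fun K s => z K w s * jump (L w) s ^+ 2)
                          (f := fun s => left_lim (V w) s * jump (L w) s ^+ 2)).
- by move=> K s; exact: z0.
- by move=> s; exact: z_homo.
- move=> s /=; rewrite in_itv/= => /andP[as_ _]; apply: cvgM; last exact: cvg_cst.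
  apply: cvg_near_cst; near=> K; rewrite /z as_; apply/min_idPl.
  by near: K; exact: nbhs_infty_ger.
Unshelve. all: by end_near. Qed.

Lemma measurable_weighted_jumps :
  measurable_fun setT (fun w => weighted_jumps (V w) (L w) a b).
Proof. by apply: (emeasurable_fun_cvg _ _ mJ) => w _; exact: cvg_J. Qed.

Let mV t : -r <= t -> measurable_fun setT (V^~ t).
Proof. by move=> rt; exact: (measurable_wrt_measurable (filtration_measurable hF rt) (Vad rt)). Qed.

Let rab t : a <= t <= b -> -r <= t.
Proof. by move=> /andP[+ _]; exact: le_trans. Qed.

Let e t := \int[P]_w V w t.
Let eK (K : nat) t := \int[P]_w trunc K w t.

Let trunc_le K w t : trunc K w t <= V w t.
Proof. by rewrite /trunc ge_min lexx. Qed.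

Let cvg_eK t : a <= t <= b -> eK K t @[K --> \oo] --> e t.
Proof.
move=> tab; have rt := rab tab.
have [] // := @Rdominated_convergence _ _ _ P setT (fun K => trunc K ^~ t) (V ^~ t) D.
- move=> K; apply: (measurable_wrt_measurable (filtration_measurable hF rt)).
  exact: trunc_ad.
- exact: mV.
- apply: aeW => w _; apply: cvg_near_cst; near=> K; apply/min_idPl.
  by near: K; exact: nbhs_infty_ger.
- apply: filterS VD => w VDw _ K; rewrite ger0_norm; last by case/andP: (truncK K w t).
  exact: le_trans (trunc_le _ _ _) (VDw _ tab).
Unshelve. all: by end_near. Qed.

Let iV t : a <= t <= b -> P.-integrable setT (EFin \o V ^~ t).
Proof.
move=> tab; have [] // := @Rdominated_convergence _ _ _ P setT (fun=> V ^~ t) (V ^~ t) D.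
- by move=> _; apply: mV; exact: rab.
- by apply: mV; exact: rab.
- by apply: aeW => w _; exact: cvg_cst.
- by apply: filterS VD => w VDw _ _; rewrite ger0_norm//; exact: VDw.
Qed.

(** Truncation at level [K]: the jump side converges monotonically, the time side by dominated
    convergence, once in chance with [D] and once in time with its mean. *)
Lemma integral_weighted_jumps :
  (\int[P]_w weighted_jumps (V w) (L w) a b = (kappa * Lint a b e)%:E)%E.
Proof.
have c1 : (\int[P]_w J K w @[K --> \oo] --> \int[P]_w weighted_jumps (V w) (L w) a b)%E.
  have lE w : limn (J ^~ w) = weighted_jumps (V w) (L w) a b.
    by apply/cvg_lim => //; exact: cvg_J.
  under [X in _ --> X]eq_integral => w _ do rewrite -lE.
  apply: cvg_monotone_convergence => //.
  - by move=> K w _; rewrite JE; apply: esum_ge0 => s _; rewrite lee_fin.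
  - move=> w _ m n mn; rewrite !JE; apply: le_esum => s _.
    by rewrite lee_fin; exact: z_homo.
have tc K : tag_continuous true (eK K) a b.
  exact: (tag_continuous_mean (truncK K) (trunc_ad K) (trunc_cadlag K) ra).
have iD' : P.-integrable setT (fun w => `|D w|%:E)%E := integrable_norm iD.
pose M := \int[P]_w `|D w|.
have eKM K t : a <= t <= b -> `|eK K t| <= M.
  move=> tab; rewrite ger0_norm; last first.
    by apply: Rintegral_ge0 => w _; case/andP: (truncK K w t).
  rewrite /eK /M /Rintegral fine_le//.
  - apply: integrable_fin_num => //.
    apply: (@integrable_bounded _ _ _ P _ K%:R).
      apply: (measurable_wrt_measurable (filtration_measurable hF (rab tab))).
      by apply: trunc_ad; exact: rab.
    by move=> w; rewrite ger0_norm; case/andP: (truncK K w t).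
  - exact: integrable_fin_num.
  apply: ae_ge0_le_integral => //.
  - by move=> w _; rewrite lee_fin; case/andP: (truncK K w t).
  - apply/measurable_EFinP.
    apply: (measurable_wrt_measurable (filtration_measurable hF (rab tab))).
    by apply: trunc_ad; exact: rab.
  - exact: measurable_int iD'.
  apply: filterS VD => w VDw _; rewrite lee_fin (le_trans (trunc_le _ _ _))//.
  by rewrite (le_trans (VDw _ tab))// ler_norm.
have c2 : kappa * Lint a b (eK K) @[K --> \oo] --> kappa * Lint a b e.
  apply: cvgM; first exact: cvg_cst.
  have [] // := @Rdominated_convergence _ _ R (@lebesgue_measure R) `[a, b] eK e (cst M).
  - by move=> K; exact: measurable_tag_continuous (tc K).
  - apply: (@measurable_fun_cvg _ _ _ _ eK) => [K|t /=].
      exact: measurable_tag_continuous (tc K).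
    by rewrite in_itv/=; exact: cvg_eK.
  - by apply: aeW => t /=; rewrite in_itv/=; exact: cvg_eK.
  - apply: measurable_bounded_integrable => //=.
      by rewrite lebesgue_measure_itv/=; case: ifP => // _; exact: ltry.
    by exists `|M|; split; [exact: num_real | move=> x Mx u _; exact: ltW].
  - by apply: aeW => t /=; rewrite in_itv/= => tab K; exact: eKM.
apply: (cvg_unique _ c1) => //.
have JintE K : (\int[P]_w J K w = (kappa * Lint a b (eK K))%:E)%E.
  exact: (integral_weighted_jumps_bounded (truncK K) (trunc_ad K) (trunc_cadlag K) ra ab).
rewrite (funext JintE); apply/fine_cvgP; split; first exact: nearW.
exact: c2.
Qed.

End dominated_integrand.
End compensation_formula.

(** * The delay equation *)

Section regular_functions.
Context {R : realType}.
Implicit Types (a b c u M : R) (y z f : R -> R).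
Local Notation leb := (@lebesgue_measure R).

(** The regularity that the mean of a dominated cadlag process has for certain. It ensures
    integrability and is stable under sums, products and shifts. *)
Definition regular y a b : Prop :=
  (exists M, forall u, a <= u <= b -> `|y u| <= M) /\ tag_continuous true y a b.

Lemma tag_right_limit y a b u : tag_continuous true y a b -> a < u < b ->
  y x @[x --> u^'+] --> y u.
Proof.
move=> yc /andP[au ub]; apply/cvg_at_rightP => s [us su].
(* Clipping keeps the sequence inside [[a, b]], as [tag_continuous] requires, and changes only
   finitely many terms. *)
pose s' n := Num.min (s n) ((u + b) / 2).
have mid : u < (u + b) / 2 /\ (u + b) / 2 < b by split; lra.
have c' : y (s' n) @[n --> \oo] --> y u.
  apply: yc; first by rewrite au.
  - move=> n; rewrite /s' le_min ge_min (ltW (lt_trans au (us n)))/=.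
    by rewrite (ltW (lt_trans au mid.1)) (ltW mid.2) orbT.
  - by move=> n; rewrite /s' lt_min us mid.1.
  - rewrite -[X in _ --> X](min_idPl (ltW mid.1)).
    exact: (cvg_comp _ _ su (@continuous_minr _ _ _)).
apply: cvg_trans c'; apply: near_eq_cvg.
have /cvgr_lt/(_ _ mid.1) := su; apply: filterS => n sn.
by rewrite /s' (min_idPl (ltW sn)).
Qed.

Lemma regular_integrable y a b : regular y a b -> leb.-integrable `[a, b] (EFin \o y).
Proof. by move=> [[M yM] yc]; exact: integrable_tag_continuous yM yc. Qed.

Lemma regularS y a b a' b' : a' <= a -> b <= b' -> regular y a' b' -> regular y a b.
Proof.
move=> aa bb [[M yM] yc]; split; last exact: tag_continuousS yc.
exists M => u /andP[au ub]; apply: yM.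
by rewrite (le_trans aa au) (le_trans ub bb).
Qed.

Lemma regular_continuous y a b : continuous y -> regular y a b.
Proof.
move=> yc; split; last exact: continuous_tag.
have [ab|ba] := leP a b; last first.
  by exists 0 => u /andP[au ub]; move: (le_trans au ub); rewrite leNgt ba.
have yn : {within `[a, b], continuous (fun u => `|y u|)}.
  apply: continuous_subspaceT => u.
  exact: (@continuous_comp _ _ _ y Num.norm u (yc u) (@norm_continuous _ _ _)).
by have [c _ cM] := EVT_max ab yn; exists `|y c| => u uab; exact: cM.
Qed.

Lemma regularM y z a b : regular y a b -> regular z a b ->
  regular (fun u => y u * z u) a b.
Proof.
move=> [[M yM] yc] [[N zN] zc]; split; last exact: tag_continuousM.
by exists (M * N) => u uab; rewrite normrM ler_pM ?yM ?zN.
Qed.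

Lemma regularD y z a b : regular y a b -> regular z a b ->
  regular (fun u => y u + z u) a b.
Proof.
move=> [[M yM] yc] [[N zN] zc]; split.
  by exists (M + N) => u uab; rewrite (le_trans (ler_normD _ _))// lerD ?yM ?zN.
by move=> u s ? ? ? ?; apply: cvgD; [exact: yc|exact: zc].
Qed.

Lemma regular_cst c a b : regular (fun=> c) a b.
Proof. by apply: regular_continuous => x; exact: cvg_cst. Qed.

Lemma regularZ c y a b : regular y a b -> regular (fun u => c * y u) a b.
Proof. by move=> yr; apply: regularM => //; exact: regular_cst. Qed.

Lemma regularB y z a b : regular y a b -> regular z a b ->
  regular (fun u => y u - z u) a b.
Proof.
move=> yr zr; have := regularD yr (regularZ (-1) zr).
by rewrite (_ : (fun u => y u + -1 * z u) = (fun u => y u - z u))//;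
  apply/funext => u; rewrite mulN1r.
Qed.

Lemma regular_shift c y a b : regular y (a + c) (b + c) ->
  regular (fun u => y (u + c)) a b.
Proof.
move=> [[M yM] yc]; split; first by exists M => u uab; rewrite yM// !lerD2r.
move=> u s uab sab us su; apply: (yc (u + c) (fun n => s n + c)).
- by rewrite !ltrD2r.
- by move=> n; rewrite !lerD2r.
- by move=> n; rewrite ltrD2r; exact: us.
- by apply: cvgD => //; exact: cvg_cst.
Qed.

Lemma LintD a b y z : regular y a b -> regular z a b ->
  Lint a b (fun u => y u + z u) = Lint a b y + Lint a b z.
Proof. by move=> yr zr; rewrite /Lint RintegralD//; exact: regular_integrable. Qed.

Lemma LintB a b y z : regular y a b -> regular z a b ->
  Lint a b (fun u => y u - z u) = Lint a b y - Lint a b z.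
Proof. by move=> yr zr; rewrite /Lint RintegralB//; exact: regular_integrable. Qed.

Lemma LintZ c a b y : regular y a b -> Lint a b (fun u => c * y u) = c * Lint a b y.
Proof. by move=> yr; rewrite /Lint RintegralZl//; exact: regular_integrable. Qed.

Lemma Lint_cst a b c : a <= b -> Lint a b (fun=> c) = c * (b - a).
Proof.
move=> ab; rewrite /Lint Rintegral_cst//= lebesgue_measure_itv/= lte_fin.
by move: ab; rewrite le_eqVlt => /predU1P[->|->//]; rewrite ltxx subrr.
Qed.

Lemma Lint_cat a c b y : a <= c -> c <= b -> regular y a b ->
  Lint a b y = Lint a c y + Lint c b y.
Proof.
move=> ac cb yr; have yi := regular_integrable yr.
have := @Rintegral_itvB _ y (BLeft a) (BRight b) c yi.
rewrite !bnd_simp => /(_ ac cb) h.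
rewrite [Lint c b y](_ : _ = \int[leb]_(x in `]c, b]) y x); last first.
  rewrite /Lint Rintegral_itv_obnd_cbnd//; apply: integrableS yi => //.
  by apply: subset_itvr; rewrite bnd_simp.
by rewrite -h /Lint addrC subrK.
Qed.

Lemma Lint_le a b y z : regular y a b -> regular z a b ->
  (forall u, a <= u <= b -> y u <= z u) -> Lint a b y <= Lint a b z.
Proof.
move=> yr zr yz; have yi := regular_integrable yr.
have zi := regular_integrable zr; apply: le_Rintegral => //.
Qed.

Lemma Lint_norm_le a b y M : a <= b -> regular y a b ->
  (forall u, a <= u <= b -> `|y u| <= M) -> `|Lint a b y| <= M * (b - a).
Proof.
move=> ab yr yM; rewrite ler_norml -mulNr -!Lint_cst//.
by apply/andP; split; apply: Lint_le => //; try exact: regular_cst;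
  move=> u /yM; rewrite ler_norml => /andP[].
Qed.

Lemma Lint_restrict a b c e y : (forall u, a <= u <= b -> ~~ (c <= u <= e) -> y u = 0) ->
  a <= c -> e <= b -> Lint a b y = Lint c e y.
Proof.
move=> y0 ac eb; rewrite /Lint Rintegral_mkcond [RHS]Rintegral_mkcond.
apply: eq_Rintegral => u _; rewrite /patch !mem_setE /=.
rewrite !in_itv/=; case: ifPn => [uab|uab].
  by case: ifPn => // uce; exact: y0.
case: ifPn => // /andP[cu ue]; case/negP: uab.
by rewrite (le_trans ac cu) (le_trans ue eb).
Qed.

(** Endpoints are ignored because [zeta] jumps at 0, so formulas for it hold only inside the
    interval. *)
Lemma Lint_eq_oo a b y z : measurable_fun `[a, b] y ->
  (forall u, a < u < b -> y u = z u) -> Lint a b z = Lint a b y.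
Proof.
move=> my yz; have {}my : measurable_fun `]a, b[ y.
  by apply: measurable_funS my => //; exact: subset_itv_oo_cc.
rewrite /Lint /Rintegral; congr fine; apply/esym; apply: eq_integral_itv_bounded => //.
apply: eq_measurable_fun my => u; rewrite inE/= in_itv/=; exact: yz.
Qed.

Lemma regular_measurable y a b : regular y a b -> measurable_fun `[a, b] y.
Proof. by move=> [_]; exact: measurable_tag_continuous. Qed.

Lemma tag_continuous_opp y a b : tag_continuous true y a b ->
  tag_continuous false (fun u => y (- u)) (- b) (- a).
Proof.
move=> yc u s /andP[bu ua] sab su us.
have uab : a < - u < b by rewrite ltrNr ua ltrNl.
have /cvg_right_seq := tag_right_limit yc uab; apply.
  by move=> n; rewrite lerN2.
exact: cvgN.
Qed.

Lemma Lint_opp_regular a b y : regular y a b ->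
  Lint a b y = Lint (- b) (- a) (fun x => y (- x)).
Proof. by move=> [[M yM] yc]; apply: (Lint_opp yM) => u; exact: tag_right_limit yc. Qed.

Lemma lipschitz_continuous (y : R -> R) M a b u : a < u < b ->
  (forall s t, a <= s -> s <= t -> t <= b -> `|y t - y s| <= M * (t - s)) ->
  {for u, continuous y}.
Proof.
move=> /andP[au ub] yl; have M0 : 0 <= M.
  have := yl a b (lexx _) (ltW (lt_trans au ub)) (lexx _).
  by move=> /(le_trans (normr_ge0 _)); rewrite pmulr_lge0// subr_gt0 (lt_trans au).
apply/cvgrPdist_lt => /= e e0; have M1 : 0 < M + 1 by rewrite ltr_wpDl.
have nb : \forall t \near u, `|u - t| < e / (M + 1).
  by apply/nbhs_ballP; exists (e / (M + 1)); rewrite /= ?divr_gt0.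
near=> t.
have tab : a < t < b.
  suff : t \in `]a, b[ by rewrite in_itv.
  by near: t; apply: near_in_itvoo; rewrite in_itv/= au.
have tu : `|u - t| < e / (M + 1).
  by near: t; exact: nb.
apply: (@le_lt_trans _ _ (M * `|u - t|)).
  have [ut|tu'] := leP u t.
    rewrite distrC (distrC u) [`|t - u|]ger0_norm ?subr_ge0//; apply: yl => //.
      exact: ltW.
    by case/andP: tab => _ /ltW.
  rewrite [`|u - t|]ger0_norm ?subr_ge0 ?(ltW tu')//; apply: yl; try exact: ltW.
  by case/andP: tab => /ltW.
move: tu; rewrite ltr_pdivlMr//; have := normr_ge0 (u - t).
move: `|u - t| => q q0; lra.
Unshelve. all: by end_near. Qed.

Lemma continuous_supported_bounded f a b : continuous f ->
  (forall u, ~ (a <= u <= b) -> f u = 0) -> exists M : R, forall u, `|f u| <= M.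
Proof.
move=> fc fs; have [[M fM] _] := regular_continuous a b fc.
exists (Num.max M 0) => u; have [u0|/negP u0] := boolP (a <= u <= b).
  by rewrite le_max fM.
by rewrite fs// normr0 le_max lexx orbT.
Qed.

End regular_functions.

Section delay_equation.
Context {R : realType}.
Implicit Types (a b c s t u v w T : R) (y : R -> R).
Local Notation leb := (@lebesgue_measure R).

Lemma Lint_shift_regular a b c y : regular y (a + c) (b + c) ->
  Lint (a + c) (b + c) y = Lint a b (fun x => y (x + c)).
Proof. by move=> [[M yM] yc]; exact: Lint_shift yM yc. Qed.

Lemma regular_Lipschitz y M a b : (forall s t, a <= s -> s <= t -> t <= b ->
  `|y t - y s| <= M * (t - s)) -> regular y a b.
Proof.
move=> yl; split.
  exists (`|M| * (b - a) + `|y a|) => u /andP[au ub].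
  rewrite -[y u](subrK (y a)) (le_trans (ler_normD _ _))// lerD2r.
  rewrite (le_trans (yl a u (lexx _) au ub))//.
  apply: (@le_trans _ _ (`|M| * (u - a))).
    by rewrite ler_wpM2r ?subr_ge0// ler_norm.
  by rewrite ler_wpM2l// lerD2r.
move=> u s uab sab us su.
have yu : {for u, continuous y} := lipschitz_continuous uab yl.
exact: (cvg_comp _ _ su yu).
Qed.

(** Moving the window changes its integral by two end pieces of equal length, hence the Lipschitz
    constant [N + N]. *)
Lemma regular_window (m : R -> R) r t : 0 <= t -> regular m (-r) t ->
  regular (fun u => Lint u (t + u) m) (-r) 0.
Proof.
move=> t0 mr; have [[N mN] _] := mr.
apply: (@regular_Lipschitz _ (N + N)) => u v ru uv v0.
have reg a b : -r <= a -> b <= t -> regular m a b.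
  by move=> ra bt; exact: regularS ra bt mr.
have e1 : Lint u (t + v) m = Lint u (t + u) m + Lint (t + u) (t + v) m.
  by apply: Lint_cat; [lra|lra|apply: reg; lra].
have e2 : Lint u (t + v) m = Lint u v m + Lint v (t + v) m.
  by apply: Lint_cat; [lra|lra|apply: reg; lra].
have b1 : `|Lint (t + u) (t + v) m| <= N * (t + v - (t + u)).
  apply: Lint_norm_le; [lra|apply: reg; lra|].
  by move=> x /andP[? ?]; apply: mN; apply/andP; split; lra.
have b2 : `|Lint u v m| <= N * (v - u).
  apply: Lint_norm_le; [lra|apply: reg; lra|].
  by move=> x /andP[? ?]; apply: mN; apply/andP; split; lra.
have -> : Lint v (t + v) m - Lint u (t + u) m = Lint (t + u) (t + v) m - Lint u v m by lra.
rewrite (le_trans (ler_normB _ _))//; lra.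
Qed.

Context (m f : R -> R) (r eta c0 : R).
Hypotheses (r0 : 0 < r) (fc : continuous f)
  (fs : forall u, ~ (-r <= u <= 0) -> f u = 0)
  (mr : forall T, regular m (-r) T).
Hypothesis eqm : forall t, 0 <= t -> m t = m 0 + eta * t - c0 * Lint 0 t m +
  Lint (-r) 0 (fun u => f u * Lint u (t + u) m).

(** Substituting [w = u + v] leads to [kT], where [v] sits only in the continuous factor [f]. Since
    [f] vanishes outside [[-r, 0]], the domain can be the fixed interval [[-r, T]], and continuity
    in [v] follows although [m] may jump on [[-r, 0]]. *)
Let k v := Lint (-r) 0 (fun u => f u * m (u + v)).
Let kT T v := Lint (-r) T (fun w => f (w - v) * m w).

Let shiftf_cont v : continuous (fun w => f (w - v)).
Proof.
move=> w; apply: (@continuous_comp _ _ _ (fun w => w - v) f); last exact: fc.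
by apply: cvgB; [exact: cvg_id|exact: cvg_cst].
Qed.

Let kT_regular T v b : regular (fun w => f (w - v) * m w) (-r) b.
Proof. by apply: regularM => //; apply: regular_continuous; exact: shiftf_cont. Qed.

Let f_bounded : exists M : R, forall u, `|f u| <= M.
Proof. exact: continuous_supported_bounded fs. Qed.

Let kE T v : 0 <= v <= T -> k v = kT T v.
Proof.
move=> /andP[v0 vT]; rewrite /kT.
rewrite (@Lint_restrict _ (-r) T (-r + v) (0 + v)); last 3 first.
- move=> u _ nu; rewrite fs ?mul0r// => /andP[h1 h2]; move/negP: nu; apply.
  by apply/andP; split; lra.
- by rewrite lerDl.
- by rewrite add0r.
rewrite Lint_shift_regular; last first.
  by apply: (regularS _ (lexx (0 + v))) (kT_regular T v _); rewrite lerDl.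
by apply: Lint_eq => u _; rewrite addrK.
Qed.

Let kT_cont T : continuous (kT T).
Proof.
move=> v; have [M fM] := f_bounded; have [[N mN] _] := mr T.
have vI : v \in (`]v - 1, v + 1[%classic : set R).
  by rewrite inE/= in_itv/= ltrBlDr ltrDl ltr01.
apply: (@continuity_under_integral R _ _ leb (fun l x => f (x - l) * m x)
  `[-r, T] _ (v - 1) (v + 1) _ _ (cst (M * N)) _ _ v vI) => //.
- by move=> l _; exact: regular_integrable (kT_regular T l T).
- apply: aeW => x _ l _; apply: cvgM; last exact: cvg_cst.
  apply: (@continuous_comp _ _ _ (fun l => x - l) f); last exact: fc.
  by apply: cvgB; [exact: cvg_cst|exact: cvg_id].
- by apply: regular_integrable; exact: regular_cst.
- move=> l _; apply: aeW => x /=; rewrite in_itv/= => xT.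
  by rewrite normrM ler_pM// mN.
Qed.

(** For fixed [u] the window integral of [m] is the integral of [m (u + v)] over [v] in [[0, t]];
    then the two integrals are exchanged. *)
Let Lint_k t : 0 <= t ->
  Lint (-r) 0 (fun u => f u * Lint u (t + u) m) = Lint 0 t k.
Proof.
rewrite le_eqVlt => /predU1P[<-|t0].
  rewrite Lint_xx (@Lint_eq _ _ _ _ (fun=> 0)) => [|u _].
    by rewrite Lint_cst ?mul0r// oppr_le0 ltW.
  by rewrite add0r Lint_xx mulr0.
have [M fM] := f_bounded; have [[N mN] mtag] := mr t.
have shift_reg u : -r <= u <= 0 -> regular (fun v => m (v + u)) 0 t.
  move=> /andP[ru u0]; apply: regular_shift; rewrite add0r.
  by apply: regularS ru _ (mr t); lra.
have YE u : -r <= u <= 0 -> Lint 0 t (fun v => f u * m (u + v)) = f u * Lint u (t + u) m.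
  move=> ur; rewrite LintZ.
    congr (_ * _); rewrite -[X in Lint X _ m]add0r Lint_shift_regular.
      by apply: Lint_eq => v _; rewrite addrC.
    by rewrite add0r; case/andP: ur => ru u0; apply: regularS ru _ (mr t); lra.
  by have := shift_reg u ur; congr (regular _ _ _); apply/funext => v; rewrite addrC.
have mYE : regular (fun u => f u * Lint u (t + u) m) (-r) 0.
  apply: regularM; first exact: regular_continuous.
  exact: regular_window (ltW t0) (mr t).
have [] := @Rintegral_Lint _ _ R leb `[-r, 0] _
  (fun u v => f u * m (u + v)) 0 t (cst (M * N)) _ _ _ _ t0 _ => //.
- by apply: regular_integrable; exact: regular_cst.
- move=> v /andP[v0 vt]; apply: (@measurable_tag_continuous _ true).
  apply: tag_continuousM; first exact: continuous_tag.
  apply: (regular_shift _).2; apply: (regularS _ _ (mr t)); lra.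
- apply: aeW => u; rewrite /= in_itv/= => ur.
  apply: tag_continuousM; first by apply: continuous_tag => z; exact: cvg_cst.
  have [_] := shift_reg u ur; congr (tag_continuous _ _ _ _).
  by apply/funext => v; rewrite addrC.
- apply: aeW => u; rewrite /= in_itv/= => /andP[ru u0] v /andP[v0 vt].
  by rewrite normrM ler_pM// mN//; apply/andP; split; lra.
- apply: (@eq_measurable_fun _ _ _ _ _ (fun u => f u * Lint u (t + u) m)).
    by move=> u; rewrite inE/= in_itv/= => ur; rewrite YE.
  by case: mYE => _; exact: measurable_tag_continuous.
move=> _ h; transitivity (\int[leb]_(x in `[-r, 0]) Lint 0 t (fun v => f x * m (x + v))).
  by apply: Lint_eq => u /YE.
by rewrite h.
Qed.

Lemma delay_swap t : 0 <= t ->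
  Lint (-r) 0 (fun u => f u * Lint u (t + u) m) =
  Lint 0 t (fun v => Lint (-r) t (fun w => f (w - v) * m w)).
Proof. by move=> t0; rewrite Lint_k//; apply: Lint_eq => v; exact: kE. Qed.

Let g T v := eta - c0 * m v + kT T v.

Let g_regular T a b : -r <= a -> regular (g T) a b.
Proof.
move=> ra; apply: regularD; last exact/regular_continuous/kT_cont.
apply: regularB; first exact: regular_cst.
by apply: regularZ; exact: regularS ra (lexx _) (mr b).
Qed.

Let mg t T : 0 <= t <= T -> m t = m 0 + Lint 0 t (g T).
Proof.
move=> /andP[t0 tT]; have m0t : regular m 0 t.
  by apply: regularS (lexx t) (mr t); rewrite oppr_le0 ltW.
have ktreg : regular (kT T) 0 t by exact/regular_continuous/kT_cont.
rewrite eqm// Lint_k// /g LintD//; last first.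
  by apply: regularB; [exact: regular_cst|exact: regularZ].
rewrite LintB//; [|exact: regular_cst|exact: regularZ].
rewrite Lint_cst// LintZ// subr0 (@Lint_eq _ _ _ k (kT T)).
  by rewrite !addrA.
by move=> u /andP[u0 ut]; apply: kE; rewrite u0 (le_trans ut).
Qed.

(** A bootstrap: [m] is an integral of the bounded [g], hence Lipschitz on [[0, T]]; this makes [g]
    continuous, so that the fundamental theorem of calculus applies. The horizon [t + 1] keeps [t]
    interior. *)
Let m_cont t : 0 < t -> {for t, continuous m}.
Proof.
move=> t0; pose T := t + 1; have r0' : -r <= 0 by rewrite oppr_le0 ltW.
have [[M gM] _] := g_regular T T r0'.
have tT : 0 < t < T by rewrite t0/= ltrDl.
apply: (@lipschitz_continuous _ _ M 0 T) tT _ => u v u0 uv vT.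
have uT := le_trans uv vT; have v0 := le_trans u0 uv.
rewrite (@mg v T) ?v0// (@mg u T) ?u0// (@Lint_cat _ 0 u v)//; last exact: g_regular.
rewrite opprD addrACA subrr add0r addrAC subrr add0r.
apply: Lint_norm_le => //; first by apply: g_regular; exact: le_trans u0.
move=> x /andP[ux xv]; apply: gM.
by rewrite (le_trans u0)// (le_trans xv).
Qed.

Let g_cont T t : 0 < t -> {for t, continuous (g T)}.
Proof.
move=> t0; apply: cvgD; last exact: kT_cont.
apply: cvgB; first exact: cvg_cst.
by apply: cvgM; [exact: cvg_cst|exact: m_cont].
Qed.

Let m_derive T t : 0 < t < T -> derivable m t 1 /\ derive1 m t = g T t.
Proof.
move=> /andP[t0 tT]; have r0' : -r <= 0 by rewrite oppr_le0 ltW.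
have [d1 d2] := @continuous_FTC1_closed _ (g T) 0 t T tT
  (regular_integrable (g_regular T T r0')) t0 (g_cont t0).
have nE : \forall x \near t, m 0 + Lint 0 x (g T) = m x.
  near=> x; rewrite -mg//.
  have : x \in `]0, T[ by near: x; apply: near_in_itvoo; rewrite in_itv/= t0.
  by rewrite in_itv/= => /andP[/ltW-> /ltW->].
have dm : is_derive t 1 m (g T t).
  apply: (near_eq_is_derive nE); rewrite -[g T t]add0r -d2 derive1E.
  by apply: is_deriveD; exact: derivableP.
by split; [exact: ex_derive|rewrite derive1E; exact: derive_val].
Unshelve. all: by end_near. Qed.

Lemma delay_derivable t : 0 < t -> derivable m t 1.
Proof. by move=> t0; have [] := @m_derive (t + 1) t; rewrite ?t0/= ?ltrDl. Qed.

Lemma delay_derive1E t : 0 < t ->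
  derive1 m t = eta - c0 * m t + Lint (-r) 0 (fun u => m (t + u) * f u).
Proof.
move=> t0; have tt : 0 < t < t + 1 by rewrite t0/= ltrDl.
rewrite (m_derive tt).2 /g -kE; last by rewrite !ltW//; case/andP: tt.
by congr (_ + _); apply: Lint_eq => u _; rewrite mulrC addrC.
Qed.

Lemma delay_derive1_continuous t : 0 < t -> derive1 m x @[x --> t] --> derive1 m t.
Proof.
move=> t0; have tt : 0 < t < t + 1 by rewrite t0/= ltrDl.
rewrite (m_derive tt).2; apply: cvg_trans (g_cont (T := t + 1) t0).
apply: near_eq_cvg; near=> x.
have : x \in `]0, t + 1[ by near: x; apply: near_in_itvoo; rewrite in_itv/= tt.
by rewrite in_itv/= => /m_derive[].
Unshelve. all: by end_near. Qed.

End delay_equation.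

(** * The renewal equation *)

Section renewal_equation.
Context {R : realType}.
Implicit Types (a b c s t u v w x T : R) (y : R -> R).
Local Notation leb := (@lebesgue_measure R).
Context (m f : R -> R) (r : R).
Hypotheses (r0 : 0 < r) (fc : continuous f)
  (fs : forall u, ~ (-r <= u <= 0) -> f u = 0)
  (mr : forall T, regular m (-r) T).

Let phi x := f (- x).
Let G (x : R) : R := Lint 0 (Num.min x r) phi.

Let phi_cont : continuous phi.
Proof. by move=> x; apply: (@continuous_comp _ _ _ -%R f); [exact: opp_continuous|exact: fc]. Qed.

(** [phi] vanishes outside [[0, r]], so the cap at [r] and the lower bound 0 may be dropped.
    Differences of [G] become plain integrals of [phi], for arguments of either sign. *)
Let GE (B x : R) : 0 <= B -> G x = Lint (- B) x phi.
Proof.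
move=> B0; apply/esym/Lint_restrict; last by rewrite ge_min lexx.
  move=> u /andP[Bu ux] nu; apply: fs => /andP[h1 h2]; move/negP: nu; apply.
  by rewrite -oppr_le0 h2 le_min ux -lerN2 h1.
by rewrite oppr_le0.
Qed.

Let G_diff (x y : R) : x <= y -> G y - G x = Lint x y phi.
Proof.
move=> xy; have xB : - `|x| <= x by rewrite lerNl ler_normr lexx orbT.
rewrite (GE _ (normr_ge0 x)) (GE x (normr_ge0 x)).
have -> : Lint (- `|x|) y phi = Lint (- `|x|) x phi + Lint x y phi.
  by apply: Lint_cat => //; exact: regular_continuous.
by rewrite [_ + Lint x y _]addrC addrK.
Qed.

Let G_neg x : x <= 0 -> G x = 0.
Proof.
move=> x0; rewrite /G (min_idPl (le_trans x0 (ltW r0))).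
move: x0; rewrite le_eqVlt => /predU1P[->|x0]; first exact: Lint_xx.
by rewrite /Lint set_itv_ge ?Rintegral_set0// bnd_simp -ltNge.
Qed.

Let G_large x : r <= x -> G x = G r.
Proof. by move=> rx; rewrite /G minxx (min_idPr rx). Qed.

Let G_cont : continuous G.
Proof.
move=> x; have [[M pM] _] := regular_continuous (x - 1) (x + 1) phi_cont.
apply: (@lipschitz_continuous _ _ M (x - 1) (x + 1)).
  by rewrite ltrBlDr ltrDl ltr01.
move=> u v xu uv vx; rewrite G_diff//; apply: Lint_norm_le => //.
  exact: regular_continuous.
by move=> z /andP[uz zv]; rewrite pM// (le_trans xu)// (le_trans zv).
Qed.

Let G_reflect t : continuous (fun w => G (t - w)).
Proof.
move=> w; apply: (@continuous_comp _ _ _ (fun w => t - w) G); last exact: G_cont.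
by apply: cvgB; [exact: cvg_cst|exact: cvg_id].
Qed.

(** The integral of [f (w - v)] over [v] in [[0, t]], that is, the total weight that [m w] receives
    in the double integral. *)
Let dG (t w : R) : R := G (t - w) - G (- w).

Let dG_cont t : continuous (dG t).
Proof.
move=> w; apply: cvgB; first exact: G_reflect.
by apply: (@continuous_comp _ _ _ -%R G); [exact: opp_continuous|exact: G_cont].
Qed.

Let window_swap t : 0 < t ->
  Lint 0 t (fun v => Lint (-r) t (fun w => f (w - v) * m w)) =
  Lint (-r) t (fun w => dG t w * m w).
Proof.
move=> t0; have freg w : regular (fun v => f (w - v)) 0 t.
  apply: regular_continuous => v.
  apply: (@continuous_comp _ _ _ (fun v => w - v) f); last exact: fc.
  by apply: cvgB; [exact: cvg_cst|exact: cvg_id].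
have innerE w : Lint 0 t (fun v => f (w - v) * m w) = dG t w * m w.
  rewrite (@Lint_eq _ _ _ _ (fun v => m w * f (w - v))) => [|v _]; last exact: mulrC.
  rewrite LintZ// mulrC; congr (_ * _).
  rewrite /dG G_diff; last by rewrite lerDr ltW.
  rewrite -[X in Lint X _ phi]add0r Lint_shift_regular.
    by apply: Lint_eq => v _; rewrite /phi opprB.
  exact: regular_continuous.
have [M fM] := continuous_supported_bounded fc fs; have [[N mN] _] := mr t.
have dGm : regular (fun w => dG t w * m w) (-r) t.
  by apply: regularM => //; exact: regular_continuous.
have ig : leb.-integrable `[-r, t] (EFin \o cst (M * N)).
  by apply: regular_integrable; exact: regular_cst.
have mY v : 0 <= v <= t -> measurable_fun `[-r, t] (fun w => f (w - v) * m w).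
  move=> _; apply: regular_measurable; apply: regularM => //.
  apply: regular_continuous => w.
  apply: (@continuous_comp _ _ _ (fun w => w - v) f); last exact: fc.
  by apply: cvgB; [exact: cvg_id|exact: cvg_cst].
have Yc : {ae leb, forall w, `[-r, t]%classic w ->
    tag_continuous true (fun v => f (w - v) * m w) 0 t}.
  apply: aeW => w _; apply: tag_continuousM; first exact: (freg w).2.
  by apply: continuous_tag => z; exact: cvg_cst.
have Yg : {ae leb, forall w, `[-r, t]%classic w ->
    forall v, 0 <= v <= t -> `|f (w - v) * m w| <= cst (M * N) w}.
  apply: aeW => w; rewrite /= in_itv/= => wt v _.
  by rewrite normrM ler_pM// mN.
have mLt : measurable_fun `[-r, t] (fun w => Lint 0 t (fun v => f (w - v) * m w)).
  by rewrite (funext innerE); exact: regular_measurable.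
have mD : measurable (`[-r, t] : set R) by exact: measurable_itv.
have [_ h] := @Rintegral_Lint _ _ R leb _ mD (fun w v => f (w - v) * m w)
  0 t _ ig mY Yc Yg t0 mLt.
by rewrite -[LHS]h; apply: eq_Rintegral => w _; exact: innerE.
Qed.

Context (eta c0 : R).
Hypothesis eqm : forall t, 0 <= t -> m t = m 0 + eta * t - c0 * Lint 0 t m +
  Lint (-r) 0 (fun u => f u * Lint u (t + u) m).

Let zeta (t : R) : R := - c0 * (if 0 < t then 1 else 0) + G t.

Let zeta_pos t : 0 < t -> zeta t = - c0 + G t.
Proof. by move=> t0; rewrite /zeta t0 mulr1. Qed.

Let Lint_zeta t : 0 < t -> Lint 0 t zeta = - c0 * t + Lint 0 t G.
Proof.
move=> t0; have Gr : regular G 0 t by exact: regular_continuous.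
rewrite (@Lint_eq_oo _ _ _ (fun u => - c0 + G u)).
- by rewrite LintD ?Lint_cst ?subr0 ?ltW//; exact: regular_cst.
- by apply: regular_measurable; apply: regularD => //; exact: regular_cst.
- by move=> u /andP[u0 _]; rewrite zeta_pos.
Qed.

Let Lint_zeta_conv t : 0 < t -> Lint 0 t (fun u => zeta (t - u) * m u) =
  - c0 * Lint 0 t m + Lint 0 t (fun u => G (t - u) * m u).
Proof.
move=> t0; have mrt : regular m 0 t.
  by apply: regularS (lexx t) (mr t); rewrite oppr_le0 ltW.
have Gm : regular (fun u => G (t - u) * m u) 0 t.
  by apply: regularM => //; exact: regular_continuous.
rewrite (@Lint_eq_oo _ _ _ (fun u => - c0 * m u + G (t - u) * m u)).
- by rewrite LintD ?LintZ//; exact: regularZ.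
- by apply: regular_measurable; apply: regularD => //; exact: regularZ.
- by move=> u /andP[_ ut]; rewrite zeta_pos ?subr_gt0// mulrDl.
Qed.

(** After reflection the integrals telescope to that of [G] over [[r, r + t]], where [G] is
    constant. *)
Let Lint_dG t : 0 < t -> Lint (-r) 0 (dG t) + Lint 0 t G = t * G r.
Proof.
move=> t0; have r0' := ltW r0; have t0' := ltW t0.
have Gr a b : regular G a b by exact: regular_continuous.
rewrite Lint_opp_regular; last exact: regular_continuous.
rewrite oppr0 opprK (@Lint_eq _ _ _ _ (fun u => G (u + t) - G u)); last first.
  by move=> u _; rewrite /dG !opprK (addrC u).
have Grt : regular (fun u => G (u + t)) 0 r by apply: regular_shift.
rewrite LintB// -(Lint_shift_regular (c := t))// add0r.
have e1 : Lint 0 (r + t) G = Lint 0 t G + Lint t (r + t) G.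
  by apply: Lint_cat => //; rewrite lerDr.
have e2 : Lint 0 (r + t) G = Lint 0 r G + Lint r (r + t) G.
  by apply: Lint_cat => //; rewrite lerDl.
have e3 : Lint r (r + t) G = t * G r.
  rewrite (@Lint_eq _ _ _ _ (fun=> G r)) => [|u /andP[ru _]]; last exact: G_large.
  by rewrite Lint_cst ?lerDl// addrAC subrr add0r mulrC.
by rewrite -e3; move: e1 e2; lra.
Qed.

(** For [u > 0] the constant [- c0] cancels in [zeta (t + u) - zeta u], leaving [dG t (- u)]; the
    formula is then a reflection. *)
Let Lint_history t (e : R) : 0 < t ->
  Lint 0 r (fun u => (zeta (t + u) - zeta u) * (m (- u) + e)) =
  Lint (-r) 0 (fun w => dG t w * m w) + e * Lint (-r) 0 (dG t).
Proof.
move=> t0; have dGr : regular (dG t) (-r) 0 by exact: regular_continuous.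
have dGm : regular (fun w => dG t w * m w) (-r) 0 by apply: regularM.
have edG : regular (fun w => e * dG t w) (-r) 0 by exact: regularZ.
have Qr : regular (fun w => dG t w * m w + e * dG t w) (-r) 0 by exact: regularD.
rewrite -[e * _]LintZ// -LintD// (Lint_opp_regular Qr) oppr0 opprK.
apply: Lint_eq_oo.
  apply: (@measurable_tag_continuous _ false).
  by have := tag_continuous_opp Qr.2; rewrite oppr0 opprK.
move=> u /andP[u0 _]; rewrite !zeta_pos ?addr_gt0// /dG !opprK; ring.
Qed.

Lemma delay_renewal t : 0 < t -> zeta r != 0 ->
  m t = Lint 0 t (fun u => zeta (t - u) * m u) +
    (m 0 + eta / zeta r * Lint 0 t zeta +
     Lint 0 r (fun u => (zeta (t + u) - zeta u) * (m (- u) + eta / zeta r))).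
Proof.
move=> t0 zr; have t0' := ltW t0; have r0' := ltW r0.
rewrite Lint_history// Lint_zeta// Lint_zeta_conv//.
have dGm : regular (fun w => dG t w * m w) (-r) t.
  by apply: regularM => //; exact: regular_continuous.
have e1 : Lint (-r) t (fun w => dG t w * m w) =
    Lint (-r) 0 (fun w => dG t w * m w) + Lint 0 t (fun u => G (t - u) * m u).
  rewrite (@Lint_cat _ _ 0)// ?oppr_le0//; congr (_ + _).
  by apply: Lint_eq => u /andP[u0 _]; rewrite /dG (@G_neg (- u)) ?subr0// oppr_le0.
have e2 := Lint_dG t0.
(* By the identity for [dG], [t * zeta r] is the integral of [zeta] over [[0, t]] plus that of
   [dG t] over [[-r, 0]]. The linear drift thus splits into the two [eta / zeta r] terms of the
   forcing function. *)
have e3 : eta * t = eta / zeta r * (t * zeta r) by field.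
rewrite eqm// (delay_swap r0 fc fs mr t0') window_swap// e1 e3.
have -> : t * zeta r = - c0 * t + Lint 0 t G + Lint (-r) 0 (dG t).
  by rewrite zeta_pos// -addrA (addrC (Lint 0 t G)) e2; ring.
ring.
Qed.

End renewal_equation.

(** * Expectation of the variance equation *)

Lemma integrable_fine {d} {T : measurableType d} {R : realType}
    (mu : {measure set T -> \bar R}) (g : T -> \bar R) :
  mu.-integrable setT g -> mu.-integrable setT (EFin \o (fine \o g)).
Proof.
move=> gi; have mg := measurable_int _ gi; apply: le_integrable gi => //.
  apply/measurable_EFinP; apply: measurableT_comp; first exact: fine_measurable.
  exact: mg.
by move=> x _ /=; case: (g x) => [s| |] /=; rewrite ?lexx ?leey.
Qed.

(** * Domination of a path by its supremum *)

Section path_supremum.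
Context {R : realType} {d : measure_display} {Omega : measurableType d}.
Context (P : probability Omega R).
Context (Y : Omega -> R -> R) (a b : R).
Hypotheses (ab : a < b) (Yc : forall w, cadlag_on a (Y w))
  (mY : forall t, a <= t -> measurable_fun setT (Y ^~ t)).

(** Capping the index makes each mesh an infinite sequence inside [[a, b]], so that the supremum
    over all meshes is a countable one. *)
Let q n i w : \bar R := (Y w (mesh a b n (minn i n.+1)) ^+ 2)%:E.

(** Any value before [b] is approached by right-continuity along mesh points from the right. *)
Let sup_sqE w : sup_sq (Y w) a b = esups (fun n => esups (fun i => q n i w) 0%N) 0%N.
Proof.
have mab n i : a <= mesh a b n (minn i n.+1) <= b.
  by rewrite mesh_ge//= mesh_le// geq_minr.
have qle n i : (q n i w <= esups (fun n => esups (fun i => q n i w) 0%N) 0%N)%E.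
  apply: (@le_trans _ _ (esups (fun i => q n i w) 0%N)).
    by apply: ereal_sup_ubound; exists i.
  by apply: ereal_sup_ubound; exists n.
apply/eqP; rewrite eq_le; apply/andP; split; apply: ub_ereal_sup.
  move=> _ [s + <-]; rewrite /= in_itv/= => sab.
  have [sb|sb] := ltP s b; last first.
    (* The endpoint [b] has no right neighbours in the interval, but it is itself a mesh point. *)
    have -> : s = mesh a b 0 (minn 1 1).
      by rewrite minnn meshN; apply/eqP; rewrite eq_le sb; case/andP: sab => _ ->.
    exact: (qle 0%N 1%N).
  have asb : a <= s < b by case/andP: sab => ->.
  have /choice[k kP] n : exists i, (i < n.+1)%N /\ mesh a b n i <= s < mesh a b n i.+1.
    by have [i] := mesh_indexr n ab asb; exists i.
  have c1 : mesh a b n (k n).+1 @[n --> \oo] --> s.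
    apply/cvgrPdist_lt => /= e e0.
    have /cvgrPdist_lt/(_ _ e0) := cvg_step a b; apply: filterS => n.
    rewrite sub0r normrN gtr0_norm ?mesh_step_gt0// => dn.
    case: (kP n) => _; rewrite meshS => /andP[].
    move: dn; set dd := _ / _; set z := mesh _ _ _ _ => ? ? ?.
    by rewrite ltr_norml; apply/andP; split; lra.
  have c2 : Y w (mesh a b n (k n).+1) @[n --> \oo] --> Y w s.
    have [+ _] := Yc w => /(_ s) h.
    have /cvg_at_rightP : Y w x @[x --> s^'+] --> Y w s by apply: h; case/andP: sab.
    by apply; split=> // n; case: (kP n) => _ /andP[].
  have c3 : ((Y w (mesh a b n (k n).+1) ^+ 2)%:E @[n --> \oo] --> (Y w s ^+ 2)%:E)%E.
    apply/fine_cvgP; split; first exact: nearW.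
    by rewrite /comp/=; rewrite expr2; under eq_fun do rewrite expr2; exact: cvgM.
  rewrite -(cvg_lim (@ereal_hausdorff R) c3).
  apply: lime_le; first by apply/cvg_ex; eexists; exact: c3.
  apply: nearW => n; have := qle n (k n).+1; rewrite /q (minn_idPl _)//.
  by case: (kP n).
move=> _ [n _ <-]; apply: ub_ereal_sup => _ [i _ <-].
apply: ereal_sup_ubound; exists (mesh a b n (minn i n.+1)) => //.
by rewrite /= in_itv/= mab.
Qed.

Lemma measurable_sup_sq : measurable_fun setT (fun w => sup_sq (Y w) a b).
Proof.
rewrite (funext sup_sqE); apply: measurable_fun_esups => n.
apply: measurable_fun_esups => i; apply/measurable_EFinP.
by apply: measurable_funX; apply: mY; rewrite mesh_ge.
Qed.

(** The dominating variable is 1 plus the supremum of squares, from [|z| <= 1 + z ^+ 2]. *)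
Lemma path_dominated : (\int[P]_w sup_sq (Y w) a b < +oo)%E ->
  exists2 D : Omega -> R, P.-integrable setT (EFin \o D) &
  {ae P, forall w t, a <= t <= b -> `|Y w t| <= D w}.
Proof.
move=> soo; have s0 w : (0 <= sup_sq (Y w) a b)%E.
  apply: (@le_trans _ _ (Y w a ^+ 2)%:E); first by rewrite lee_fin sqr_ge0.
  by apply: ereal_sup_ubound; exists a; rewrite //= in_itv/= lexx ltW.
have mS := measurable_sup_sq.
have fin := ge0_integral_fin_ae mS s0 soo.
have iS : P.-integrable setT (fun w => sup_sq (Y w) a b).
  apply/integrableP; split=> //.
  by under eq_integral => w _ do rewrite gee0_abs//.
have i1 : P.-integrable setT (EFin \o (fun w => fine (sup_sq (Y w) a b))).
  exact: (integrable_fine iS).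
exists (fun w => 1 + fine (sup_sq (Y w) a b)).
  have ic : P.-integrable setT (EFin \o cst (1 : R)).
    by apply: (@integrable_bounded _ _ _ P _ 1) => // w; rewrite normr1.
  exact: (integrableD measurableT ic i1).
apply: filterS fin => w fw t tab.
have : ((Y w t ^+ 2)%:E <= sup_sq (Y w) a b)%E.
  by apply: ereal_sup_ubound; exists t; rewrite //= in_itv.
have -> : sup_sq (Y w) a b = (fine (sup_sq (Y w) a b))%:E.
  by rewrite fineK// ge0_fin_numE.
rewrite lee_fin/= => h; apply: le_trans (lerD (lexx 1) h).
rewrite -real_normK ?num_real//; have := normr_ge0 (Y w t).
move: `|Y w t| => z z0; nra.
Qed.

End path_supremum.

Section dominated_mean.
Context {R : realType} {d : measure_display} {Omega : measurableType d}.
Context (P : probability Omega R).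
Context (Y : Omega -> R -> R) (D : Omega -> R) (a b : R).
Hypotheses (iD : P.-integrable setT (EFin \o D))
  (mY : forall t : R, a <= t <= b -> measurable_fun setT (Y ^~ t))
  (Yc : forall w, cadlag_on a (Y w))
  (YD : {ae P, forall w (t : R), a <= t <= b -> `|Y w t| <= D w}).

Let YD_setT : {ae P, forall w, setT w -> forall t : R, a <= t <= b -> `|Y w t| <= D w}.
Proof. by apply: filterS YD => w wD _. Qed.

Lemma dominated_integrable (t : R) : a <= t <= b -> P.-integrable setT (EFin \o Y ^~ t).
Proof. exact: (@integrable_section _ _ R P setT measurableT Y a b D iD mY YD_setT). Qed.

Lemma dominated_mean_regular : regular (fun t => \int[P]_w Y w t) a b.
Proof.
split.
  exists (\int[P]_w `|D w|) => t.
  exact: (@norm_integral_section _ _ R P setT measurableT Y a b D iD mY YD_setT).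
apply: (@tag_continuous_integral _ _ R P setT measurableT Y a b D iD mY) => //.
by apply: aeW => w _; exact: cadlag_tag_continuous.
Qed.

End dominated_mean.

Section complete_fubini.
Context {R : realType} {d : measure_display} {Omega : measurableType d}.
Context (P : probability Omega R).
Hypothesis cP : forall N A, measurable N -> P N = 0%E -> A `<=` N -> measurable A.

(** Measurability of the path integral is derived here: it is an almost sure limit of Riemann sums,
    and the probability is complete. *)
Lemma Rintegral_Lint_complete (Y : Omega -> R -> R) (a b : R) (G : Omega -> R) :
  a <= b -> P.-integrable setT (EFin \o G) ->
  (forall u, a <= u <= b -> measurable_fun setT (Y ^~ u)) ->
  {ae P, forall w, tag_continuous true (Y w) a b} ->
  {ae P, forall w u, a <= u <= b -> `|Y w u| <= G w} ->
  P.-integrable setT (EFin \o (fun w => Lint a b (Y w))) /\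
  \int[P]_w Lint a b (Y w) = Lint a b (fun u => \int[P]_w Y w u).
Proof.
rewrite le_eqVlt => /predU1P[<- _ _ _ _|ab iG mY Yc YG].
  rewrite Lint_xx; have -> : (fun w => Lint a a (Y w)) = cst 0.
    by apply/funext => w; rewrite Lint_xx.
  rewrite Rintegral_prob_cst; split=> //.
  by apply: (@integrable_bounded _ _ _ P _ 0) => // w; rewrite normr0.
apply: (@Rintegral_Lint _ _ R P setT measurableT Y a b G) => //.
- by apply: filterS Yc => w.
- by apply: filterS YG => w.
apply/measurable_EFinP.
apply: (complete_ae_measurable_cvg cP (f_ := fun n w => (riemann_sum true (Y w) a b n)%:E)).
  move=> n; apply/measurable_EFinP; apply: measurable_sum => i.
  by apply: measurable_funM => //; apply: mY; rewrite mesh_ge// mesh_le// addn1.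
apply: filterS2 Yc YG => w wc wG; apply/fine_cvgP; split; first exact: nearW.
exact: (riemann_sum_cvg ab wG wc).
Qed.

End complete_fubini.

(** * Means of increments and of their windowed integrals *)

Section window_expectation.
Context {R : realType} {d : measure_display} {Omega : measurableType d}.
Context (P : probability Omega R).
Hypothesis cP : forall N A, measurable N -> P N = 0%E -> A `<=` N -> measurable A.
Implicit Types (a b q s t u v : R).
Context (r T c : R) (m : R -> R) (A : Omega -> R -> R -> R) (J : Omega -> R -> R)
  (G : Omega -> R).
Hypotheses (mr : regular m (-r) T) (iG : P.-integrable setT (EFin \o G))
  (mJ : forall v, -r <= v <= T -> measurable_fun setT (J ^~ v))
  (JA : {ae P, forall w a b, -r <= a -> a <= b -> b <= T -> A w a b = J w b - J w a})
  (Jc : {ae P, forall w, tag_continuous true (J w) (-r) T})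
  (JG : {ae P, forall w v, -r <= v <= T -> `|J w v| <= G w})
  (EJ : forall v, -r <= v <= T -> \int[P]_w J w v = c * Lint (-r) v m).

Let iJ v : -r <= v <= T -> P.-integrable setT (EFin \o J ^~ v).
Proof.
move=> vT; apply: (@integrable_section _ _ R P setT measurableT J (-r) T G) => //.
by apply: filterS JG => w wG _.
Qed.

Let dominated_increment :
  {ae P, forall w a b, -r <= a -> a <= b -> b <= T -> `|A w a b| <= 2 * G w}.
Proof.
apply: filterS2 JA JG => w wA wG a b ra ab bT; rewrite wA//.
rewrite (le_trans (ler_normB _ _))// mulr_natl mulr2n lerD// wG//.
  by rewrite bT (le_trans ra).
by rewrite ra (le_trans ab).
Qed.

Let mA a b : -r <= a -> a <= b -> b <= T -> measurable_fun setT (fun w => A w a b).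
Proof.
move=> ra ab bT.
apply: (complete_ae_measurable cP (f := fun w => J w b - J w a)).
  apply: measurable_funB; apply: mJ; first by rewrite bT (le_trans ra).
  by rewrite ra (le_trans ab).
by apply: filterS JA => w ->.
Qed.

(** Kept abstract because it serves both integrals of the equation: in time with [c = 1], over jumps
    with [c = kappa2]. Additivity of [A] holds only almost surely, so its measurability is borrowed
    from [J] by completeness. *)
Lemma expectation_increment a b : -r <= a -> a <= b -> b <= T ->
  P.-integrable setT (EFin \o (fun w => A w a b)) /\
  \int[P]_w A w a b = c * Lint a b m.
Proof.
move=> ra ab bT; have aT : -r <= a <= T by rewrite ra (le_trans ab).
have bT' : -r <= b <= T by rewrite bT (le_trans ra).
have i2G : P.-integrable setT (EFin \o (fun w => 2 * G w)).
  exact: integrable_Rscale.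
have [] := @Rdominated_convergence _ _ R P setT (fun _ w => J w b - J w a)
  (fun w => A w a b) (fun w => 2 * G w) measurableT _ (mA ra ab bT) _ i2G _.
- by move=> _; apply: measurable_funB; exact: mJ.
- by apply: filterS JA => w wA _; rewrite wA//; exact: cvg_cst.
- apply: filterS2 JA dominated_increment => w wA wG _ _; rewrite -wA//.
  exact: wG.
move=> iA cA; split=> //.
have <- : \int[P]_w (J w b - J w a) = \int[P]_w A w a b.
  by apply: (cvg_unique _ _ cA) => //; exact: cvg_cst.
rewrite RintegralB//; last 2 first.
- exact: iJ.
- exact: iJ.
rewrite !EJ// -mulrBr (@Lint_cat _ (-r) a b m)//; last first.
  exact: regularS (lexx _) bT mr.
by rewrite addrAC subrr add0r.
Qed.

(** As a function of [u] the window increment is [J (t + u) - J u], right-continuous along almost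
    every path, so the exchange through Riemann sums applies. *)
Lemma expectation_window q t (g : R -> R) : continuous g -> 0 <= q <= r -> 0 <= t <= T ->
  P.-integrable setT (EFin \o (fun w => Lint (-q) 0 (fun u => g u * A w u (t + u)))) /\
  \int[P]_w Lint (-q) 0 (fun u => g u * A w u (t + u)) =
  Lint (-q) 0 (fun u => g u * (c * Lint u (t + u) m)).
Proof.
move=> gc /andP[q0 qr] /andP[t0 tT].
have win u : -q <= u <= 0 -> [/\ -r <= u, u <= t + u & t + u <= T].
  move=> /andP[qu u0]; split; first by rewrite (le_trans _ qu)// lerN2.
    by rewrite lerDr.
  by rewrite (le_trans _ tT)// gerDl.
have [[M gM] _] := regular_continuous (-q) 0 gc.
have [] := @Rintegral_Lint_complete _ _ _ P cP (fun w u => g u * A w u (t + u))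
  (-q) 0 (fun w => M * (2 * G w)).
- by rewrite oppr_le0.
- by apply: integrable_Rscale => //; exact: integrable_Rscale.
- move=> u /win[h1 h2 h3]; apply: measurable_funM => //; exact: mA.
- apply: filterS2 JA Jc => w wA wc u s uab sab us su.
  have sE n : A w (s n) (t + s n) = J w (t + s n) - J w (s n).
    by case: (win _ (sab n)) => *; exact: wA.
  have [h1 h2 h3] : [/\ -r <= u, u <= t + u & t + u <= T].
    by apply: win; case/andP: uab => ? ?; rewrite !ltW.
  rewrite wA// (funext (fun n => congr1 (fun x => g (s n) * x) (sE n))).
  apply: cvgM; first exact: (cvg_comp _ _ su (gc u)).
  have /andP[uq u0] := uab.
  apply: cvgB; apply: wc => //.
  + rewrite (lt_le_trans _ h2) ?(le_lt_trans _ uq) ?lerN2//=.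
    by rewrite (lt_le_trans _ tT)// gtrDl.
  + by move=> n; case: (win _ (sab n)) => h4 h5 ->; rewrite (le_trans h4).
  + by move=> n; rewrite ltrD2l; exact: us.
  + by apply: cvgD => //; exact: cvg_cst.
  + by rewrite (le_lt_trans _ uq) ?lerN2//= (lt_le_trans u0)// (le_trans t0).
  + by move=> n; case: (win _ (sab n)) => -> h5 h6; rewrite (le_trans h5).
- apply: filterS dominated_increment => w wG u uq; rewrite normrM ler_pM ?gM//.
  by case: (win _ uq) => *; exact: wG.
move=> iL ->; split=> //; apply: Lint_eq => u uq; have [h1 h2 h3] := win _ uq.
have [iA <-] := expectation_increment h1 h2 h3.
by rewrite RintegralZl.
Qed.

End window_expectation.

(** * Means of the time and jump integrals of the solution *)

Section cumulative_expectations.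
Context {R : realType} {d : measure_display} {Omega : measurableType d}.
Implicit Types (a b s t u v : R).
Context (P : probability Omega R) (r : R) (F : R -> set (set Omega)).
Context (L : Omega -> R -> R) (Pi : {measure set R -> \bar R}).
Hypotheses (hF : filtration r F) (hL : centered_sq_levy P r F L).
Hypotheses (hPi : levy_measure Pi) (hLK : levy_khintchine_no_brownian P r L Pi).
Hypothesis cP : forall N A, measurable N -> P N = 0%E -> A `<=` N -> measurable A.
Context (X : Omega -> R -> R).
Hypotheses (Xad : adapted r F X) (Xc : forall w, cadlag_on (-r) (X w)).
Context (T : R) (D : Omega -> R).
Hypotheses (rT : -r < T) (iD : P.-integrable setT (EFin \o D))
  (XD : {ae P, forall w t, -r <= t <= T -> `|X w t| <= D w}).

Let m t := \int[P]_w X w t.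

Let mX t : -r <= t -> measurable_fun setT (X ^~ t).
Proof.
by move=> rt; exact: (measurable_wrt_measurable (filtration_measurable hF rt) (Xad rt)).
Qed.

Let mX_itv t : -r <= t <= T -> measurable_fun setT (X ^~ t).
Proof. by move=> /andP[rt _]; exact: mX. Qed.

Lemma integrable_value t : -r <= t <= T -> P.-integrable setT (EFin \o X ^~ t).
Proof. exact: (dominated_integrable iD mX_itv XD). Qed.

Lemma mean_regular : regular m (-r) T.
Proof. exact: (dominated_mean_regular iD mX_itv Xc XD). Qed.

Let path_regular : {ae P, forall w, regular (X w) (-r) T}.
Proof.
by apply: filterS XD => w wD; split; [exists (D w)|exact: cadlag_tag_continuous].
Qed.

Let Jt w v := Lint (-r) v (X w).

Let Jt_props v : -r <= v <= T -> measurable_fun setT (Jt ^~ v) /\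
  \int[P]_w Jt w v = 1 * Lint (-r) v m.
Proof.
move=> /andP[rv vT].
have mXv u : -r <= u <= v -> measurable_fun setT (X ^~ u) by move=> /andP[ru _]; exact: mX.
have Xv : {ae P, forall w, tag_continuous true (X w) (-r) v}.
  by apply: aeW => w; exact: cadlag_tag_continuous.
have Xvd : {ae P, forall w u, -r <= u <= v -> `|X w u| <= D w}.
  by apply: filterS XD => w wD u /andP[ru uv]; rewrite wD// ru (le_trans uv).
have [i ->] := Rintegral_Lint_complete cP rv iD mXv Xv Xvd.
by rewrite mul1r; split=> //; exact: integrable_measurable i.
Qed.

Let Jt_lip : {ae P, forall w s t, -r <= s -> s <= t -> t <= T ->
  Lint s t (X w) = Jt w t - Jt w s /\ `|Jt w t - Jt w s| <= D w * (t - s)}.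
Proof.
apply: filterS2 path_regular XD => w wr wD s t rs st tT.
have E : Lint s t (X w) = Jt w t - Jt w s.
  rewrite /Jt (@Lint_cat _ (-r) s t)//; last exact: regularS (lexx _) tT wr.
  by rewrite addrAC subrr add0r.
split=> //; rewrite -E; apply: Lint_norm_le => //; first exact: regularS rs tT wr.
by move=> u /andP[su ut]; rewrite wD// (le_trans rs)// (le_trans ut).
Qed.

Let Jt0 w : Jt w (-r) = 0. Proof. exact: Lint_xx. Qed.

Let iGt : P.-integrable setT (EFin \o (fun w => (T + r) * D w)).
Proof. exact: integrable_Rscale. Qed.

Let mJt v : -r <= v <= T -> measurable_fun setT (Jt ^~ v).
Proof. by case/Jt_props. Qed.

Let JtA : {ae P, forall w a b, -r <= a -> a <= b -> b <= T ->
  Lint a b (X w) = Jt w b - Jt w a}.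
Proof. by apply: filterS Jt_lip => w wl a b ra ab bT; case: (wl a b ra ab bT). Qed.

Let Jtc : {ae P, forall w, tag_continuous true (Jt w) (-r) T}.
Proof.
apply: filterS Jt_lip => w wl.
by apply: (@regular_Lipschitz _ _ (D w) _ _ _).2 => s t rs st tT; case: (wl s t).
Qed.

Let JtG : {ae P, forall w v, -r <= v <= T -> `|Jt w v| <= (T + r) * D w}.
Proof.
apply: filterS2 Jt_lip XD => w wl wD v /andP[rv vT].
have [_] := wl (-r) v (lexx _) rv vT; rewrite Jt0 subr0 => /le_trans; apply.
have D0 : 0 <= D w by rewrite (le_trans _ (wD v _))// rv.
by rewrite mulrC ler_wpM2r// opprK lerD2r.
Qed.

Let EJt v : -r <= v <= T -> \int[P]_w Jt w v = 1 * Lint (-r) v m.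
Proof. by case/Jt_props. Qed.

Lemma expectation_time a b : -r <= a -> a <= b -> b <= T ->
  P.-integrable setT (EFin \o (fun w => Lint a b (X w))) /\
  \int[P]_w Lint a b (X w) = Lint a b m.
Proof.
move=> ra ab bT; rewrite -[RHS]mul1r.
exact: (expectation_increment cP mean_regular iGt mJt JtA JtG EJt ra ab bT).
Qed.

Lemma expectation_time_window q t (g : R -> R) : continuous g ->
  0 <= q <= r -> 0 <= t <= T ->
  P.-integrable setT (EFin \o (fun w => Lint (-q) 0 (fun u => g u * Lint u (t + u) (X w)))) /\
  \int[P]_w Lint (-q) 0 (fun u => g u * Lint u (t + u) (X w)) =
  Lint (-q) 0 (fun u => g u * Lint u (t + u) m).
Proof.
move=> gc qr tT.
have [iW ->] := expectation_window cP mean_regular iGt mJt JtA Jtc JtG EJt gc qr tT.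
by split=> //; apply: Lint_eq => u _; rewrite mul1r.
Qed.

(** Positive part for [true], negative part for [false], the same split as in [jump_integral]; the
    compensation formula is proved for nonnegative integrands. *)
Let sgn_max (e : bool) (x : R) : R := Num.max (if e then x else - x) 0.
Let V (e : bool) w t : R := sgn_max e (X w t).

Let sgn_max_cont e : continuous (sgn_max e).
Proof.
case: e; first exact: continuous_maxr.
suff : continuous ((fun y : R => Num.max y 0) \o (-%R : R -> R) : R -> R) by [].
by move=> x; apply: continuous_comp; [exact: opp_continuous|exact: continuous_maxr].
Qed.

Let V0 e w t : 0 <= V e w t.
Proof. by rewrite /V /sgn_max le_max lexx orbT. Qed.

Let Vad e t : -r <= t -> measurable_wrt (F t) (V e ^~ t).
Proof.
move=> rt; apply: (measurable_wrt_comp (filtration_sigma hF rt) (g := sgn_max e)).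
  exact: continuous_measurable_fun.
exact: Xad.
Qed.

Let Vc e w : cadlag_on (-r) (V e w).
Proof. exact: (cadlag_comp (@sgn_max_cont e) (Xc w)). Qed.

Let left_lim_V e w s : -r < s ->
  left_lim (V e w) s = Num.max (if e then left_lim (X w) s else - left_lim (X w) s) 0.
Proof. by move=> rs; exact: (left_lim_comp (@sgn_max_cont e) (Xc w) rs). Qed.

Let VD e b : b <= T -> {ae P, forall w t, -r <= t <= b -> V e w t <= D w}.
Proof.
move=> bT; apply: filterS XD => w wD t /andP[rt tb].
have h := wD t; rewrite rt (le_trans tb bT) in h.
rewrite /V /sgn_max ge_max (le_trans (normr_ge0 _) (h isT)) andbT.
by case: e; apply: le_trans (h isT); rewrite ?ler_norm// -normrN ler_norm.
Qed.

Let W e w a b := weighted_jumps (V e w) (L w) a b.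

Let jump_integralE w a b : -r <= a ->
  jump_integral (X w) (L w) a b = fine (W true w a b - W false w a b)%E.
Proof.
move=> ra; rewrite /jump_integral; congr (fine (_ - _)%E); apply: eq_esum => s /=;
  by rewrite in_itv/= => /andP[as_ _]; rewrite left_lim_V// (le_lt_trans ra).
Qed.

(** Nonnegative at every real [s], whatever [left_lim] returns up to [-r]. *)
Let z e w s := if -r < s then left_lim (V e w) s * jump (L w) s ^+ 2 else 0.

Let z0 e w s : 0 <= z e w s.
Proof.
rewrite /z; case: ifPn => // rs; rewrite mulr_ge0 ?sqr_ge0//.
by apply: (left_lim_ge0 (Vc e w)).
Qed.

Let WE e w a b : -r <= a -> W e w a b = (\esum_(s in `]a, b]) (z e w s)%:E)%E.
Proof.
move=> ra; apply: eq_esum => s /=; rewrite in_itv/= /z => /andP[as_ _].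
by rewrite (le_lt_trans ra).
Qed.

Let W_ge0 e w a b : -r <= a -> (0 <= W e w a b)%E.
Proof. by move=> ra; rewrite WE//; apply: esum_ge0 => s _; rewrite lee_fin. Qed.

Let mW e b : -r < b <= T -> measurable_fun setT (fun w => W e w (-r) b).
Proof.
move=> /andP[rb bT].
exact: (measurable_weighted_jumps hF hL hPi hLK cP (@V0 e) (@Vad e) (@Vc e) (lexx _) rb).
Qed.

Let intW e b : -r < b <= T ->
  (\int[P]_w W e w (-r) b = (kappa2 Pi * Lint (-r) b (fun t => \int[P]_w V e w t))%:E)%E.
Proof.
move=> /andP[rb bT].
exact: (integral_weighted_jumps hF hL hPi hLK cP (@V0 e) (@Vad e) (@Vc e) (lexx _) rb iD (@VD e b bT)).
Qed.

Let iW e b : -r < b <= T -> P.-integrable setT (fun w => W e w (-r) b).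
Proof.
move=> bT; apply/integrableP; split; first exact: mW.
under eq_integral => w _ do rewrite gee0_abs ?W_ge0//.
by rewrite intW// ltry.
Qed.

(** Both parts have finite mean, so almost surely the difference in [jump_integral] is not of the
    form infinity minus infinity and [fine] is additive. *)
Let Wfin : {ae P, forall w, forall e, (W e w (-r) T < +oo)%E}.
Proof.
have h e : {ae P, forall w, (W e w (-r) T < +oo)%E}.
  apply: ge0_integral_fin_ae.
  - by apply: mW; rewrite rT lexx.
  - by move=> w; exact: W_ge0.
  - by rewrite intW ?rT ?lexx// ltry.
by apply: filterS2 (h true) (h false) => w h1 h2 [].
Qed.

Let Jj w v := fine (W true w (-r) v) - fine (W false w (-r) v).

Let W_split : {ae P, forall w, forall e a b, -r <= a -> a <= b -> b <= T ->
  W e w a b \is a fin_num /\ fine (W e w a b) = fine (W e w (-r) b) - fine (W e w (-r) a)}.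
Proof.
apply: filterS Wfin => w wf e a b ra ab bT.
have foo : (\esum_(s in `](-r)%R, T]) (z e w s)%:E < +oo)%E by rewrite -WE.
have f1 := Esum_itv_fine (z0 e w) foo bT.
have f2 := Esum_itv_fine (z0 e w) foo (le_trans ab bT).
have := Esum_itvU ra ab (z0 e w); rewrite -!WE// in f1 f2 *.
move=> E; have f3 : W e w a b \is a fin_num.
  by move: f1; rewrite E fin_numD => /andP[].
by split=> //; rewrite E fineD// addrAC subrr add0r.
Qed.

Let Jj0 w : Jj w (-r) = 0.
Proof. by rewrite /Jj /W /weighted_jumps set_itvoc0 !esum_set0 subrr. Qed.

Let JjA : {ae P, forall w a b, -r <= a -> a <= b -> b <= T ->
  jump_integral (X w) (L w) a b = Jj w b - Jj w a}.
Proof.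
apply: filterS W_split => w ws a b ra ab bT; rewrite jump_integralE//.
have [f1 e1] := ws true a b ra ab bT; have [f2 e2] := ws false a b ra ab bT.
by rewrite fineB// e1 e2 /Jj; ring.
Qed.

Let Jjc : {ae P, forall w, tag_continuous true (Jj w) (-r) T}.
Proof.
apply: filterS Wfin => w wf; apply: tag_continuous_right => u /andP[ru uT].
have h e : fine (W e w (-r) v) @[v --> u^'+] --> fine (W e w (-r) u).
  have foo : (\esum_(s in `](-r)%R, T]) (z e w s)%:E < +oo)%E by rewrite -WE.
  have := running_Esum_rcont (z0 e w) foo (u := u); rewrite ltW//= => /(_ uT).
  by under [X in _ -> X @ _ --> _]eq_fun do rewrite WE//; rewrite WE.
by apply: cvgB; exact: h.
Qed.

Let Gj w := fine (W true w (-r) T) + fine (W false w (-r) T).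

Let iGj : P.-integrable setT (EFin \o Gj).
Proof.
have TT : -r < T <= T by rewrite rT lexx.
exact: (integrableD measurableT (integrable_fine (@iW true T TT)) (integrable_fine (@iW false T TT))).
Qed.

Let JjG : {ae P, forall w v, -r <= v <= T -> `|Jj w v| <= Gj w}.
Proof.
apply: filterS2 W_split Wfin => w ws wf v /andP[rv vT].
have h e : 0 <= fine (W e w (-r) v) <= fine (W e w (-r) T).
  rewrite fine_ge0 ?W_ge0//=.
  have [_] := ws e v T rv vT (lexx _); have := fine_ge0 (W_ge0 e w T rv).
  lra.
have /andP[h1 h2] := h true; have /andP[h3 h4] := h false.
by rewrite /Jj /Gj ler_norml; apply/andP; split; lra.
Qed.

Let mJj v : -r <= v <= T -> measurable_fun setT (Jj ^~ v).
Proof.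
move=> /andP[]; rewrite le_eqVlt => /predU1P[<- _|rv vT].
  by rewrite (funext Jj0).
have vT' : -r < v <= T by rewrite rv.
by apply: measurable_funB; apply: integrable_measurable; apply: integrable_fine; exact: iW vT'.
Qed.

Let mV e t : -r <= t <= T -> measurable_fun setT (V e ^~ t).
Proof.
move=> /andP[rt _].
exact: (measurable_wrt_measurable (filtration_measurable hF rt) (Vad e rt)).
Qed.

Let Vn e : {ae P, forall w t, -r <= t <= T -> `|V e w t| <= D w}.
Proof. by apply: filterS (VD e (lexx T)) => w wD t tT; rewrite ger0_norm// wD. Qed.

Let iV e t : -r <= t <= T -> P.-integrable setT (EFin \o V e ^~ t).
Proof. exact: (dominated_integrable iD (@mV e) (Vn e)). Qed.

Let V_regular e : regular (fun t => \int[P]_w V e w t) (-r) T.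
Proof. exact: (dominated_mean_regular iD (@mV e) (@Vc e) (Vn e)). Qed.

(** Compensation is applied to each part, and the means of the two parts recombine into [m]. *)
Let EJj v : -r <= v <= T -> \int[P]_w Jj w v = kappa2 Pi * Lint (-r) v m.
Proof.
move=> /andP[]; rewrite le_eqVlt => /predU1P[<- _|rv vT].
  by under eq_Rintegral do rewrite Jj0; rewrite Rintegral_prob_cst Lint_xx mulr0.
have vT' : -r < v <= T by rewrite rv.
have fineE e : \int[P]_w fine (W e w (-r) v) =
    kappa2 Pi * Lint (-r) v (fun t => \int[P]_w V e w t).
  rewrite /Rintegral -[RHS]/(fine (_ : R)%:E) -intW//; congr fine.
  apply: ae_eq_integral => //.
  - exact: measurable_int (integrable_fine (@iW e v vT')).
  - exact: mW.
  - apply: filterS W_split => w ws _; have [f _] := ws e (-r) v (lexx _) (ltW rv) vT.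
    by rewrite fineK.
rewrite RintegralB//; [|exact: integrable_fine (iW _ vT')..].
rewrite !fineE -mulrBr -LintB.
- congr (_ * _); apply: Lint_eq => t /andP[rt tv].
  have tT : -r <= t <= T by rewrite rt (le_trans tv).
  rewrite -RintegralB//; [|exact: iV..].
  apply: eq_Rintegral => w _; rewrite /V /sgn_max /=.
  by case: (leP (X w t) 0) => x0; case: (leP (- X w t) 0) => x1; lra.
- exact: regularS (lexx _) vT (V_regular true).
- exact: regularS (lexx _) vT (V_regular false).
Qed.

Lemma expectation_jump a b : -r <= a -> a <= b -> b <= T ->
  P.-integrable setT (EFin \o (fun w => jump_integral (X w) (L w) a b)) /\
  \int[P]_w jump_integral (X w) (L w) a b = kappa2 Pi * Lint a b m.
Proof. exact: (expectation_increment cP mean_regular iGj mJj JjA JjG EJj). Qed.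

Lemma expectation_jump_window q t (g : R -> R) : continuous g ->
  0 <= q <= r -> 0 <= t <= T ->
  P.-integrable setT (EFin \o
    (fun w => Lint (-q) 0 (fun u => g u * jump_integral (X w) (L w) u (t + u)))) /\
  \int[P]_w Lint (-q) 0 (fun u => g u * jump_integral (X w) (L w) u (t + u)) =
  Lint (-q) 0 (fun u => g u * (kappa2 Pi * Lint u (t + u) m)).
Proof.
exact: (expectation_window cP mean_regular iGj mJj JjA Jjc JjG EJj).
Qed.

End cumulative_expectations.

(** * The integral equation for the mean *)

Section mean_of_solution.
Context {R : realType} {d : measure_display} {Omega : measurableType d}.
Implicit Types (a b s t u v T : R).
Context (P : probability Omega R) (F : R -> set (set Omega)).
Context (p q r eta c_mu c_nu : R) (f_mu f_nu : R -> R).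
Context (L Phi X : Omega -> R -> R) (Pi : {measure set R -> \bar R}).
Hypotheses (p0 : 0 <= p) (q0 : 0 <= q) (pr : p <= r) (qr : q <= r) (r0 : 0 < r).
Hypotheses (fc_mu : continuous f_mu) (fs_mu : forall u, ~ (-p <= u <= 0) -> f_mu u = 0).
Hypotheses (fc_nu : continuous f_nu) (fs_nu : forall u, ~ (-q <= u <= 0) -> f_nu u = 0).
Hypotheses (hF : filtration r F) (hU : usual_conditions P r F).
Hypothesis hL : centered_sq_levy P r F L.
Hypotheses (hPi : levy_measure Pi) (hLK : levy_khintchine_no_brownian P r L Pi).
Hypothesis hX : strong_solution P p q r eta c_mu c_nu f_mu f_nu F Phi L X.

Let m t := \int[P]_w X w t.
Let f u := f_mu u + kappa2 Pi * f_nu u.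

Let cP : forall N A, measurable N -> P N = 0%E -> A `<=` N -> measurable A.
Proof. by case: hU. Qed.

Let Xad : adapted r F X. Proof. by case: hX. Qed.
Let Xc w : cadlag_on (-r) (X w). Proof. by case: hX. Qed.

Let mX t : -r <= t -> measurable_fun setT (X ^~ t).
Proof.
by move=> rt; exact: (measurable_wrt_measurable (filtration_measurable hF rt) (Xad rt)).
Qed.

Let X_dominated T : -r < T -> exists2 D : Omega -> R, P.-integrable setT (EFin \o D) &
  {ae P, forall w t, -r <= t <= T -> `|X w t| <= D w}.
Proof.
move=> rT; apply: (path_dominated rT Xc mX).
by case: hX => _ _ + _; apply; exact: ltW.
Qed.

Lemma solution_integrable t : -r <= t -> P.-integrable setT (EFin \o X ^~ t).
Proof.
(* The horizon goes past [t] because domination needs a nondegenerate interval and [t] may be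
   [-r]. *)
move=> rt; have rt1 : -r < t + 1 by rewrite (le_lt_trans rt)// ltrDl.
have [D iD XD] := X_dominated rt1.
by apply: (integrable_value hF Xad iD XD); rewrite rt/= lerDl.
Qed.

Lemma solution_mean_regular T : regular m (-r) T.
Proof.
have rT : -r < Num.max T 0 by rewrite lt_max oppr_lt0 r0 orbT.
have [D iD XD] := X_dominated rT.
apply: (regularS (lexx _) _ (mean_regular hF Xad Xc iD XD)).
by rewrite le_max lexx.
Qed.

Let Phi_ae : {ae P, forall w, forall s, -r <= s -> s <= 0 -> X w s = Phi w s}.
Proof. by case: hX => _ _ _; apply: filterS => w []. Qed.

Lemma solution_mean_initial u : -r <= u <= 0 -> m u = \int[P]_w Phi w u.
Proof.
move=> /andP[ru u0]; have XP : {ae P, forall w, X w u = Phi w u}.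
  by apply: filterS Phi_ae => w; apply.
rewrite /m /Rintegral; congr fine; apply: ae_eq_integral => //.
- by apply/measurable_EFinP; exact: mX.
- by apply/measurable_EFinP; apply: complete_ae_measurable XP => //; exact: mX.
- by apply: filterS XP => w -> _.
Qed.

Lemma solution_mean_equation t : 0 <= t ->
  m t = m 0 + eta * t - (c_mu - kappa2 Pi * c_nu) * Lint 0 t m +
        Lint (-r) 0 (fun u => f u * Lint u (t + u) m).
Proof.
move=> t0; set k := kappa2 Pi.
have r0' : -r <= 0 by rewrite oppr_le0 ltW.
have rT : -r < t + 1 by rewrite (le_lt_trans r0')// ltr_wpDl.
have tT : 0 <= t <= t + 1 by rewrite t0/= lerDl ler01.
have [D iD XD] := X_dominated rT.
have p0r : 0 <= p <= r by rewrite p0.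
have q0r : 0 <= q <= r by rewrite q0.
have [iA EA] := expectation_time_window hF cP Xad Xc iD XD fc_mu p0r tT.
have [iB EB] := expectation_time hF cP Xad Xc iD XD r0' t0 (proj2 (andP tT)).
have [iC EC] := expectation_jump_window hF hL hPi hLK cP Xad Xc rT iD XD fc_nu q0r tT.
have [iE EE] := expectation_jump hF hL hPi hLK cP Xad Xc rT iD XD r0' t0 (proj2 (andP tT)).
have i0 := solution_integrable r0'.
have it : P.-integrable setT (EFin \o X ^~ t) by exact: solution_integrable (le_trans r0' t0).
pose A w := Lint (-p) 0 (fun u => f_mu u * Lint u (t + u) (X w)).
pose B w := Lint 0 t (X w).
pose C w := Lint (-q) 0 (fun u => f_nu u * jump_integral (X w) (L w) u (t + u)).
pose E w := jump_integral (X w) (L w) 0 t.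
have iBc : P.-integrable setT (EFin \o (fun w => c_mu * B w)) by exact: integrable_Rscale.
have iEc : P.-integrable setT (EFin \o (fun w => c_nu * E w)) by exact: integrable_Rscale.
have iAB : P.-integrable setT (EFin \o (fun w => A w - c_mu * B w)).
  exact: (integrableB measurableT iA iBc).
have iCE : P.-integrable setT (EFin \o (fun w => C w + c_nu * E w)).
  exact: (integrableD measurableT iC iEc).
have ic : P.-integrable setT (EFin \o cst (eta * t)).
  by apply: (@integrable_bounded _ _ _ P _ `|eta * t|) => // w; rewrite lexx.
have i0c : P.-integrable setT (EFin \o (fun w => X w 0 + eta * t)).
  exact: (integrableD measurableT i0 ic).
have i1 : P.-integrable setT (EFin \o (fun w => X w 0 + eta * t + (A w - c_mu * B w))).
  exact: (integrableD measurableT i0c iAB).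
have -> : m t = \int[P]_w (X w 0 + eta * t + (A w - c_mu * B w) + (C w + c_nu * E w)).
  rewrite /m /Rintegral; congr fine; apply: ae_eq_integral => //.
  - exact: measurable_int it.
  - exact: measurable_int (integrableD measurableT i1 iCE).
  case: hX => _ _ _; apply: filterS => w [XPhi Xeq] _.
  rewrite Xeq// /cdgarch_rhs XPhi//; congr ((_ + _ + _)%:E).
  (* For [t >= 0] the first branch of [theta] is reached only at [t = 0], where [eta * t]
     vanishes. *)
  rewrite /theta; case: ifPn => // tle.
  have -> : t = 0 by apply/eqP; rewrite eq_le tle.
  by rewrite mulr0 addr0.
rewrite RintegralD// RintegralD// RintegralD// RintegralB// RintegralD//.
rewrite Rintegral_prob_cst !RintegralZl// EA EB EC EE -/(m 0).
have mr := solution_mean_regular t.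
have wr : regular (fun u => Lint u (t + u) m) (-r) 0 by exact: regular_window.
(* Both windows are widened to [[-r, 0]], at no cost by the supports, so that the two kernels can be
   added into [f]. *)
have eA : Lint (-p) 0 (fun u => f_mu u * Lint u (t + u) m) =
          Lint (-r) 0 (fun u => f_mu u * Lint u (t + u) m).
  apply/esym/Lint_restrict; rewrite ?lerN2// => u _ /negP nu.
  by rewrite fs_mu// mul0r.
have eC : Lint (-q) 0 (fun u => f_nu u * (k * Lint u (t + u) m)) =
          Lint (-r) 0 (fun u => f_nu u * (k * Lint u (t + u) m)).
  apply/esym/Lint_restrict; rewrite ?lerN2// => u _ /negP nu.
  by rewrite fs_nu// mul0r.
rewrite eA eC.
have -> : Lint (-r) 0 (fun u => f u * Lint u (t + u) m) =
    Lint (-r) 0 (fun u => f_mu u * Lint u (t + u) m) +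
    Lint (-r) 0 (fun u => f_nu u * (k * Lint u (t + u) m)).
  rewrite -LintD.
  - by apply: Lint_eq => u _; rewrite /f -/k; ring.
  - by apply: regularM => //; exact: regular_continuous.
  - by apply: regularM; [exact: regular_continuous|exact: regularZ].
rewrite -/k; ring.
Qed.

End mean_of_solution.

Theorem theorem5p2 (R : realType) (d : measure_display) (Omega : measurableType d)
    (P : probability Omega R) (F : R -> set (set Omega))
    (p q r eta c_mu c_nu : R) (f_mu f_nu : R -> R)
    (L Phi X : Omega -> R -> R) (Pi : {measure set R -> \bar R}) :
  (* parameters *)
  0 <= p -> 0 <= q -> r = Num.max p q -> 0 < r ->
  0 < eta -> 0 < c_mu -> 0 < c_nu ->
  (forall u : R, 0 <= f_mu u) -> continuous f_mu ->
  (forall u : R, ~ (-p <= u <= 0) -> f_mu u = 0) ->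
  (forall u : R, 0 <= f_nu u) -> continuous f_nu ->
  (forall u : R, ~ (-q <= u <= 0) -> f_nu u = 0) ->
  (* filtered probability space and Levy process *)
  filtration r F -> usual_conditions P r F ->
  centered_sq_levy P r F L ->
  levy_measure Pi -> levy_khintchine_no_brownian P r L Pi ->
  (* hypotheses of the theorem *)
  (forall u : R, -r <= u <= 0 -> measurable_wrt (natural_filtration P r L u) (Phi^~ u)) ->
  (\int[P]_w sup_sq (Phi w) (-r) 0 < +oo)%E ->
  (\int[P]_w ((L w 1) ^+ 4)%:E < +oo)%E ->
  strong_solution P p q r eta c_mu c_nu f_mu f_nu F Phi L X ->
  (forall u : R, -r <= u <= 0 -> 0 < expect P (Phi^~ u)) ->
  let kappa2 : R := fine (\int[Pi]_z (z ^+ 2)%:E) in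
  let m : R -> R := fun t => expect P (X^~ t) in
  let phi : R -> R := fun u => expect P (Phi^~ u) in
  let c0 : R := c_mu - kappa2 * c_nu in
  let f : R -> R := fun u => f_mu u + kappa2 * f_nu u in
  let zeta : R -> R := fun t =>
    - c0 * (if 0 < t then 1 else 0) + Lint 0 (Num.min t r) (fun u => f (- u)) in
  let h : R -> R := fun t =>
    m 0 + eta / zeta r * Lint 0 t zeta
    + Lint 0 r (fun u => (zeta (t + u) - zeta u) * (m (- u) + eta / zeta r)) in
  (* (a) *)
  ((forall t : R, -r <= t -> P.-integrable setT (fun w => (X w t)%:E)) /\
   (forall t : R, 0 < t -> derivable m t 1) /\
   (forall t : R, 0 < t -> derive1 m x @[x --> t] --> derive1 m t) /\
   (forall t : R, 0 < t ->
      derive1 m t = eta - c0 * m t + Lint (-r) 0 (fun u => m (t + u) * f u)) /\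
   (forall u : R, -r <= u <= 0 -> m u = phi u)) /\
  (* (b) *)
  (zeta r != 0 ->
   (forall t : R, 0 < t -> m t = Lint 0 t (fun u => zeta (t - u) * m u) + h t) /\
   m 0 = phi 0).
Proof.
move=> p0 q0 rE r0 _ _ _ _ fc_mu fs_mu _ fc_nu fs_nu hF hU hL hPi hLK _ _ _ hX _.
move=> k m phi c0 f zeta h.
have pr : p <= r by rewrite rE le_max lexx.
have qr : q <= r by rewrite rE le_max lexx orbT.
have fc : continuous f.
  move=> x; apply: cvgD; first exact: fc_mu.
  by apply: cvgM; [exact: cvg_cst|exact: fc_nu].
have fs u : ~ (-r <= u <= 0) -> f u = 0.
  move=> nu; rewrite /f fs_mu ?fs_nu ?mulr0 ?addr0// => /andP[xu u0]; apply: nu;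
    by rewrite u0 (le_trans _ xu)// lerN2.
have mr : forall T, regular m (-r) T := solution_mean_regular r0 hF hX.
have eqm : forall t, 0 <= t -> m t = m 0 + eta * t - c0 * Lint 0 t m +
    Lint (-r) 0 (fun u => f u * Lint u (t + u) m) :=
  solution_mean_equation p0 q0 pr qr r0 fc_mu fs_mu fc_nu fs_nu hF hU hL hPi hLK hX.
have mphi : forall u, -r <= u <= 0 -> m u = phi u :=
  solution_mean_initial hF hU hX.
split; last first.
  move=> zr; split; last by apply: mphi; rewrite lexx oppr_le0 ltW.
  by move=> t t0; exact: (delay_renewal r0 fc fs mr eqm t0 zr).
split; first exact: (solution_integrable hF hX).
split; first by move=> t t0; exact: (delay_derivable r0 fc fs mr eqm t0).
split; first by move=> t t0; exact: (delay_derive1_continuous r0 fc fs mr eqm t0).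
by split=> // t t0; exact: (delay_derive1E r0 fc fs mr eqm t0).
Qed.
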